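(* Let $D$ be a central division algebra over a non-archimedean local field $F$, and let $\tau_1$ and $\tau_2$ be two irreducible smooth depth-zero representations of $D^\times$. Then the restriction of the natural quotient map $\tau_1\times\tau_2\to(\tau_1\times\tau_2)_{N,\psi}$ to the subspace $(\tau_1\times\tau_2)^{I(1),\psi_0}$, $$(\tau_1\times\tau_2)^{I(1),\psi_0}\longrightarrow(\tau_1\times\tau_2)_{N,\psi},$$ is an isomorphism of $D^\times$-representations.
   Context: All representations are smooth and complex. $F$ has ring of integers $\mathfrak{o}_F$ with maximal ideal $\mathfrak{p}_F$ and residue field $\mathbb{F}_q$. $D$ has index $n$, maximal order $\mathfrak{o}_D$, maximal ideal $\mathfrak{p}_D\subseteq\mathfrak{o}_D$, and uniformizer $\varpi_D$. A representation of $D^\times$ is depth-zero (tamely ramified) if it is trivial on $D(1)=1+\mathfrak{p}_D$. Let $G=\mathrm{GL}_2(D)$, $B\subseteq G$ the subgroup of upper triangular matrices, $N\subseteq B$ the subgroup of upper triangular unipotent matrices, $T\subseteq B$ the diagonal matrices; $D^\times$ is embedded diagonally in $T$. $\tau_1\times\tau_2$ denotes the normalized parabolic induction of $\tau_1\otimes\tau_2$ from $B$ to $G$. $I$ is the standard Iwahori subgroup of $G$ (matrices in $\mathrm{GL}_2(\mathfrak{o}_D)$ that are upper triangular modulo $\mathfrak{p}_D$) and $I(1)$ is its pro-$p$ radical (matrices in $I$ with diagonal entries in $1+\mathfrak{p}_D$). Fix an additive character $\psi_F:F\to\mathbb{C}^\times$ which is non-trivial on $\mathfrak{o}_F$ and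 trivial on $\mathfrak{p}_F$. Put $\psi=\psi_F\circ\mathrm{Tr}_{D/F}$ ($\mathrm{Tr}_{D/F}$ the reduced trace), a character of $D$ that is non-trivial on $\mathfrak{o}_D$ and trivial on $\mathfrak{p}_D$; it is viewed as a character of $N$ by $\begin{pmatrix}1&x\\0&1\end{pmatrix}\mapsto\psi(x)$. The map $\begin{pmatrix}a&b\\ \varpi_Dc&d\end{pmatrix}\mapsto\psi(b)$ defines a non-trivial character $\psi_0$ of $I(1)$. For a smooth representation $V$ of $I(1)$, $V^{I(1),\psi_0}=\{v\in V: gv=\psi_0(g)v\ \text{for all } g\in I(1)\}$; if $V$ is a smooth $G$-representation this space is stable under $D^\times$. For a smooth representation $(\pi,V)$ of $G$, $V_{N,\psi}$ is the quotient of $V$ by the span of $\{\pi(n)v-\psi(n)v: v\in V,n\in N\}$, regarded as a representation of $\mathrm{Stab}_T(\psi)=D^\times$. *)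

(* Defs.v *)
From HB Require Import structures.
From mathcomp Require Import all_boot all_order all_algebra falgebra.
From mathcomp Require Import generic_quotient ring_quotient.
From mathcomp Require Import boolp classical_sets functions reals complex freeg.

Set Implicit Arguments.
Unset Strict Implicit.
Unset Printing Implicit Defensive.

Import Order.TTheory GRing.Theory Num.Theory.

Local Open Scope ring_scope.

(* The group of two-sided units of a possibly noncommutative ring. It is used
   both for D^* and for GL_2(D), whose matrix ring is not a unitRingType. *)
Section UnitGroup.
Variable R : nzRingType.

Definition is_unit (x : R) : bool := `[< exists y, y * x = 1 /\ x * y = 1 >].

Record unit_group := UnitGroup { uval : R; uvalP : is_unit uval }.

HB.instance Definition _ := [isSub for uval].
HB.instance Definition _ := [Choice of unit_group by <:].

Implicit Types u w : unit_group.

Definition uinv_val u : R := xget 1 [set y | y * val u = 1 /\ val u * y = 1]%classic.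

Fact uinv_valP u : uinv_val u * val u = 1 /\ val u * uinv_val u = 1.
Proof.
have /asboolP[y Hy] := uvalP u.
by rewrite /uinv_val; case: xgetP => [z _ //|/(_ y)].
Qed.

Fact is_unit1 : is_unit 1.
Proof. by apply/asboolP; exists 1; rewrite mulr1. Qed.

Fact is_unitM u w : is_unit (val u * val w).
Proof.
apply/asboolP; exists (uinv_val w * uinv_val u).
have [u1 u2] := uinv_valP u; have [w1 w2] := uinv_valP w; split.
  by rewrite mulrA -(mulrA _ _ (val u)) u1 mulr1 w1.
by rewrite mulrA -(mulrA _ (val w)) w2 mulr1 u2.
Qed.

Fact is_unitV u : is_unit (uinv_val u).
Proof. by apply/asboolP; exists (val u); have [] := uinv_valP u. Qed.

Definition unit1 := UnitGroup is_unit1.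
Definition unitM u w := UnitGroup (is_unitM u w).
Definition unitV u := UnitGroup (is_unitV u).

Fact unitMA : associative unitM.
Proof. by move=> x y z; apply: val_inj; rewrite /= mulrA. Qed.
Fact unit1M : left_id unit1 unitM.
Proof. by move=> x; apply: val_inj; rewrite /= mul1r. Qed.
Fact unitM1 : right_id unit1 unitM.
Proof. by move=> x; apply: val_inj; rewrite /= mulr1. Qed.
Fact unitVM : left_inverse unit1 unitV unitM.
Proof. by move=> x; apply: val_inj; have [] := uinv_valP x. Qed.
Fact unitMV : right_inverse unit1 unitV unitM.
Proof. by move=> x; apply: val_inj; have [] := uinv_valP x. Qed.

HB.instance Definition _ :=
  isGroup.Build unit_group unitMA unit1M unitM1 unitVM unitMV.

End UnitGroup.

Section Modules.
Variables (K : fieldType) (V : lmodType K).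

Definition lspan (A : set V) : {pred V} := fun x =>
  `[< exists (m : nat) (c : 'I_m -> K) (u : 'I_m -> V),
        (forall i, A (u i)) /\ x = \sum_i c i *: u i >].

Fact lspan_submod A : submod_closed (lspan A).
Proof.
split=> [|a x y].
  by apply/asboolP; exists 0, (fun=> 0), (fun=> 0); split=> [[]//|]; rewrite big_ord0.
move=> /asboolP[m [c [u [Au ->]]]] /asboolP[m' [c' [u' [Au' ->]]]].
apply/asboolP; exists (m + m')%N.
exists (fun i => match fintype.split i with inl j => a * c j | inr j => c' j end).
exists (fun i => match fintype.split i with inl j => u j | inr j => u' j end).
split=> [i|]; first by case: (fintype.split i).
rewrite big_split_ord /= scaler_sumr; congr (_ + _); apply: eq_bigr => i _.
  by rewrite (unsplitK (inl i)) scalerA.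
by rewrite (unsplitK (inr i)).
Qed.

HB.instance Definition _ A :=
  GRing.isSubmodClosed.Build K V (lspan A) (lspan_submod A).

Variable S : submodClosed V.

Record submod := Submod { submod_val : V; submod_valP : submod_val \in S }.

HB.instance Definition _ := [isSub for submod_val].
HB.instance Definition _ := [Choice of submod by <:].
HB.instance Definition _ := [SubChoice_isSubLmodule of submod by <:].

(* submodClosed does not provide closure under opposites by itself. *)
Definition zpred : {pred V} := fun x => x \in S.

Fact zpred_zmod : zmod_closed zpred.
Proof.
by split=> [|x y Sx Sy]; [exact: (rpred0 S)|apply: (rpredD Sx); rewrite -scaleN1r rpredZ].
Qed.

HB.instance Definition _ := GRing.isZmodClosed.Build V zpred zpred_zmod.

Definition qmod := Quotient.quot zpred.

HB.instance Definition _ := GRing.Zmodule.on qmod.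
HB.instance Definition _ := EqQuotient.on qmod.

Definition qproj (x : V) : qmod := \pi_(qmod)%qT x.

Fact qproj_eq x y : (qproj x = qproj y) <-> (x - y \in S).
Proof. by have := Quotient.idealrBE zpred x y; rewrite {1}/in_mem /= /zpred => ->; split=> /eqP. Qed.

Fact qprojD : {morph qproj : x y / x + y}.
Proof. by move=> x y; rewrite /qproj Quotient.pi_add. Qed.

Definition qscale (a : K) (z : qmod) : qmod := qproj (a *: repr z).

Fact qscaleE a x : qscale a (qproj x) = qproj (a *: x).
Proof.
by apply/qproj_eq; rewrite -scalerBr; apply: rpredZ; apply/qproj_eq; rewrite /qproj reprK.
Qed.

Fact qproj_surj (z : qmod) : exists x, qproj x = z.
Proof. by exists (repr z); rewrite /qproj reprK. Qed.

Fact qscaleA a b z : qscale a (qscale b z) = qscale (a * b) z.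
Proof. by have [x <-] := qproj_surj z; rewrite !qscaleE scalerA. Qed.
Fact qscale1 : left_id 1 qscale.
Proof. by move=> z; have [x <-] := qproj_surj z; rewrite qscaleE scale1r. Qed.
Fact qscaleDr : right_distributive qscale +%R.
Proof.
move=> a z w; have [x <-] := qproj_surj z; have [y <-] := qproj_surj w.
by rewrite -qprojD !qscaleE scalerDr qprojD.
Qed.
Fact qscaleDl z : {morph qscale^~ z : a b / a + b}.
Proof.
by move=> a b; have [x <-] := qproj_surj z; rewrite !qscaleE scalerDl qprojD.
Qed.

HB.instance Definition _ := GRing.Zmodule_isLmodule.Build K qmod
  qscaleA qscale1 qscaleDr qscaleDl.

Fact qproj_linear : linear qproj.
Proof. by move=> a x y; rewrite qprojD; congr (_ + _); exact/esym/qscaleE. Qed.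

HB.instance Definition _ :=
  GRing.isSemilinear.Build K V qmod _ qproj (GRing.semilinear_linear qproj_linear).

End Modules.

Section Representations.
Variable K : fieldType.

Record rep (G : groupType) (V : lmodType K) := Rep {
  rep_act :> G -> V -> V;
  rep_linear : forall g, linear (rep_act g);
  rep1 : forall x, rep_act 1%g x = x;
  repM : forall g h x, rep_act (g * h)%g x = rep_act g (rep_act h x) }.

HB.instance Definition _ G V (r : rep G V) g :=
  GRing.isSemilinear.Build K V V _ (rep_act r g)
    (GRing.semilinear_linear (rep_linear r g)).

Definition stable (G : groupType) (V : lmodType K) (r : rep G V) (S : {pred V}) :=
  forall g, {in S, forall x, r g x \in S}.

Definition irreducible (G : groupType) (V : lmodType K) (r : rep G V) :=
  (exists x : V, x != 0) /\
  forall S : submodClosed V, stable r S ->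
    (forall x, x \in S -> x = 0) \/ (forall x, x \in S).

Definition rep_iso (G : groupType) (V W : lmodType K) (r : rep G V) (s : rep G W)
    (phi : V -> W) :=
  [/\ linear phi, bijective phi & forall g x, phi (r g x) = s g (phi x)].

Section Constructions.
Variables (G : groupType) (V : lmodType K) (r : rep G V).

Section Restriction.
Variables (H : groupType) (f : {multiplicative H -> G}) (f1 : f 1%g = 1%g).

Definition res_rep : rep H V.
Proof.
refine (@Rep H V (fun h => r (f h)) _ _ _) => [h|x|g h x].
- exact: rep_linear.
- by rewrite f1 rep1.
- by rewrite gmulfM repM.
Defined.
End Restriction.

Variables (S : submodClosed V) (hS : stable r S).

Definition sub_act g (x : submod S) : submod S := Submod (hS g (submod_valP x)).

Definition sub_rep : rep G (submod S).
Proof.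
refine (@Rep G (submod S) sub_act _ _ _) => [g a x y|x|g h x]; apply: val_inj => /=.
- by rewrite linearP.
- exact: rep1.
- exact: repM.
Defined.

Definition quot_act g (z : qmod S) : qmod S := qproj S (r g (repr z)).

Fact quot_actE g x : quot_act g (qproj S x) = qproj S (r g x).
Proof.
apply/qproj_eq; rewrite -linearB; apply: hS.
by apply/qproj_eq; rewrite /qproj reprK.
Qed.

Definition quot_rep : rep G (qmod S).
Proof.
refine (@Rep G (qmod S) quot_act _ _ _) => [g a z w|z|g h z].
- have [x <-] := qproj_surj z; have [y <-] := qproj_surj w.
  by rewrite -linearP !quot_actE !linearP.
- by have [x <-] := qproj_surj z; rewrite quot_actE rep1.
- by have [x <-] := qproj_surj z; rewrite !quot_actE repM.
Defined.

End Constructions.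
End Representations.

(* The tensor product over K of two arbitrary (possibly infinite-dimensional)
   spaces: the free space on V * W modulo the bilinearity relations. *)
Section Tensor.
Variable K : fieldType.

Section Def.
Variables V W : lmodType K.

Definition free_mod : lmodType K := {freeg (V * W)%type / K}.
Definition gen (x : V) (y : W) : free_mod := << (x, y) >>.

Definition tensor_rel : set free_mod := [set z |
  (exists a x x' y, z = gen (a *: x + x') y - (a *: gen x y + gen x' y)) \/
  (exists a x y y', z = gen x (a *: y + y') - (a *: gen x y + gen x y'))]%classic.

Definition tensor : lmodType K := qmod (lspan tensor_rel).
Definition pure (x : V) (y : W) : tensor := qproj (lspan tensor_rel) (gen x y).

End Def.

Section Map.
Variables (V W V' W' : lmodType K) (f : V -> V') (g : W -> W').

Definition free_map (z : free_mod V W) : free_mod V' W' :=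
  fglift (fun p => gen (f p.1) (g p.2)) z.

Definition tensor_map (z : tensor V W) : tensor V' W' :=
  qproj (lspan (@tensor_rel V' W')) (free_map (repr z)).

Fact free_map_gen x y : free_map (gen x y) = gen (f x) (g y).
Proof. by rewrite /free_map /gen liftU scale1r. Qed.

Fact free_mapB : {morph free_map : z w / z - w}.
Proof. exact: lift_is_additive. Qed.

Fact free_map0 : free_map 0 = 0.
Proof. by rewrite -[0 in LHS](subrr 0) free_mapB subrr. Qed.

Fact free_mapD : {morph free_map : z w / z + w}.
Proof. by move=> z w; rewrite -{1}[w]opprK -[- w]sub0r !free_mapB free_map0 sub0r opprK. Qed.

Fact free_mapZ a z : free_map (a *: z) = a *: free_map z.
Proof.
have sumE (s : seq (V * W)) (F : V * W -> free_mod V W) :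
    free_map (\sum_(p <- s) F p) = \sum_(p <- s) free_map (F p).
  exact: (big_morph _ free_mapD free_map0).
have U k p : free_map << k *g p >> = k *: gen (f p.1) (g p.2).
  by rewrite /free_map liftU.
have UZ k (p : V * W) : a *: (<< k *g p >> : free_mod V W) = << (a * k) *g p >>.
  by apply/eqP/freeg_eqP => p'; rewrite coeffZ !coeffU mulrA.
rewrite -[z]freeg_sumE scaler_sumr !sumE scaler_sumr.
by apply: eq_bigr => p _; rewrite UZ !U scalerA.
Qed.

Hypotheses (f_lin : linear f) (g_lin : linear g).

Fact free_map_rel z :
  z \in lspan (@tensor_rel V W) -> free_map z \in lspan (@tensor_rel V' W').
Proof.
move=> /asboolP[m [c [u [Ru ->]]]].
rewrite (big_morph _ free_mapD free_map0); apply/asboolP.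
exists m, c, (fun i => free_map (u i)); split=> [i|]; last first.
  by apply: eq_bigr => i _; rewrite free_mapZ.
case: (Ru i) => [[a [x [x' [y ->]]]]|[a [x [y [y' ->]]]]];
  rewrite free_mapB free_mapD free_mapZ !free_map_gen.
- by left; exists a, (f x), (f x'), (g y); rewrite f_lin.
- by right; exists a, (f x), (g y), (g y'); rewrite g_lin.
Qed.

Fact tensor_map_qproj z :
  tensor_map (qproj (lspan (@tensor_rel V W)) z) =
  qproj (lspan (@tensor_rel V' W')) (free_map z).
Proof.
apply/qproj_eq; rewrite -free_mapB; apply: free_map_rel.
by apply/qproj_eq; rewrite /qproj reprK.
Qed.

Fact tensor_map_pure x y : tensor_map (pure x y) = pure (f x) (g y).
Proof. by rewrite /pure tensor_map_qproj free_map_gen. Qed.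

Fact tensor_map_linear : linear tensor_map.
Proof.
move=> a z w; have [x <-] := qproj_surj z; have [y <-] := qproj_surj w.
by rewrite -linearP !tensor_map_qproj free_mapD free_mapZ linearP.
Qed.

End Map.
End Tensor.

Section LocalFields.
Variables (F : fieldType) (v : F -> int).

(* p_F^k; the value of v at 0 is irrelevant. *)
Definition frac_ideal (k : int) : set F := [set x | x = 0 \/ k <= v x]%classic.

Record local_field (q : nat) : Prop := {
  valM : forall x y, x != 0 -> y != 0 -> v (x * y) = v x + v y;
  valD : forall k x y,
    frac_ideal k x -> frac_ideal k y -> frac_ideal k (x + y);
  val_normalized : exists2 x, x != 0 & v x = 1;
  val_complete : forall u : nat -> F,
    (forall k, exists N, forall i j, (N <= i)%N -> (N <= j)%N ->
       frac_ideal k (u i - u j)) ->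
    exists l, forall k, exists N, forall i, (N <= i)%N -> frac_ideal k (u i - l);
  residue_card : exists r : 'I_q -> F, (forall i, frac_ideal 0 (r i)) /\
    forall x, frac_ideal 0 x -> exists! i, frac_ideal 1 (x - r i) }.

Variable D : falgType F.

Record central_division_algebra (n : nat) : Prop := {
  division : forall x : D, x != 0 -> x \is a GRing.unit;
  central : 'Z({:D})%VS = 1%VS;
  index_n : \dim {:D} = (n ^ 2)%N }.

(* Full o_F-lattices that are subrings. *)
Record is_order (O : set D) : Prop := {
  order1 : O 1;
  orderB : forall x y, O x -> O y -> O (x - y);
  orderM : forall x y, O x -> O y -> O (x * y);
  order_lattice : exists (m : nat) (b : m.-tuple D), <<b>>%VS = fullv /\
    forall x, O x <-> exists c : 'I_m -> F,
      (forall i, frac_ideal 0 (c i)) /\ x = \sum_i c i *: b`_i }.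

Record maximal_order (O : set D) : Prop := {
  max_is_order :> is_order O;
  max_order : forall O', is_order O' -> (O `<=` O')%classic -> O' = O }.

Record is_ideal (O P : set D) : Prop := {
  ideal_sub : (P `<=` O)%classic;
  ideal0 : P 0;
  idealB : forall x y, P x -> P y -> P (x - y);
  idealMl : forall a x, O a -> P x -> P (a * x);
  idealMr : forall a x, O a -> P x -> P (x * a) }.

Record maximal_ideal (O P : set D) : Prop := {
  max_is_ideal :> is_ideal O P;
  max_proper : P <> O;
  max_ideal : forall P', is_ideal O P' -> (P `<=` P')%classic -> P' = P \/ P' = O }.

(* t is the reduced trace: the F-algebra morphism rho induces an isomorphism
   L (x)_F D ~ M_n(L), and t(x) is the trace of rho(x). *)
Definition reduced_trace (n : nat) (t : D -> F) : Prop :=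
  exists (L : fieldType) (iota : {rmorphism F -> L}) (rho : D -> 'M[L]_n),
  [/\ (forall a x y, rho (a *: x + y) = iota a *: rho x + rho y),
      rho 1 = 1%:M,
      (forall x y, rho (x * y) = rho x *m rho y),
      (forall A : 'M[L]_n, exists! c : 'rV[L]_(\dim {:D}),
         A = \sum_i c 0 i *: rho (vbasis {:D})`_i) &
      (forall x, iota (t x) = \tr (rho x))].

End LocalFields.

Section GL2.
Variables (F : fieldType) (D : falgType F).

Definition mx22 (a b c d : D) : 'M[D]_2 :=
  \matrix_(i, j) if i == 0 then (if j == 0 then a else b)
                 else (if j == 0 then c else d).

Local Notation Dx := (unit_group D).
Local Notation G := (unit_group 'M[D]_2).

Fact diag_is_unit (d : Dx) : is_unit ((val d)%:M : 'M[D]_2).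
Proof.
apply/asboolP; exists (val (d^-1)%g)%:M.
have [l r] := uinv_valP d.
by split; rewrite -[LHS]/(_ *m _) -scalar_mxM /= ?l ?r.
Qed.

Definition diag (d : Dx) : G := UnitGroup (diag_is_unit d).

Fact diagM : {morph diag : d e / (d * e)%g}.
Proof. by move=> d e; apply: val_inj; rewrite /= scalar_mxM. Qed.

HB.instance Definition _ := isMultiplicative.Build Dx G diag diagM.

Fact diag1 : diag 1%g = 1%g.
Proof. exact: val_inj. Qed.

End GL2.

(* Neighbourhoods of 1: as y runs over F \ {0}, the sets 1 + y o_D and
   1 + y M_2(o_D), intersected with the unit groups, form bases of
   neighbourhoods of 1 in D^* and GL_2(D). *)
Section Smooth.
Variables (F : fieldType) (D : falgType F) (oD : set D).

Definition nbhsD (y : F) (d : unit_group D) : Prop :=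
  exists2 x, oD x & val d - 1 = y *: x.

Definition nbhsG (y : F) (g : unit_group 'M[D]_2) : Prop :=
  forall i j, exists2 x, oD x & (val g - 1) i j = y *: x.

Variables (K : fieldType) (V : lmodType K) (r : rep (unit_group D) V).

Definition smooth : Prop :=
  forall x, exists2 y : F, y != 0 & forall d, nbhsD y d -> r d x = x.

Definition depth_zero (pD : set D) : Prop :=
  forall d, pD (val d - 1) -> forall x, r d x = x.

End Smooth.

Section ParabolicInduction.
Variables (R : realType) (F : fieldType) (v : F -> int) (q : nat).
Variables (D : falgType F) (oD : set D).
Hypotheses (hF : local_field v q) (hO : is_order v oD).

Local Notation C := R[i].
Local Notation Dx := (unit_group D).
Local Notation G := (unit_group 'M[D]_2).

(* delta_B(diag(a,d)) is the normalized absolute value of the determinant of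
   the F-linear automorphism x |-> a x d^-1 of D ~ Lie N. *)
Definition modulus (a d : Dx) : R :=
  q%:R ^ (- v (\det (passmx.mxof (vbasis {:D}) (vbasis {:D})
                 (amull (val a) \o amulr (val (d^-1)%g))%VF))).

Definition sqrt_modulus (a d : Dx) : C := (Num.sqrt (modulus a d))%:C%C.

Variables (V1 V2 : lmodType C) (tau1 : rep Dx V1) (tau2 : rep Dx V2).
Local Notation W := (tensor V1 V2).

Definition ind_space : {pred G -> W} := fun f =>
  `[< (forall (b g : G) (a d : Dx) (x : D),
         val b = mx22 (val a) x 0 (val d) ->
         f (b * g)%g = sqrt_modulus a d *: tensor_map (tau1 a) (tau2 d) (f g)) /\
      exists2 y : F, y != 0 & forall k g, nbhsG oD y k -> f (g * k)%g = f g >].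

Fact val1 : v 1 = 0.
Proof.
have := valM hF (oner_neq0 F) (oner_neq0 F).
by rewrite mulr1 -[X in X = _]addr0 => /addrI.
Qed.

Fact scale_int (c : F) :
  exists z, [/\ z != 0, frac_ideal v 0 z & frac_ideal v 0 (z * c)].
Proof.
have i1 : frac_ideal v 0 1 by right; rewrite val1.
have [->|c0] := eqVneq c 0; first by exists 1; rewrite oner_neq0 mulr0; split=> //; left.
have [vc|vc] := leP 0 (v c).
  by exists 1; rewrite oner_neq0 mul1r; split=> //; right.
have cV0 : c^-1 != 0 by rewrite invr_eq0.
exists c^-1; rewrite mulVf//; split=> //; right.
have := valM hF cV0 c0; rewrite mulVf// val1 => /esym/eqP.
by rewrite addr_eq0 => /eqP ->; rewrite oppr_ge0 ltW.
Qed.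

Fact frac_idealM x y :
  frac_ideal v 0 x -> frac_ideal v 0 y -> frac_ideal v 0 (x * y).
Proof.
case=> [->|vx]; first by left; rewrite mul0r.
case=> [->|vy]; first by left; rewrite mulr0.
have [->|x0] := eqVneq x 0; first by left; rewrite mul0r.
have [->|y0] := eqVneq y 0; first by left; rewrite mulr0.
by right; rewrite (valM hF) // addr_ge0.
Qed.

Fact order_scale a x : frac_ideal v 0 a -> oD x -> oD (a *: x).
Proof.
move=> va; have [m [b [_ H]]] := order_lattice hO.
move=> /H[c [vc ->]]; apply/H; exists (fun i => a * c i); split=> [i|].
  exact: frac_idealM.
by rewrite scaler_sumr; apply: eq_bigr => i _; rewrite scalerA.
Qed.

Fact order0 : oD 0.
Proof. by rewrite -(subrr 1); apply: (orderB hO); exact: order1 hO. Qed.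

Fact orderD x y : oD x -> oD y -> oD (x + y).
Proof.
by move=> ox oy; rewrite -[y]opprK -[- y]sub0r; do 2?apply: (orderB hO) => //; exact: order0.
Qed.

Fact scale_seq (s : seq F) : exists z, [/\ z != 0, frac_ideal v 0 z &
  forall c, c \in s -> frac_ideal v 0 (z * c)].
Proof.
elim: s => [|c s [z [z0 iz zs]]].
  by exists 1; rewrite oner_neq0; split=> //; right; rewrite val1.
have [w [w0 iw wc]] := scale_int c; exists (z * w); split.
- by rewrite mulf_neq0.
- exact: frac_idealM.
- move=> e; rewrite inE => /orP[/eqP ->|es]; first by rewrite -mulrA; exact: frac_idealM.
  by rewrite mulrAC mulrC; apply: frac_idealM => //; exact: zs.
Qed.

Fact scale_order1 (x : D) :
  exists z : F, [/\ z != 0, frac_ideal v 0 z & oD (z *: x)].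
Proof.
have [m [b [fb H]]] := order_lattice hO.
have xb : x \in <<b>>%VS by rewrite fb memvf.
have [z [z0 iz zs]] := scale_seq [seq coord b i x | i <- enum 'I_m].
exists z; split=> //; apply/H; exists (fun i => z * coord b i x); split=> [i|].
  by apply: zs; apply: map_f; rewrite mem_enum.
by rewrite {1}(coord_span xb) scaler_sumr; apply: eq_bigr => i _; rewrite scalerA.
Qed.

Fact scale_order (s : seq D) :
  exists z : F, [/\ z != 0, frac_ideal v 0 z & forall x, x \in s -> oD (z *: x)].
Proof.
elim: s => [|c s [z [z0 iz zs]]].
  by exists 1; rewrite oner_neq0; split=> //; right; rewrite val1.
have [w [w0 iw wc]] := scale_order1 c; exists (z * w); split.
- by rewrite mulf_neq0.
- exact: frac_idealM.
- move=> e; rewrite inE => /orP[/eqP ->|es]; first by rewrite -scalerA; exact: order_scale.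
  by rewrite mulrC -scalerA; apply: order_scale => //; exact: zs.
Qed.

Fact nbhsG_mul (y z : F) k : frac_ideal v 0 z -> nbhsG oD (y * z) k -> nbhsG oD y k.
Proof.
move=> iz Hk i j; have [x ox ->] := Hk i j.
by exists (z *: x); [exact: order_scale|rewrite scalerA].
Qed.

Fact nbhsG_conj (y : F) (h : G) : y != 0 -> exists2 z : F, z != 0 &
  forall k, nbhsG oD z k -> nbhsG oD y (h^-1 * (k * h))%g.
Proof.
move=> y0; set A := val (h^-1)%g; set B := val h.
have [z [z0 iz Hz]] := scale_order
  ([seq A p.1 p.2 | p <- enum (setX [set: 'I_2] [set: 'I_2])] ++
   [seq B p.1 p.2 | p <- enum (setX [set: 'I_2] [set: 'I_2])]).
have HA i j : oD (z *: A i j).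
  apply: Hz; rewrite mem_cat; apply/orP; left; apply/mapP.
  by exists (i, j) => //; rewrite mem_enum !inE.
have HB i j : oD (z *: B i j).
  apply: Hz; rewrite mem_cat; apply/orP; right; apply/mapP.
  by exists (i, j) => //; rewrite mem_enum !inE.
exists (y * (z * z)); first by rewrite !mulf_neq0.
move=> k Hk i j.
have -> : val (h^-1 * (k * h))%g - 1 = A *m ((val k - 1) *m B).
  have AB : A *m B = 1 by have [] := uinv_valP h.
  by rewrite mulmxBl mulmxBr mul1mx AB.
rewrite mxE.
have sumO (f : 'I_2 -> D) : (forall l, exists2 x, oD x & f l = y *: x) ->
    exists2 x, oD x & \sum_l f l = y *: x.
  move=> Hf; apply: (big_ind (fun s => exists2 x, oD x & s = y *: x)) => //.
  - by exists 0; [exact: order0|rewrite scaler0].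
  - move=> _ _ [x ox ->] [x' ox' ->]; exists (x + x'); last by rewrite scalerDr.
    exact: orderD.
apply: (@sumO _) => l; rewrite mxE mulr_sumr; apply: (@sumO _) => p.
have [x ox ->] := Hk l p.
exists ((z *: A i l) * (x * (z *: B p j))).
  by apply: (orderM hO) => //; apply: (orderM hO).
by rewrite -!(scalerAl, scalerAr) !scalerA !mulrA.
Qed.

Fact ind_space_submod : submod_closed ind_space.
Proof.
have tl a d := tensor_map_linear (rep_linear tau1 a) (rep_linear tau2 d).
have t0 a d : tensor_map (tau1 a) (tau2 d) 0 = 0.
  by have := tl a d 1 0 0; rewrite !scale1r addr0 -[X in X = _]addr0 => /addrI <-.
split=> [|c f f' /asboolP[Hf [y y0 sf]] /asboolP[Hf' [y' y'0 sf']]].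
  apply/asboolP; split=> [b g a d x _|]; first by
    transitivity (sqrt_modulus a d *: tensor_map (tau1 a) (tau2 d) 0);
    [rewrite t0 scaler0|].
  by exists 1; rewrite ?oner_neq0.
apply/asboolP; split=> [b g a d x bE|].
  rewrite -[LHS]/(c *: f (b * g)%g + f' (b * g)%g).
  rewrite (Hf _ _ _ _ _ bE) (Hf' _ _ _ _ _ bE).
  by rewrite -[(_ + _) g]/(c *: f g + f' g) tl scalerDr !scalerA mulrC.
have [z [z0 iz zy]] := scale_int (y' / y).
exists (y * (z * (y' / y)) * z).
  by rewrite !mulf_neq0 ?invr_eq0.
move=> k g Hk; have Hk1 := nbhsG_mul iz Hk.
have Hk2 : nbhsG oD y k by apply: nbhsG_mul zy _.
have Hk3 : nbhsG oD y' k.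
  apply: nbhsG_mul iz _; move: Hk1; congr nbhsG.
  by rewrite mulrCA (mulrC y) divfK // mulrC.
rewrite -[LHS]/(c *: f (g * k)%g + f' (g * k)%g).
by rewrite sf // sf'.
Qed.

HB.instance Definition _ := GRing.isSubmodClosed.Build _ _ ind_space ind_space_submod.

Fact translate_ind (h : G) (f : G -> W) :
  f \in ind_space -> (fun g => f (g * h)%g) \in ind_space.
Proof.
move=> /asboolP[Hf [y y0 sf]]; apply/asboolP; split=> [b g a d x bE|].
  by rewrite -mulgA (Hf _ _ _ _ _ bE).
have [z z0 Hz] := nbhsG_conj h y0; exists z => // k g /Hz Hk.
by rewrite -[in RHS](sf _ _ Hk) !mulgA mulgK.
Qed.

Definition translate (h : G) (f : submod ind_space) : submod ind_space :=
  Submod (translate_ind h (submod_valP f)).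

(* The normalized parabolic induction tau1 x tau2, realized on functions
   f : G -> V1 (x) V2 on which G acts by right translation. *)
Definition parabolic_induction : rep G (submod ind_space).
Proof.
refine (@Rep _ G (submod ind_space) translate _ _ _) => [h a x y|x|g h x].
- exact: val_inj.
- by apply: val_inj; apply/funext => g /=; rewrite mulg1.
- by apply: val_inj; apply/funext => g' /=; rewrite mulgA.
Defined.

End ParabolicInduction.

Section Whittaker.
Variables (K : fieldType) (F : fieldType) (D : falgType F) (oD pD : set D).
Variable (psi : D -> K).
Local Notation G := (unit_group 'M[D]_2).

Definition GL2_oD : set G :=
  [set g : G | forall i j, oD (val g i j) /\ oD (val (g^-1)%g i j)]%classic.

Definition Iwahori : set G := [set g : G | GL2_oD g /\ pD (val g 1 0)]%classic.

Definition Iwahori1 : set G :=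
  [set g : G | [/\ Iwahori g, pD (val g 0 0 - 1) & pD (val g 1 1 - 1)]]%classic.

Definition psi0 (g : G) : K := psi (val g 0 1).

Variables (V : lmodType K) (pi : rep G V).

Definition psi0_invariants : {pred V} := fun x =>
  `[< forall g, Iwahori1 g -> pi g x = psi0 g *: x >].

Fact psi0_invariants_submod : submod_closed psi0_invariants.
Proof.
split=> [|a x y /asboolP Hx /asboolP Hy]; apply/asboolP => g Ig.
  by rewrite linear0 scaler0.
by rewrite linearP /= Hx // Hy // scalerDr !scalerA mulrC.
Qed.

HB.instance Definition _ :=
  GRing.isSubmodClosed.Build K V psi0_invariants psi0_invariants_submod.

(* V_{N,psi} is the quotient of V by the span of these vectors. *)
Definition twisted_relations : set V := [set z |
  exists (n : G) (b : D) (x : V),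
    val n = mx22 1 b 0 1 /\ z = pi n x - psi b *: x]%classic.

End Whittaker.

Section AdditiveCharacters.
Variables (F : fieldType) (v : F -> int) (K : fieldType).

(* Nonvanishing and local constancy follow from char_trivial. *)
Record level_one_character (psi : F -> K) : Prop := {
  charD : forall x y, psi (x + y) = psi x * psi y;
  char_trivial : forall x, frac_ideal v 1 x -> psi x = 1;
  char_nontrivial : exists2 x, frac_ideal v 0 x & psi x != 1 }.

End AdditiveCharacters.

(* Main.v *)
Require Import Defs.
From HB Require Import structures.
From mathcomp Require Import all_boot all_order all_algebra fingroup cyclic.
From mathcomp Require Import falgebra finfield freeg.
From mathcomp Require Import boolp classical_sets functions reals complex.
From mathcomp Require Import zify ring lra.

(** Functions in the induced space are governed by the Bruhat decomposition
    G = B + B w N.  A vector [f] fixed by I(1) up to psi_0 vanishes at 1,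
    because the integral points of N fix the value at 1 on the left and
    multiply it by a non-trivial character on the right; it vanishes at w n(x)
    for x outside o_D, because w n(x) lies in B n^-(1/x) and n^-(1/x) belongs
    to I(1); and f(w n(x)) = psi(x) f(w) for x in o_D.  Hence [f] is determined
    by f(w), and every vector of tau_1 (x) tau_2 occurs as f(w): the only
    constraint comes from the elements g of I(1) with w g w^-1 in B, on which
    psi_0 is trivial and whose diagonal lies in 1 + p_D, so it holds by depth
    zero ([cell_fun_Iwahori1], [invariant_values]).

    The twisted coinvariants are computed by the functional
    f |-> \int_N psi(x)^-1 f(w n(x)) dx.  The integral is realized as a sum over
    a finite quotient of two lattices ([averages], [whittaker_sum]).  It kills
    the relations, and on the invariants it is a positive multiple of f(w);
    this gives injectivity ([whittaker_inj]).  Conversely, modulo the relations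
    one may assume f(1) = 0, so that x |-> f(w n(x)) has compact support; then
    psi^-1-averaging over a large lattice in N does not change the class of [f]
    up to a non-zero scalar, and the average only depends on the value of the
    functional.  Comparing with the invariant vector having the same value gives
    surjectivity ([twisted_average_eq], [whittaker_surj]).

    This uses that psi is trivial on p_D, non-trivial on o_D and invariant under
    conjugation, and that o_D and p_D are the ring and the ideal of a valuation.
    The valuation is v o det of left multiplication ([dval]).  Its ultrametric
    inequality comes from local compactness: it is bounded on the unit sphere
    ([sphere_bound]), so the elements of non-negative valuation are exactly the
    power-bounded ones ([dval1D]).  The valuation ring is therefore an order
    containing every order, whence it is o_D ([maximal_orderE]).

    For the trace, let f be the residue degree of D, y an element of least
    positive valuation and e the ramification index.  An element of D has
    degree at most n over F, by Cayley-Hamilton in the splitting representation;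
    hence e, f <= n, while the products a^i y^j span D if [a] generates the
    residue field, so e f >= n^2 and e = f = n
    ([residue_degree_ramification]).  Consequently an element of least positive
    valuation satisfies a relation of degree n of Eisenstein type, so that its
    reduced trace lies in p_F, and every element of p_D is a difference of two
    such elements ([Trd_maximal_ideal]).  The reduced characteristic polynomial
    of a lift of a generator of the residue field lifts a minimal polynomial
    over F_q, and some generator has non-zero trace ([Trd_integral_unit]). *)

Set Implicit Arguments.
Unset Strict Implicit.
Unset Printing Implicit Defensive.

Import Order.TTheory GRing.Theory Num.Theory.

Local Open Scope ring_scope.

(** * Powers of the maximal ideal of a local field *)

Section LocalField.
Variables (F : fieldType) (v : F -> int) (q : nat) (hF : local_field v q).
Local Notation P := (frac_ideal v).

Lemma valuation1 : v 1 = 0.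
Proof. exact: Defs.val1 hF. Qed.

Lemma valuationV x : x != 0 -> v x^-1 = - v x.
Proof.
move=> x0; have := Defs.valM hF x0 (invr_neq0 x0); rewrite divff // valuation1.
by move/esym/eqP; rewrite addrC addr_eq0 => /eqP.
Qed.

Lemma valuationX x k : x != 0 -> v (x ^+ k) = v x *+ k.
Proof.
move=> x0; elim: k => [|k IH]; first by rewrite expr0 valuation1.
by rewrite exprS (Defs.valM hF) ?expf_neq0 // IH mulrS.
Qed.

Lemma valuationN1 : v (-1) = 0.
Proof.
have n1 : (-1 : F) != 0 by rewrite oppr_eq0 oner_neq0.
have := Defs.valM hF n1 n1; rewrite mulrNN mulr1 valuation1; lia.
Qed.

Lemma valuationN x : v (- x) = v x.
Proof.
have [->|x0] := eqVneq x 0; first by rewrite oppr0.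
by rewrite -mulN1r (Defs.valM hF) ?valuationN1 ?add0r // oppr_eq0 oner_neq0.
Qed.

Lemma valuationXz x (k : int) : x != 0 -> v (x ^ k) = v x * k.
Proof.
move=> x0; case: k => k; first by rewrite -exprnP valuationX // pmulrn mulrzz.
by rewrite NegzE -exprnN valuationV ?expf_neq0 // valuationX // pmulrn mulrzz mulrN.
Qed.

Lemma frac_ideal0 k : P k 0. Proof. by left. Qed.

Lemma frac_idealD k x y : P k x -> P k y -> P k (x + y).
Proof. exact: (Defs.valD hF). Qed.

Lemma frac_idealN k x : P k x -> P k (- x).
Proof. by case=> [->|h]; [left; rewrite oppr0|right; rewrite valuationN]. Qed.

Lemma frac_idealB k x y : P k x -> P k y -> P k (x - y).
Proof. by move=> hx hy; apply/frac_idealD/frac_idealN. Qed.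

Lemma frac_ideal_le k l x : k <= l -> P l x -> P k x.
Proof. by move=> kl [->|h]; [left|right; apply: le_trans h]. Qed.

Lemma frac_ideal_val x : P (v x) x. Proof. by right. Qed.

Lemma frac_ideal_ge k x : x != 0 -> P k x -> k <= v x.
Proof. by move=> /eqP x0 [/x0|]. Qed.

Lemma frac_ideal_mul k l x y : P k x -> P l y -> P (k + l) (x * y).
Proof.
have [->|x0] := eqVneq x 0; first by rewrite mul0r; left.
have [->|y0] := eqVneq y 0; first by rewrite mulr0; left.
by move=> /(frac_ideal_ge x0) hx /(frac_ideal_ge y0) hy; right; rewrite (Defs.valM hF) // lerD.
Qed.

Lemma frac_ideal1 : P 0 1. Proof. by right; rewrite valuation1. Qed.

Lemma frac_ideal_mull k x y : P 0 x -> P k y -> P k (x * y).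
Proof. by move=> hx hy; rewrite -(add0r k); apply: frac_ideal_mul. Qed.

Lemma frac_ideal_mulr k x y : P k x -> P 0 y -> P k (x * y).
Proof. by move=> hx hy; rewrite -(addr0 k); apply: frac_ideal_mul. Qed.

Lemma frac_ideal_sum (I : Type) (r : seq I) (Q : pred I) (f : I -> F) k :
  (forall i, Q i -> P k (f i)) -> P k (\sum_(i <- r | Q i) f i).
Proof. by move=> h; apply: big_ind => //; [left|apply: frac_idealD]. Qed.

Lemma frac_ideal_prod (m : nat) (f : 'I_m -> F) k :
  (forall i, P k (f i)) -> P (k * m%:Z) (\prod_i f i).
Proof.
elim: m f => [|m IH] f h; first by rewrite big_ord0 mulr0; exact: frac_ideal1.
have -> : k * m.+1%:Z = k + k * m%:Z by rewrite intS mulrDr mulr1.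
rewrite big_ord_recl; apply: frac_ideal_mul => //; exact: IH.
Qed.

Lemma frac_ideal_sign (s : bool) : P 0 ((-1) ^+ s).
Proof. by case: s; [apply: frac_idealN|]; apply: frac_ideal1. Qed.

Lemma frac_ideal_det m (A : 'M[F]_m) k : (forall i j, P k (A i j)) -> P (k * m%:Z) (\det A).
Proof.
move=> h; apply: frac_ideal_sum => s _; apply: frac_ideal_mull; first exact: frac_ideal_sign.
exact: frac_ideal_prod.
Qed.

Lemma frac_ideal_prod_congr (m : nat) (f g : 'I_m -> F) k :
  (forall i, P 0 (f i)) -> (forall i, P 0 (g i)) ->
  (forall i, P k (f i - g i)) -> P k (\prod_i f i - \prod_i g i).
Proof.
elim: m f g => [|m IH] f g hf hg h; first by rewrite !big_ord0 subrr; left.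
rewrite !big_ord_recl.
have -> (a b c d : F) : a * b - c * d = (a - c) * b + c * (b - d) by ring.
apply: frac_idealD.
  apply: frac_ideal_mulr => //; have := @frac_ideal_prod m (fun i => f (fintype.lift ord0 i)) 0 (fun i => hf _).
  by rewrite mul0r.
by apply: frac_ideal_mull => //; apply: IH.
Qed.

Lemma frac_ideal_det_congr m (A B : 'M[F]_m) k :
  (forall i j, P 0 (A i j)) -> (forall i j, P 0 (B i j)) ->
  (forall i j, P k (A i j - B i j)) -> P k (\det A - \det B).
Proof.
move=> hA hB h; rewrite /determinant -sumrB; apply: frac_ideal_sum => s _.
rewrite -mulrBr; apply: frac_ideal_mull; first exact: frac_ideal_sign.
exact: frac_ideal_prod_congr.
Qed.

Lemma frac_ideal_inter0 x : (forall k, P k x) -> x = 0.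
Proof. by move=> h; case: (h (v x + 1)) => //; rewrite -[leRHS]addr0 lerD2l. Qed.

Lemma frac_idealV x : x != 0 -> P (- v x) x^-1.
Proof. by move=> x0; right; rewrite valuationV. Qed.

Lemma frac_ideal_div k x y : y != 0 -> P (k + v y) x -> P k (x / y).
Proof.
by move=> y0 h; have := frac_ideal_mul h (frac_idealV y0); rewrite addrK.
Qed.

Lemma frac_ideal_nat (k : nat) : P 0 k%:R.
Proof. by elim: k => [|k IH]; [left|rewrite -natr1; apply: frac_idealD => //; apply: frac_ideal1]. Qed.

End LocalField.

Section Uniformizer.
Variables (F : fieldType) (v : F -> int).

Definition unif : F := xget 0 [set x | x != 0 /\ v x = 1]%classic.

Variables (q : nat) (hF : local_field v q).
Local Notation P := (frac_ideal v).

Fact unif_spec : unif != 0 /\ v unif = 1.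
Proof.
rewrite /unif; case: xgetP => [x _ //|h].
by have [x x0 x1] := val_normalized hF; case: (h x).
Qed.

Lemma unif_neq0 : unif != 0. Proof. by case: unif_spec. Qed.
Lemma valuation_unif : v unif = 1. Proof. by case: unif_spec. Qed.

Lemma unifz_neq0 (k : int) : unif ^ k != 0.
Proof. exact/expfz_neq0/unif_neq0. Qed.

Lemma valuation_unifz (k : int) : v (unif ^ k) = k.
Proof. by rewrite (valuationXz hF) ?unif_neq0 // valuation_unif mul1r. Qed.

Lemma frac_ideal_unifz (k : int) : P k (unif ^ k).
Proof. by right; rewrite valuation_unifz. Qed.

Lemma frac_ideal_shift k l x : P (k + l) (unif ^ k * x) <-> P l x.
Proof.
split=> [h|]; last exact/(frac_ideal_mul hF)/frac_ideal_unifz.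
have := frac_ideal_mul hF (frac_ideal_unifz (- k)) h.
by rewrite mulrA -expfzDr ?unif_neq0 // addNr mul1r addKr.
Qed.

End Uniformizer.

(** * Summation over finite quotients *)

Section Averaging.
Variables (D : zmodType).

(** The sum of [f] over [s] plays the part of the integral of [f] over [A]:
    for functions invariant under the open subgroup [A'] it is invariant
    under translation by [A]. Repetitions modulo [A'] are harmless, so no
    normalization of [s] is imposed. *)
Definition averages (A A' : set D) (s : seq D) : Prop :=
  [/\ s != [::], (forall x, x \in s -> A x) &
    forall (W : zmodType) (f : D -> W), (forall x t, A' t -> f (x + t) = f x) ->
    forall t, A t -> \sum_(x <- s) f (x + t) = \sum_(x <- s) f x].

(** Summation in stages: the inner sum, over [B] modulo [C], is a
    [B]-invariant function. *)
Lemma averages_trans (A B C : set D) s s' :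
  (forall x, B x -> A x) -> (forall x y, A x -> A y -> A (x + y)) ->
  averages A B s -> averages B C s' ->
  averages A C [seq x + x' | x <- s, x' <- s'].
Proof.
move=> BA AD [s0 sA hs] [s'0 s'B hs']; split.
- by rewrite -size_eq0 size_allpairs muln_eq0 negb_or !size_eq0 s0.
- move=> z /allpairsP[[x x'] [/= xs xs' ->]].
  by apply: AD; [exact: sA|exact/BA/s'B].
- move=> W f hf t At; rewrite !big_allpairs_dep /=.
  have e x : \sum_(x' <- s') f (x + x' + t) = \sum_(x' <- s') f (x + t + x').
    by apply: eq_bigr => x' _; rewrite addrAC.
  rewrite (eq_bigr _ (fun x _ => e x)).
  apply: (hs W (fun y => \sum_(x' <- s') f (y + x')) _ t At) => x u Bu.
  transitivity (\sum_(x' <- s') f (x + (x' + u))).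
    by apply: eq_bigr => x' _; rewrite -addrA (addrC u).
  apply: (hs' W (fun y => f (x + y)) _ u Bu) => y w Cw.
  by rewrite addrA (hf _ _ Cw).
Qed.

(** If no element of [s] were congruent to [x], the indicator function of [A']
    would have sum zero after translation by [- x]; but its sum is
    positive after translation by the opposite of an element of [s]. *)
Lemma averages_repr (A A' : set D) s x :
  (forall y, A y -> A (- y)) -> A' 0 ->
  (forall y z, A' y -> A' z -> A' (y - z)) ->
  averages A A' s -> A x -> exists2 r, r \in s & A' (x - r).
Proof.
move=> AN A'0 A'B [s0 sA hs] Ax; apply: contrapT => h.
have [r0 r0s] : exists r0, r0 \in s.
  by case: (s) s0 => [|a s1] // _; exists a; rewrite inE eqxx.
have A'N t : A' t -> A' (- t) by move=> ?; rewrite -sub0r; exact: A'B.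
pose f (y : D) : int := `[< A' y >]%:Z.
have hf y t : A' t -> f (y + t) = f y.
  move=> A't; rewrite /f; congr (Posz (nat_of_bool _)); apply/asboolP/asboolP => hy.
    by rewrite -(addrK t y); exact: A'B.
  by rewrite -[t]opprK; apply: A'B => //; exact: A'N.
have e1 : \sum_(r <- s) f (r - x) = 0.
  apply: big1_seq => r /andP[_ rs]; rewrite /f; case: asboolP => // hr.
  by case: h; exists r => //; rewrite -opprB; exact: A'N.
have := hs _ f hf (- r0) (AN _ (sA _ r0s)).
rewrite -(hs _ f hf (- x) (AN _ Ax)) e1 (big_rem r0) //= subrr {1}/f.
have -> : asbool (A' 0) = true by apply/asboolP.
have : 0 <= \sum_(y <- rem r0 s) f (y - r0) by apply: sumr_ge0.
set S := \sum_(_ <- _) _; lia.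
Qed.

End Averaging.

(** * Lattices in the division algebra *)

Section Lattices.
Variables (F : fieldType) (v : F -> int) (q : nat) (hF : local_field v q).
Variables (D : falgType F).
Local Notation P := (frac_ideal v).
Local Notation e := (vbasis {:D}).
Local Notation m := (\dim {:D}).
Local Notation pi := (unif v).

Definition crd (j : 'I_m) (x : D) : F := coord e j x.
Definition lattice (k : int) : set D := [set x | forall j, P k (crd j x)]%classic.
Local Notation L := lattice.

Lemma crd_sum x : x = \sum_j crd j x *: e`_j.
Proof. exact: coord_vbasis (memvf x). Qed.

Lemma crdD j x y : crd j (x + y) = crd j x + crd j y.
Proof. exact: linearD. Qed.
Lemma crdB j x y : crd j (x - y) = crd j x - crd j y.
Proof. exact: linearB. Qed.
Lemma crdZ j a x : crd j (a *: x) = a * crd j x.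
Proof. exact: linearZ. Qed.

Lemma crd_lin j (c : 'I_m -> F) : crd j (\sum_i c i *: e`_i) = c j.
Proof. exact/coord_sum_free/(basis_free (vbasisP _)). Qed.

Lemma crd_eq x y : (forall j, crd j x = crd j y) -> x = y.
Proof. by move=> h; rewrite (crd_sum x) (crd_sum y); under eq_bigr do rewrite h. Qed.

Lemma lattice0 k : L k 0. Proof. by move=> j; rewrite /crd linear0; left. Qed.
Lemma latticeD k x y : L k x -> L k y -> L k (x + y).
Proof. by move=> hx hy j; rewrite crdD; apply: (frac_idealD hF). Qed.
Lemma latticeB k x y : L k x -> L k y -> L k (x - y).
Proof. by move=> hx hy j; rewrite crdB; apply: (frac_idealB hF). Qed.
Lemma latticeN k x : L k x -> L k (- x).
Proof. by move=> hx; rewrite -sub0r; apply: latticeB => //; exact: lattice0. Qed.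
Lemma latticeZ k l a x : P k a -> L l x -> L (k + l) (a *: x).
Proof. by move=> ha hx j; rewrite crdZ; exact: (frac_ideal_mul hF). Qed.
Lemma latticeZ0 l a x : P 0 a -> L l x -> L l (a *: x).
Proof. by move=> ha hx; rewrite -[l]add0r; exact: latticeZ. Qed.
Lemma lattice_le k l x : k <= l -> L l x -> L k x.
Proof. by move=> kl hx j; apply: frac_ideal_le kl _. Qed.
Lemma lattice_sum (I : Type) (r : seq I) (Q : pred I) (f : I -> D) k :
  (forall i, Q i -> L k (f i)) -> L k (\sum_(i <- r | Q i) f i).
Proof. by move=> h; apply: big_ind => //; [exact: lattice0|apply: latticeD]. Qed.

Lemma lattice_shift k l x : L (k + l) (pi ^ k *: x) <-> L l x.
Proof.
by split=> h j; have := h j; rewrite crdZ => /(frac_ideal_shift hF).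
Qed.

Lemma lattice_shiftE k l x : L (k + l) x <-> L l (pi ^ (- k) *: x).
Proof.
rewrite -(lattice_shift k l) scalerA -expfzDr ?(unif_neq0 hF) // subrr scale1r //.
Qed.

Lemma lattice_exhaust x : exists k : nat, L (- k%:Z) x.
Proof.
exists (\sum_j `|v (crd j x)|)%N => j; apply: frac_ideal_le (frac_ideal_val _ _).
have h : (`|v (crd j x)| <= \sum_j `|v (crd j x)|)%N by rewrite (bigD1 j) //= leq_addr.
lia.
Qed.

Lemma lattice_order_ex x : x != 0 -> exists k, L k x /\ ~ L (k + 1) x.
Proof.
move=> x0; apply: contrapT => h.
have [k0 hk0] := lattice_exhaust x.
have hall : forall i : nat, L (- k0%:Z + i%:Z) x.
  elim=> [|i IH]; first by rewrite addr0.
  rewrite intS addrCA addrC; apply: contrapT => h'; apply: h.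
  by exists (- k0%:Z + i%:Z).
move/negP: x0; apply; apply/eqP/crd_eq => j; rewrite {2}/crd linear0.
apply: (frac_ideal_inter0 (v := v)) => k; apply: frac_ideal_le (hall (k0 + `|k|)%N j); lia.
Qed.

Lemma notin_lattice_neq0 k x : ~ L k x -> x != 0.
Proof. by move=> h; apply/eqP => x0; apply: h; rewrite x0; exact: lattice0. Qed.

Lemma lattice_basis (i : 'I_m) : L 0 e`_i.
Proof.
by move=> l; rewrite /crd coord_free ?(basis_free (vbasisP _)) //; exact: (frac_ideal_nat hF).
Qed.

(** Translation by an integral vector permutes the sums of residue
    representatives, coordinate by coordinate, modulo the uniformizer. *)
Lemma lattice_averages1 : exists s, averages (L 0) (L 1) s.
Proof.
have [r [r0 hr]] := residue_card hF.
have [i0 _] := hr 1 (frac_ideal1 hF).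
have [res hres] : {res : F -> 'I_q & forall x, P 0 x -> P 1 (x - r (res x))}.
  apply: (choice (P := fun x i => P 0 x -> P 1 (x - r i))) => x.
  have [hx|hx] := pselect (P 0 x); last by exists i0.
  by have [i [hi _]] := hr x hx; exists i.
pose rp (c : {ffun 'I_m -> 'I_q}) : D := \sum_j r (c j) *: e`_j.
exists [seq rp c | c : {ffun 'I_m -> 'I_q}]; split.
- rewrite -size_eq0 size_map -cardT -lt0n; apply/card_gt0P.
  by exists [ffun _ => res 1].
- by move=> x /mapP[c _ ->] j; rewrite crd_lin.
move=> W f hf t Lt; rewrite !big_image /=.
pose sh (c : {ffun 'I_m -> 'I_q}) := [ffun j => res (r (c j) + crd j t)].
have hsh (c : {ffun 'I_m -> 'I_q}) j : P 1 (r (c j) + crd j t - r (sh c j)).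
  by rewrite ffunE; apply: hres; exact: (frac_idealD hF).
have sh_inj : injective sh.
  move=> c c' cc; apply/ffunP => j.
  have h := hsh c j; have h' := hsh c' j; rewrite -cc in h'.
  have [i [_ ui]] := hr (r (c j)) (r0 _).
  transitivity i; first by apply/esym/ui; rewrite subrr; exact: frac_ideal0.
  apply: ui.
  have -> : r (c j) - r (c' j) = (r (c j) + crd j t - r (sh c j)) -
     (r (c' j) + crd j t - r (sh c j)) by ring.
  exact: (frac_idealB hF).
rewrite [RHS](reindex_inj sh_inj) /=; apply: eq_bigr => c _.
have E : rp c + t = rp (sh c) + (rp c + t - rp (sh c)) by rewrite [RHS]addrC subrK.
rewrite E; apply: hf => j; rewrite crdB crdD.
by rewrite [X in P 1 (X + _ - _)]crd_lin [X in P 1 (_ - X)]crd_lin.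
Qed.

(** Refine the lattice by one power of the uniformizer at a time. *)
Lemma lattice_averages k l : k <= l -> exists s, averages (L k) (L l) s.
Proof.
have [s1 [s1n s1L s1a]] := lattice_averages1.
have step j : averages (L j) (L (j + 1)) [seq pi ^ j *: x | x <- s1].
  split; first by rewrite -size_eq0 size_map size_eq0.
    by move=> x /mapP[y /s1L Ly ->]; move/(lattice_shift j): Ly; rewrite addr0.
  move=> W f hf t Lt; rewrite !big_map.
  have tE : t = pi ^ j *: (pi ^ (- j) *: t).
    by rewrite scalerA -expfzDr ?(unif_neq0 hF) // subrr scale1r.
  rewrite tE; under eq_bigr do rewrite -scalerDr.
  apply: (s1a W (fun x => f (pi ^ j *: x))) => [x u Lu|].
    by rewrite scalerDr hf //; apply/lattice_shift.
  by apply/lattice_shiftE; rewrite addr0.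
move=> kl; have [i ->] : exists i : nat, l = k + i%:Z.
  by exists `|l - k|%N; lia.
elim: i {l kl} => [|i [s hs]].
  exists [:: 0]; rewrite addr0; split=> // [x|W f hf t Lt].
    by rewrite inE => /eqP ->; exact: lattice0.
  by rewrite !big_seq1 hf.
rewrite intS (addrC 1) addrA; eexists; apply: averages_trans hs (step _).
- by move=> x; apply: lattice_le; lia.
- exact: latticeD.
Qed.

Lemma lattice_transversal k l : exists s : seq D, forall x, L k x ->
  exists2 r, r \in s & L l (x - r).
Proof.
have [kl|lk] := leP k l.
  have [s hs] := lattice_averages kl; exists s => x Lx.
  by apply: averages_repr hs Lx; [exact: latticeN|exact: lattice0|exact: latticeB].
exists [:: 0] => x Lx; exists 0; rewrite ?inE // subr0.
by apply: lattice_le Lx; exact: ltW.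
Qed.

Lemma lattice_mul : exists C : nat, forall k l x y,
  L k x -> L l y -> L (k + l - C%:Z) (x * y).
Proof.
have [C hC] : exists C : nat, forall i j, L (- C%:Z) (e`_(nat_of_ord (i : 'I_m)) * e`_(nat_of_ord (j : 'I_m))).
  have [g hg] : {g : 'I_m * 'I_m -> nat & forall p, L (- (g p)%:Z) (e`_(p.1) * e`_(p.2))}.
    have H (p : 'I_m * 'I_m) : exists g : nat, L (- g%:Z) (e`_(p.1) * e`_(p.2)).
      exact: lattice_exhaust.
    exact: (choice H).
  exists (\sum_p g p)%N => i j; apply: lattice_le (hg (i, j)).
  by rewrite (bigD1 (i, j)) //=; lia.
exists C => k l x y Lx Ly.
rewrite (crd_sum x) (crd_sum y) mulr_suml; apply: lattice_sum => i _.
rewrite mulr_sumr; apply: lattice_sum => j _.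
rewrite -scalerAl -scalerAr scalerA; apply: latticeZ => //.
by apply: (frac_ideal_mul hF); [exact: Lx|exact: Ly].
Qed.

End Lattices.

(** * The determinant of a multiplication *)

Section Determinants.
Variables (F : fieldType) (v : F -> int) (q : nat) (hF : local_field v q).
Variables (D : falgType F).
Hypothesis divD : forall x : D, x != 0 -> x \is a GRing.unit.
Local Notation P := (frac_ideal v).
Local Notation e := (vbasis {:D}).
Local Notation m := (\dim {:D}).
Local Notation pi := (unif v).
Local Notation L := (@lattice F v D).

Definition dmat (f : 'End(D)) : 'M[F]_m := passmx.mxof e e f.

Lemma dmatE f i j : dmat f i j = crd j (f e`_i).
Proof.
rewrite /dmat /passmx.mxof mxE /= /crd -passmx.coord_rVof; congr (coord _ _ (f _)).
have := passmx.rVofE (vbasisP {:D}) i => <-.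
by rewrite passmx.rVofK ?vbasisP // memvf.
Qed.

Lemma dmat_comp f g : dmat (f \o g)%VF = dmat g *m dmat f.
Proof. by apply: passmx.mxof_comp; exact: vbasisP. Qed.

Lemma dmat1 : dmat \1%VF = 1%:M.
Proof. by apply/passmx.mxof1/(basis_free (vbasisP _)). Qed.

Lemma dmatZ a f : dmat (a *: f) = a *: dmat f.
Proof. by apply/matrixP => i j; rewrite [RHS]mxE !dmatE scale_lfunE crdZ. Qed.

Lemma dmatD f g : dmat (f + g) = dmat f + dmat g.
Proof. by apply/matrixP => i j; rewrite [RHS]mxE !dmatE add_lfunE crdD. Qed.

Definition ldet (x : D) : F := \det (dmat (amull x)).
Definition rdet (x : D) : F := \det (dmat (amulr x)).
(** Up to normalization this is the valuation of [D]: [ldet] is the norm from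
    [D] to [F]. *)
Definition dval (x : D) : int := v (ldet x).
(** The analogue for right multiplication, which enters the modulus character
    of the Borel subgroup. *)
Definition drval (x : D) : int := v (rdet x).

Lemma ldetM x y : ldet (x * y) = ldet x * ldet y.
Proof. by rewrite /ldet amullM dmat_comp det_mulmx mulrC. Qed.

Lemma rdetM x y : rdet (x * y) = rdet x * rdet y.
Proof. by rewrite /rdet rmorphM /= dmat_comp det_mulmx. Qed.

Lemma ldet1 : ldet 1 = 1.
Proof. by rewrite /ldet amull1 dmat1 det1. Qed.

Lemma rdet1 : rdet 1 = 1.
Proof. by rewrite /rdet rmorph1 dmat1 det1. Qed.

Lemma ldet_neq0 x : x != 0 -> ldet x != 0.
Proof.
move=> /divD xu; have := ldetM x x^-1; rewrite divrr // ldet1.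
by apply: contra_eqN => /eqP ->; rewrite mul0r oner_neq0.
Qed.

Lemma rdet_neq0 x : x != 0 -> rdet x != 0.
Proof.
move=> /divD xu; have := rdetM x x^-1; rewrite divrr // rdet1.
by apply: contra_eqN => /eqP ->; rewrite mul0r oner_neq0.
Qed.

Lemma mulD_neq0 (x y : D) : x != 0 -> y != 0 -> x * y != 0.
Proof.
move=> x0 y0; apply/eqP => h; move/negP: y0; apply.
by rewrite -(mulKr (divD x0) y) h mulr0.
Qed.

Lemma invD_neq0 (x : D) : x != 0 -> x^-1 != 0.
Proof. by move=> x0; rewrite invr_eq0. Qed.

Lemma expD_neq0 (x : D) k : x != 0 -> x ^+ k != 0.
Proof.
move=> x0; elim: k => [|k IH]; first by rewrite oner_neq0.
by rewrite exprS mulD_neq0.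
Qed.

Lemma ldet_bound : exists C : nat, forall k x, L k x -> P (k * m%:Z - C%:Z) (ldet x).
Proof.
have [C hC] := lattice_mul hF D; exists (C * m)%N => k x Lx.
have -> : k * m%:Z - (C * m)%N%:Z = (k - C%:Z) * m%:Z by rewrite PoszM; ring.
apply: (frac_ideal_det hF) => i j; rewrite dmatE lfunE /=.
have := hC k 0 x e`_i Lx; rewrite addr0; apply; exact: (lattice_basis hF).
Qed.

Lemma rdet_bound : exists C : nat, forall k x, L k x -> P (k * m%:Z - C%:Z) (rdet x).
Proof.
have [C hC] := lattice_mul hF D; exists (C * m)%N => k x Lx.
have -> : k * m%:Z - (C * m)%N%:Z = (k - C%:Z) * m%:Z by rewrite PoszM; ring.
apply: (frac_ideal_det hF) => i j; rewrite dmatE lfunE /=.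
have := hC 0 k e`_i x; rewrite add0r; apply => //; exact: (lattice_basis hF).
Qed.

(** A negative valuation would tend to minus infinity along the powers. *)
Lemma bounded_powers (x : F) (C : int) :
  x != 0 -> (forall k : nat, P C (x ^+ k)) -> 0 <= v x.
Proof.
move=> x0 h; rewrite leNgt; apply/negP => vx.
have := frac_ideal_ge (expf_neq0 (`|C| + 1)%N x0) (h (`|C| + 1)%N).
rewrite (valuationX hF) // -mulr_natr natz; nia.
Qed.

Lemma dvalM x y : x != 0 -> y != 0 -> dval (x * y) = dval x + dval y.
Proof. by move=> x0 y0; rewrite /dval ldetM (Defs.valM hF) // ldet_neq0. Qed.

Lemma dval1 : dval 1 = 0.
Proof. by rewrite /dval ldet1 (valuation1 hF). Qed.

Lemma dvalV x : x != 0 -> dval x^-1 = - dval x.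
Proof.
move=> x0; have := dvalM x0 (invD_neq0 x0); rewrite divrr ?divD // dval1.
by move/esym/eqP; rewrite addrC addr_eq0 => /eqP.
Qed.

Lemma dvalX x k : x != 0 -> dval (x ^+ k) = dval x *+ k.
Proof.
move=> x0; elim: k => [|k IH]; first by rewrite expr0 dval1.
by rewrite exprS dvalM ?expD_neq0 // IH mulrS.
Qed.

Lemma dvalZ a x : a != 0 -> x != 0 -> dval (a *: x) = v a * m%:Z + dval x.
Proof.
move=> a0 x0; rewrite /dval /ldet.
have -> : dmat (amull (a *: x)) = a *: dmat (amull x).
  by rewrite linearZ /= dmatZ.
rewrite detZ (Defs.valM hF) ?expf_neq0 ?ldet_neq0 // (valuationX hF) //.
by rewrite -mulr_natr natz.
Qed.

Lemma dvalN x : dval (- x) = dval x.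
Proof.
have [->|x0] := eqVneq x 0; first by rewrite oppr0.
by rewrite -scaleN1r dvalZ ?oppr_eq0 ?oner_neq0 // (valuationN1 hF) mul0r add0r.
Qed.

Lemma dval_conj x y : x != 0 -> y != 0 -> dval (x * y * x^-1) = dval y.
Proof.
by move=> x0 y0; rewrite !dvalM ?mulD_neq0 ?invD_neq0 // dvalV //; lia.
Qed.

Lemma dval_powers_ge0 (x : D) (C : int) :
  x != 0 -> (forall k : nat, L C (x ^+ k)) -> 0 <= dval x.
Proof.
move=> x0 h; have [C' hC'] := ldet_bound.
apply: (@bounded_powers _ (C * m%:Z - C'%:Z)); first exact: ldet_neq0.
have E k : ldet (x ^+ k) = ldet x ^+ k.
  by elim: k => [|k IH]; rewrite ?ldet1 // !exprS ldetM IH.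
by move=> k; rewrite -E; exact: hC'.
Qed.

Lemma drval_powers_ge0 (x : D) (C : int) :
  x != 0 -> (forall k : nat, L C (x ^+ k)) -> 0 <= drval x.
Proof.
move=> x0 h; have [C' hC'] := rdet_bound.
apply: (@bounded_powers _ (C * m%:Z - C'%:Z)); first exact: rdet_neq0.
have E k : rdet (x ^+ k) = rdet x ^+ k.
  by elim: k => [|k IH]; rewrite ?rdet1 // !exprS rdetM IH.
by move=> k; rewrite -E; exact: hC'.
Qed.

Lemma drvalV x : x != 0 -> drval x^-1 = - drval x.
Proof.
move=> x0; have := rdetM x x^-1; rewrite divrr ?divD // rdet1 /drval => E.
have := congr1 v E.
by rewrite (valuation1 hF) (Defs.valM hF) ?rdet_neq0 ?invD_neq0 //; lia.
Qed.

(** Multiplication by [1 + h] is congruent to the identity matrix, hence so is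
    its determinant to 1. *)
Lemma dval_near1 : exists K : nat, forall h, L K%:Z h -> 1 + h != 0 /\ dval (1 + h) = 0.
Proof.
have [C hC] := lattice_mul hF D; exists (C + 1)%N => h Lh.
have d1 : P 1 (ldet (1 + h) - ldet 1).
  have E : dmat (amull (1 + h)) = 1%:M + dmat (amull h).
    by rewrite linearD /= dmatD amull1 dmat1.
  have hh i j : P 1 (dmat (amull h) i j).
    rewrite dmatE lfunE /=.
    have := hC _ 0 _ e`_i Lh; rewrite addr0 PoszD addrAC subrr add0r; apply; exact: (lattice_basis hF).
  have h1 i j : P 0 ((1%:M : 'M[F]_m) i j) by rewrite mxE; exact: (frac_ideal_nat hF).
  rewrite /ldet E amull1 dmat1; apply: (frac_ideal_det_congr hF) => i j //.
    by rewrite mxE; apply: (frac_idealD hF) => //; apply: frac_ideal_le (hh i j).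
  by rewrite mxE addrAC subrr add0r.
have n1 y : P 1 (y - 1) -> ~ P 1 y.
  move=> h1 h2; have := frac_idealB hF h2 h1; rewrite opprB addrCA subrr addr0.
  by move/(frac_ideal_ge (oner_neq0 _)); rewrite (valuation1 hF).
rewrite ldet1 in d1.
have h0 : 1 + h != 0.
  apply/eqP => E; move: (n1 _ d1); rewrite E /ldet linear0 -(scale0r 0) dmatZ scale0r.
  have m0 : (0 < m)%N.
    by rewrite lt0n dimv_eq0; apply/eqP => E0; have := memvf (1 : D);
       rewrite E0 memv0 oner_eq0.
  case: (m) m0 => // m' _.
  by rewrite det0; apply; left.
split=> //; apply/eqP; rewrite eq_le; apply/andP; split.
  rewrite leNgt; apply/negP => lt; apply: (n1 _ d1); right; exact: lt.
apply: (frac_ideal_ge (ldet_neq0 h0)).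
rewrite -[ldet _](subrK 1); apply: (frac_idealD hF); last exact: (frac_ideal1 hF).
exact: frac_ideal_le d1.
Qed.

End Determinants.

(** * The valuation ring of the division algebra *)

Section Compactness.
Variables (F : fieldType) (v : F -> int) (q : nat) (hF : local_field v q).
Variables (D : falgType F).
Hypothesis divD : forall x : D, x != 0 -> x \is a GRing.unit.
Local Notation P := (frac_ideal v).
Local Notation e := (vbasis {:D}).
Local Notation m := (\dim {:D}).
Local Notation pi := (unif v).
Local Notation L := (@lattice F v D).
Local Notation w := (@dval F v D).

(** Completeness of [F], coordinate by coordinate. *)
Lemma lattice_complete (u : nat -> D) :
  (forall k : nat, L k%:Z (u k.+1 - u k)) -> exists l, forall k : nat, L k%:Z (l - u k).
Proof.
move=> hu.
have hui k i : L k%:Z (u (k + i)%N - u k).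
  elim: i => [|i IH]; first by rewrite addn0 subrr; exact: lattice0.
  rewrite addnS -(subrK (u (k + i)%N) (u _.+1)) -addrA.
  by apply: (latticeD hF) => //; apply: lattice_le (hu _); lia.
have [l hl] : {l : 'I_m -> F & forall j, forall k, exists N, forall i, (N <= i)%N ->
    P k (crd j (u i) - l j)}.
  have H (j : 'I_m) : exists l, forall k, exists N, forall i, (N <= i)%N ->
      P k (crd j (u i) - l).
    apply: (val_complete hF) => k; exists `|k|%N => i i' hi hi'.
    have hP i0 : (`|k| <= i0)%N -> P k (crd j (u i0) - crd j (u `|k|%N)).
      move=> h; rewrite -crdB; apply: (@frac_ideal_le _ _ _ `|k|%N%:Z); first lia.
      by rewrite -(subnKC h); exact: hui.
    have -> : crd j (u i) - crd j (u i') = crd j (u i) - crd j (u `|k|%N) -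
       (crd j (u i') - crd j (u `|k|%N)) by ring.
    by apply: (frac_idealB hF); exact: hP.
  exact: (choice H).
exists (\sum_j l j *: e`_j) => k j; rewrite crdB crd_lin.
have [N hN] := hl j k%:Z.
have -> : l j - crd j (u k) = (crd j (u (k + N)%N) - crd j (u k)) -
   (crd j (u (k + N)%N) - l j) by ring.
apply: (frac_idealB hF); first by rewrite -crdB; exact: hui.
by apply: hN; exact: leq_addl.
Qed.

(** Compactness of the unit sphere. If the valuation were unbounded there,
    Koenig's lemma would give a converging sequence along which it tends
    to infinity. The limit [l] is non-zero, hence invertible, and the
    valuation is constant near [l] because [x = l * (1 + h)] with [h]
    small. *)
Lemma sphere_bound : exists M : nat, forall x, L 0 x -> ~ L 1 x -> w x <= M%:Z.
Proof.
apply: contrapT => hno.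
(* The valuation is unbounded on the part of the sphere close to [c]. *)
pose bad (k : nat) (c : D) := forall M : nat, exists x,
  [/\ L 0 x, ~ L 1 x, L k%:Z (x - c) & M%:Z < w x].
have bad0 : bad 0%N 0.
  move=> M; apply: contrapT => h; apply: hno; exists M => x x0 x1.
  rewrite leNgt; apply/negP => lt; apply: h; exists x; split=> //.
  by rewrite subr0.
have step (p : nat * D) : exists c', bad p.1 p.2 -> bad p.1.+1 c' /\ L p.1%:Z (c' - p.2).
  case: p => k c /=.
  have [hb|hb] := pselect (bad k c); last by exists c.
  have [s hs] := lattice_transversal hF D k%:Z (k.+1)%:Z.
  apply: contrapT => hc.
  have nb r : exists M : nat, L k%:Z r -> forall x, L 0 x -> ~ L 1 x ->
      L k.+1%:Z (x - (c + r)) -> w x <= M%:Z.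
    have [Lr|nLr] := pselect (L k%:Z r); last by exists 0%N.
    apply: contrapT => h; apply: hc; exists (c + r) => _; split; last by rewrite addrC addKr.
    move=> M; apply: contrapT => h'; apply: h; exists M => _ x x0 x1 xr.
    by rewrite leNgt; apply/negP => lt; apply: h'; exists x.
  have [g hg] := choice nb.
  have [x [x0 x1 xc xw]] := hb (\sum_(r <- s) g r)%N.
  have [r rs xr] := hs _ xc.
  have Lr : L k%:Z r.
    rewrite -[r](subKr (x - c)); apply: (latticeB hF) => //; apply: lattice_le xr; lia.
  have := hg r Lr x x0 x1; rewrite opprD addrA => /(_ xr).
  by rewrite (big_rem r) //= in xw; lia.
have [nxt hn] := choice step.
pose u := fix u (k : nat) : D := if k is k'.+1 then nxt (k', u k') else 0.
have ub k : bad k (u k) by elim: k => [//|k IH]; have [] := hn (k, u k) IH.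
have uc (k : nat) : L k%:Z (u k.+1 - u k) by have [] := hn (k, u k) (ub k).
have [l hl] := lattice_complete uc.
have l0 : l != 0.
  have [x [x0 x1 xc _]] := ub 1%N 0%N.
  apply: (@notin_lattice_neq0 _ v _ 1) => Ll; apply: x1.
  rewrite -(subrK (u 1%N) x); apply: (latticeD hF) => //.
  by rewrite -[u _](subKr l); apply: (latticeB hF) => //; exact: hl.
have [K hK] := dval_near1 hF divD.
have [C hC] := lattice_mul hF D.
have [a ha] := lattice_exhaust v l^-1.
have [x [x0 x1 xc xw]] := ub (K + C + a)%N `|w l|%N.
have xl : L (K + C + a)%N%:Z (x - l).
  rewrite -(subrK (u (K + C + a)%N) x) -addrA.
  by apply: (latticeD hF) => //; rewrite -opprB; apply: (latticeN hF); exact: hl.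
have hh := hC _ _ _ _ ha xl.
have [|h0 hw] := hK (l^-1 * (x - l)); first by apply: lattice_le hh; lia.
have xE : x = l * (1 + l^-1 * (x - l)).
  by rewrite mulrDr mulr1 mulVKr ?divD // addrC subrK.
by move: xw; rewrite xE (dvalM hF) // hw; lia.
Qed.

Lemma dimD_gt0 : (0 < m)%N.
Proof.
by rewrite lt0n dimv_eq0; apply/eqP => E0; have := memvf (1 : D);
   rewrite E0 memv0 oner_eq0.
Qed.

Lemma dval_unif (k : int) x : x != 0 -> w (pi ^ k *: x) = k * m%:Z + w x.
Proof. by move=> x0; rewrite (dvalZ hF divD) ?(unifz_neq0 hF) // (valuation_unifz hF). Qed.

(** Rescale to the unit sphere by a power of the uniformizer. *)
Lemma integral_bounded : exists M : nat, forall x, x != 0 -> 0 <= w x -> L (- M%:Z) x.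
Proof.
have [M hM] := sphere_bound; exists M => x x0 wx.
have [k [Lk Lk1]] := lattice_order_ex v x0.
apply: (lattice_le _ Lk).
have := hM (pi ^ (- k) *: x); rewrite dval_unif // => h.
have {}h : - k * m%:Z + w x <= M%:Z.
  apply: h; first (apply/(lattice_shiftE hF); rewrite addr0; exact: Lk).
  by move/(lattice_shiftE hF).
have := dimD_gt0; nia.
Qed.

(** The powers of [x] stay in a fixed lattice, hence so do the powers of [1 +
    x], which are sums of integral multiples of them; and power-bounded
    elements have non-negative valuation. This argument takes the place of
    Hensel's lemma. *)
Lemma dval1D x : x != 0 -> 0 <= w x -> 1 + x != 0 -> 0 <= w (1 + x).
Proof.
move=> x0 wx x1; have [M hM] := integral_bounded.
apply: (dval_powers_ge0 hF divD x1 (C := - M%:Z)) => k.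
rewrite exprDn_comm; last exact/commr_sym/commr1.
apply: (lattice_sum hF) => i _; rewrite expr1n mul1r -scaler_nat.
apply: (latticeZ0 hF); first exact: (frac_ideal_nat hF).
by apply: hM; [exact: expD_neq0|rewrite (dvalX hF) // mulrn_wge0].
Qed.

(** Divide by the summand of smaller valuation. *)
Lemma dval_add x y (k : int) : x != 0 -> y != 0 -> x + y != 0 ->
  k <= w x -> k <= w y -> k <= w (x + y).
Proof.
wlog xy : x y / w x <= w y.
  move=> H x0 y0 xy0 hx hy; have [/H|/ltW/H] := leP (w x) (w y); first exact.
  by rewrite [y + x]addrC; apply.
move=> x0 y0 xy0 hx hy.
have E : x + y = x * (1 + x^-1 * y) by rewrite mulrDr mulr1 mulVKr ?divD.
have u0 : x^-1 * y != 0 by rewrite mulD_neq0 ?invD_neq0.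
have u1 : 1 + x^-1 * y != 0 by move: xy0; rewrite E; apply: contra_neq => ->; rewrite mulr0.
rewrite E (dvalM hF) //; apply: ler_wpDr => //; apply: dval1D => //.
by rewrite (dvalM hF) ?invD_neq0 // (dvalV hF) //; lia.
Qed.

Definition dideal (k : int) : set D := [set x | x = 0 \/ k <= w x]%classic.

Lemma dideal0 k : dideal k 0. Proof. by left. Qed.
Lemma didealD k x y : dideal k x -> dideal k y -> dideal k (x + y).
Proof.
have [->|x0] := eqVneq x 0; first by rewrite add0r.
have [->|y0] := eqVneq y 0; first by rewrite addr0.
have [->|xy] := eqVneq (x + y) 0; first by left.
by move=> [/eqP|hx]; rewrite ?(negPf x0) // => -[/eqP|hy]; rewrite ?(negPf y0) //; right; exact: dval_add.
Qed.
Lemma didealN k x : dideal k x -> dideal k (- x).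
Proof. by case=> [->|h]; [left; rewrite oppr0|right; rewrite (dvalN hF divD)]. Qed.
Lemma didealB k x y : dideal k x -> dideal k y -> dideal k (x - y).
Proof. by move=> hx hy; apply/didealD/didealN. Qed.
Lemma dideal_ge k x : x != 0 -> dideal k x -> k <= w x.
Proof. by move=> /eqP x0 [/x0|]. Qed.
Lemma didealM k l x y : dideal k x -> dideal l y -> dideal (k + l) (x * y).
Proof.
have [->|x0] := eqVneq x 0; first by rewrite mul0r; left.
have [->|y0] := eqVneq y 0; first by rewrite mulr0; left.
by move=> /(dideal_ge x0) hx /(dideal_ge y0) hy; right; rewrite (dvalM hF) // lerD.
Qed.
Lemma dideal_le k l x : k <= l -> dideal l x -> dideal k x.
Proof. by move=> kl [->|h]; [left|right; exact: le_trans h]. Qed.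
Lemma dideal1 : dideal 0 1. Proof. by right; rewrite (dval1 hF). Qed.

Lemma didealX x k : dideal 0 x -> dideal 0 (x ^+ k).
Proof.
move=> hx; elim: k => [|k IH]; first exact: dideal1.
by rewrite exprS -[0]addr0; apply: didealM.
Qed.

Lemma didealZ k l a x : P k a -> dideal l x -> dideal (k * m%:Z + l) (a *: x).
Proof.
have [->|a0] := eqVneq a 0; first by rewrite scale0r; left.
have [->|x0] := eqVneq x 0; first by rewrite scaler0; left.
move=> /(frac_ideal_ge a0) hx /(dideal_ge x0) hy; right; rewrite (dvalZ hF) //.
by apply: lerD => //; apply: ler_wpM2r.
Qed.

Lemma didealZ0 l a x : P 0 a -> dideal l x -> dideal l (a *: x).
Proof. by move=> ha hx; have := didealZ ha hx; rewrite mul0r add0r. Qed.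

Lemma dideal_sum k (I : Type) (r : seq I) (Q : pred I) (f : I -> D) :
  (forall i, Q i -> dideal k (f i)) -> dideal k (\sum_(i <- r | Q i) f i).
Proof. by move=> h; apply: big_ind => //; [left|apply: didealD]. Qed.

Lemma lattice_dideal : exists M : nat, forall k x, L k x -> dideal (k * m%:Z - M%:Z) x.
Proof.
have [C hC] := ldet_bound hF D; exists C => k x Lx.
have [->|x0] := eqVneq x 0; first by left.
right; apply: (frac_ideal_ge (ldet_neq0 divD x0)); exact: hC.
Qed.

Lemma dideal_lattice : exists M : nat, forall x, dideal 0 x -> L (- M%:Z) x.
Proof.
have [M hM] := integral_bounded; exists M => x [->|]; first exact: lattice0.
by have [->|x0] := eqVneq x 0; [move=> _; exact: lattice0|exact: hM].
Qed.

(** The valuation ring lies between two lattices with finite quotient; it is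
    generated by a basis of the smaller one and finitely many
    representatives. *)
Lemma dideal_order : is_order v (dideal 0).
Proof.
split.
- exact: dideal1.
- exact: didealB.
- by move=> x y hx hy; rewrite -[0]addr0; exact: didealM.
have [M hM] := dideal_lattice; have [M' hM'] := lattice_dideal.
have [s hs] := lattice_transversal hF D (- M%:Z) M'%:Z.
pose s' := [seq r <- s | `[< dideal 0 r >]].
pose b1 := [seq pi ^ M'%:Z *: (e`_(nat_of_ord i)) | i <- enum 'I_m].
have Lint x : L M'%:Z x -> dideal 0 x.
  by move=> /hM'; apply: dideal_le; have := dimD_gt0; nia.
have b1i (i : 'I_m) : dideal 0 (pi ^ M'%:Z *: (e`_i)).
  by apply: Lint; move/(lattice_shift hF M'%:Z): (lattice_basis hF i); rewrite addr0.
pose b := in_tuple (b1 ++ s').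
have sz1 : size b1 = m by rewrite size_map size_enum_ord.
have bO j : (j < size (b1 ++ s'))%N -> dideal 0 b`_j.
  move=> /(mem_nth 0); rewrite mem_cat => /orP[/mapP[i _ ->]|]; first exact: b1i.
  by rewrite mem_filter => /andP[/asboolP].
(* The integral combinations of the generators. *)
pose Q x := exists c : 'I_(size (b1 ++ s')) -> F,
    (forall i, P 0 (c i)) /\ x = \sum_i c i *: b`_i.
have QD x y : Q x -> Q y -> Q (x + y).
  move=> [c [hc ->]] [c' [hc' ->]]; exists (fun i => c i + c' i); split=> [i|].
    exact: (frac_idealD hF).
  by rewrite -big_split; apply: eq_bigr => i _; rewrite scalerDl.
have QZ a x : P 0 a -> Q x -> Q (a *: x).
  move=> ha [c [hc ->]]; exists (fun i => a * c i); split=> [i|].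
    exact: (frac_ideal_mull hF).
  by rewrite scaler_sumr; apply: eq_bigr => i _; rewrite scalerA.
have Q0 : Q 0.
  exists (fun=> 0); split=> [i|]; first exact: frac_ideal0.
  by rewrite big1 // => i _; rewrite scale0r.
have Qsum (f : 'I_m -> D) : (forall i, Q (f i)) -> Q (\sum_i f i).
  by move=> h; apply: big_ind => //.
have Qmem x : x \in b1 ++ s' -> Q x.
  move=> xb; have xi : (index x (b1 ++ s') < size (b1 ++ s'))%N by rewrite index_mem.
  exists (fun i => (i == Ordinal xi)%:R); split=> [i|]; first exact: (frac_ideal_nat hF).
  rewrite (bigD1 (Ordinal xi)) //= eqxx scale1r nth_index // big1 ?addr0 //.
  by move=> i /negPf ->; rewrite scale0r.
have key x : dideal 0 x -> Q x.
  move=> hx; have [r rs hr] := hs x (hM x hx).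
  have hr0 : dideal 0 r by rewrite -[r](subKr x); apply: didealB => //; exact: Lint.
  have rs' : r \in b1 ++ s' by rewrite mem_cat mem_filter rs andbT (asboolT hr0) orbT.
  have [c1 c1E] : exists c1 : 'I_m -> F, (forall i, P 0 (c1 i)) /\
      x - r = \sum_i c1 i *: (pi ^ M'%:Z *: e`_i).
    exists (fun i => pi ^ (- M'%:Z) * crd i (x - r)); split=> [i|].
      apply/(frac_ideal_shift hF M'%:Z); rewrite mulrA -expfzDr ?(unif_neq0 hF) // subrr mul1r.
      by rewrite addr0; exact: hr.
    rewrite [LHS]crd_sum; apply: eq_bigr => i _; rewrite scalerA mulrAC -expfzDr ?(unif_neq0 hF) //.
    by rewrite addNr mul1r.
  rewrite -(subrK r x); apply: QD; last exact: Qmem.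
  case: c1E => hc1 ->; apply: Qsum => i; apply: QZ => //; apply: Qmem.
  by rewrite mem_cat; apply/orP; left; apply/mapP; exists i; rewrite ?mem_enum.
exists (size b), b; split=> [|x]; last first.
  split; first exact: key.
  case=> c [hc ->]; apply: dideal_sum => i _; apply: didealZ0 => //; exact: bO.
apply/eqP; rewrite eqEsubv subvf /=; apply/subvP => x _; rewrite (crd_sum x).
apply: rpred_sum => i _; apply: rpredZ.
have -> : e`_i = pi ^ (- M'%:Z) *: (pi ^ M'%:Z *: e`_i).
  by rewrite scalerA -expfzDr ?(unif_neq0 hF) // addNr scale1r.
apply: rpredZ; apply: memv_span.
by rewrite mem_cat; apply/orP; left; apply/mapP; exists i; rewrite ?mem_enum.
Qed.

End Compactness.

(** * The maximal order and its maximal ideal *)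

Section MaximalOrder.
Variables (F : fieldType) (v : F -> int) (q : nat) (hF : local_field v q).
Variables (D : falgType F).
Hypothesis divD : forall x : D, x != 0 -> x \is a GRing.unit.
Local Notation P := (frac_ideal v).
Local Notation L := (@lattice F v D).
Local Notation w := (@dval F v D).
Local Notation dideal := (@dideal F v D).

Lemma order_bounded (O : set D) : is_order v O -> exists C : nat, forall x, O x -> L (- C%:Z) x.
Proof.
move=> /order_lattice[k [b [_ hb]]].
have H (i : 'I_k) : exists c : nat, L (- c%:Z) b`_i by exact: lattice_exhaust.
have [g hg] := choice H; exists (\sum_i g i)%N => x /hb[c [hc ->]].
apply: (lattice_sum hF) => i _; apply: (latticeZ0 hF) => //; apply: lattice_le (hg i).
by rewrite (bigD1 i) //=; lia.
Qed.

(** The elements of an order are power-bounded. *)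
Lemma order_sub_dideal (O : set D) x : is_order v O -> O x -> dideal 0 x.
Proof.
move=> hO Ox; have [->|x0] := eqVneq x 0; first by left.
have [C hC] := order_bounded hO.
right; apply: (dval_powers_ge0 hF divD x0 (C := - C%:Z)) => k; apply: hC.
elim: k => [|k IH]; first by rewrite expr0; exact: Defs.order1 hO.
by rewrite exprS; apply: (Defs.orderM hO).
Qed.

(** The valuation ring is an order that contains all others. *)
Lemma maximal_orderE (O : set D) : maximal_order v O -> O = dideal 0.
Proof.
move=> hO; symmetry; apply: (max_order hO); first exact: (dideal_order hF divD).
by move=> x; exact: (order_sub_dideal (max_is_order hO)).
Qed.

(** An element of valuation zero is a unit of the valuation ring, so a proper
    ideal consists of elements of positive valuation. *)
Lemma maximal_idealE (O I : set D) : maximal_order v O -> maximal_ideal O I -> I = dideal 1.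
Proof.
move=> /maximal_orderE -> hI.
have nI1 : ~ I 1.
  move=> I1; apply: (max_proper hI); apply/seteqP; split; first exact: (ideal_sub hI).
  by move=> x Ox; rewrite -[x]mulr1; exact: (Defs.idealMl hI).
have sub : (I `<=` dideal 1)%classic.
  move=> x Ix; have [->|x0] := eqVneq x 0; first by left.
  have := dideal_ge x0 (ideal_sub hI Ix); rewrite le_eqVlt => /orP[/eqP wx|]; last first.
    by move=> h; right; lia.
  case: nI1; rewrite -(divrr (divD x0)); apply: (Defs.idealMr hI) => //.
  by right; rewrite (dvalV hF) // -wx.
have hd : is_ideal (dideal 0) (dideal 1).
  split.
  - by move=> x; exact: (dideal_le ler01).
  - exact: dideal0.
  - exact: (didealB hF divD).
  - by move=> a x ha hx; rewrite -[1]add0r; exact: (didealM hF divD).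
  - by move=> a x ha hx; rewrite -[1]addr0; exact: (didealM hF divD).
have [//|E] := max_ideal hI hd sub.
have : dideal 1 1 by rewrite E; exact: (dideal1 hF).
by move/(dideal_ge (oner_neq0 _)); rewrite (dval1 hF).
Qed.

End MaximalOrder.

(** * Residue fields *)

(** The data defining a finite residue ring. Non-members of the ideal are
    invertible modulo it, so the quotient is a finite skew field and, by
    Wedderburn's theorem, a field. A transversal is part of the data in
    order to realize the quotient on its index type, which is finite by
    construction. *)
Record residue_data (A : nzRingType) := ResidueData {
  rd_ring : set A; rd_ideal : set A; rd_card : nat; rd_rep : 'I_rd_card -> A;
  rd_1 : rd_ring 1;
  rd_B : forall x y, rd_ring x -> rd_ring y -> rd_ring (x - y);
  rd_M : forall x y, rd_ring x -> rd_ring y -> rd_ring (x * y);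
  rd_iB : forall x y, rd_ideal x -> rd_ideal y -> rd_ideal (x - y);
  rd_iMl : forall x y, rd_ring x -> rd_ideal y -> rd_ideal (x * y);
  rd_iMr : forall x y, rd_ideal x -> rd_ring y -> rd_ideal (x * y);
  rd_sub : forall x, rd_ideal x -> rd_ring x;
  rd_proper : ~ rd_ideal 1;
  rd_inv : forall x, rd_ring x -> ~ rd_ideal x ->
    exists2 y, rd_ring y & rd_ideal (y * x - 1) /\ rd_ideal (x * y - 1);
  rd_ring_rep : forall i, rd_ring (rd_rep i);
  rd_repP : forall x, rd_ring x -> exists! i, rd_ideal (x - rd_rep i) }.

Section Residue.
Variables (A : nzRingType) (d : residue_data A).
Local Notation O := (rd_ring d).
Local Notation I := (rd_ideal d).
Local Notation r := (@rd_rep A d).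

Definition residue : Type := 'I_(rd_card d).

HB.instance Definition _ := Finite.on residue.

Fact rd_ring0 : O 0.
Proof. by rewrite -(subrr 1); apply: rd_B; exact: rd_1. Qed.
Fact rd_ringN x : O x -> O (- x).
Proof. by move=> h; rewrite -sub0r; apply: rd_B => //; exact: rd_ring0. Qed.
Fact rd_ringD x y : O x -> O y -> O (x + y).
Proof. by move=> hx hy; rewrite -[y]opprK; apply/rd_B/rd_ringN. Qed.
Fact rd_ideal0 : I 0.
Proof. by have [i [h _]] := rd_repP rd_ring0; rewrite -(subrr (0 - r i)); exact: rd_iB. Qed.
Fact rd_idealN x : I x -> I (- x).
Proof. by move=> h; rewrite -sub0r; apply: rd_iB => //; exact: rd_ideal0. Qed.
Fact rd_idealD x y : I x -> I y -> I (x + y).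
Proof. by move=> hx hy; rewrite -[y]opprK; apply/rd_iB/rd_idealN. Qed.

Fact red_ex x : exists i : residue, O x -> I (x - r i).
Proof.
have [h|h] := pselect (O x); first by have [i [hi _]] := rd_repP h; exists i.
by have [i _] := rd_repP rd_ring0; exists i.
Qed.

Definition red (x : A) : residue := projT1 (cid (red_ex x)).

Lemma redP x : O x -> I (x - r (red x)).
Proof. by rewrite /red; case: cid. Qed.

Lemma red_eq x y : O x -> O y -> red x = red y <-> I (x - y).
Proof.
move=> hx hy; have ix := redP hx; have iy := redP hy; split=> [E|hxy].
  rewrite -E in iy.
  have -> : x - y = (x - r (red x)) - (y - r (red x)) by rewrite opprB addrA subrK.
  exact: rd_iB.
have [i [_ ui]] := rd_repP hx; rewrite -(ui _ ix); apply: ui.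
by rewrite -(subrK y x) -addrA; exact: rd_idealD.
Qed.

Lemma red_rep (i : residue) : red (r i) = i.
Proof.
have [j [_ uj]] := rd_repP (rd_ring_rep i).
by rewrite -(uj _ (redP (rd_ring_rep i))); apply: uj; rewrite subrr; exact: rd_ideal0.
Qed.

Lemma red_rep_eq x y : O x -> O y -> I (x - y) -> red x = red y.
Proof. by move=> hx hy /red_eq; apply. Qed.

Definition radd (i j : residue) : residue := red (r i + r j).
Definition ropp (i : residue) : residue := red (- r i).
Definition rmul (i j : residue) : residue := red (r i * r j).

Lemma redD x y : O x -> O y -> radd (red x) (red y) = red (x + y).
Proof.
move=> hx hy; apply: red_rep_eq.
- by apply: rd_ringD; exact: rd_ring_rep.
- exact: rd_ringD.
rewrite -opprB; apply: rd_idealN.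
have -> : x + y - (r (red x) + r (red y)) = (x - r (red x)) + (y - r (red y)).
  by rewrite opprD addrACA.
by apply: rd_idealD; exact: redP.
Qed.

Lemma redN x : O x -> ropp (red x) = red (- x).
Proof.
move=> hx; apply: red_rep_eq.
- by apply: rd_ringN; exact: rd_ring_rep.
- exact: rd_ringN.
by rewrite opprK addrC; exact: redP.
Qed.

Lemma redM x y : O x -> O y -> rmul (red x) (red y) = red (x * y).
Proof.
move=> hx hy; apply: red_rep_eq.
- by apply: rd_M; exact: rd_ring_rep.
- exact: rd_M.
rewrite -opprB; apply: rd_idealN.
have -> : x * y - r (red x) * r (red y) = (x - r (red x)) * y + r (red x) * (y - r (red y)).
  by rewrite mulrBl mulrBr addrA subrK.
apply: rd_idealD; first by apply: rd_iMr => //; exact: redP.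
by apply: rd_iMl; [exact: rd_ring_rep|exact: redP].
Qed.

Let O_rep := (@rd_ring_rep A d).

Fact raddA : associative radd.
Proof.
move=> i j k; rewrite -(red_rep i) -(red_rep j) -(red_rep k).
by rewrite !redD ?addrA //; apply: rd_ringD.
Qed.
Fact raddC : commutative radd.
Proof. by move=> i j; rewrite -(red_rep i) -(red_rep j) !redD // addrC. Qed.
Fact radd0 : left_id (red 0) radd.
Proof. by move=> i; rewrite -(red_rep i) redD ?add0r //; exact: rd_ring0. Qed.
Fact raddN : left_inverse (red 0) ropp radd.
Proof.
by move=> i; rewrite -(red_rep i) redN ?redD ?addNr //; apply: rd_ringN.
Qed.

HB.instance Definition _ := GRing.isZmodule.Build residue raddA raddC radd0 raddN.

Fact rmulA : associative rmul.
Proof.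
move=> i j k; rewrite -(red_rep i) -(red_rep j) -(red_rep k).
by rewrite !redM ?mulrA //; apply: rd_M.
Qed.
Fact rmul1l : left_id (red 1) rmul.
Proof. by move=> i; rewrite -(red_rep i) redM ?mul1r //; exact: rd_1. Qed.
Fact rmulr1 : right_id (red 1) rmul.
Proof. by move=> i; rewrite -(red_rep i) redM ?mulr1 //; exact: rd_1. Qed.
Fact rmulDl : left_distributive rmul radd.
Proof.
move=> i j k; rewrite -(red_rep i) -(red_rep j) -(red_rep k).
by rewrite !(redD, redM) ?mulrDl //; solve [apply: rd_ringD => // | apply: rd_M => //].
Qed.
Fact rmulDr : right_distributive rmul radd.
Proof.
move=> i j k; rewrite -(red_rep i) -(red_rep j) -(red_rep k).
by rewrite !(redD, redM) ?mulrDr //; solve [apply: rd_ringD => // | apply: rd_M => //].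
Qed.
Fact rone_neq0 : red 1 != red 0.
Proof.
apply/eqP => /red_eq; rewrite subr0 => /(_ (@rd_1 _ _) rd_ring0).
exact: rd_proper.
Qed.

HB.instance Definition _ := GRing.Zmodule_isNzRing.Build residue
  rmulA rmul1l rmulr1 rmulDl rmulDr rone_neq0.

Lemma red_eq0 x : O x -> (red x == 0) <-> I x.
Proof.
move=> hx; rewrite -[X in I X]subr0; split=> [/eqP|].
  by move/red_eq; apply=> //; exact: rd_ring0.
by move=> h; apply/eqP/red_eq => //; exact: rd_ring0.
Qed.

Fact rinv_ex (i : residue) : exists j : residue, i != 0 -> j * i = 1 /\ i * j = 1.
Proof.
have [->|i0] := eqVneq i 0; first by exists 0.
have [|y hy [h1 h2]] := rd_inv (O_rep i).
  by move=> /(red_eq0 (O_rep i)); rewrite red_rep (negPf i0).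
exists (red y) => _; rewrite -(red_rep i).
by split; (transitivity (red 1); last by []); rewrite [LHS]redM //;
  apply: red_rep_eq => //; first [exact: rd_1|exact: rd_M].
Qed.

Definition rinv (i : residue) : residue :=
  if i == 0 then i else projT1 (cid (rinv_ex i)).

Fact rinvP (i : residue) : i != 0 -> rinv i * i = 1 /\ i * rinv i = 1.
Proof.
by move=> i0; rewrite /rinv ifN //; exact: (projT2 (cid (rinv_ex i)) i0).
Qed.

Fact rmulV : {in [pred i : residue | i != 0], left_inverse 1 rinv *%R}.
Proof. by move=> i /rinvP[]. Qed.
Fact rdivV : {in [pred i : residue | i != 0], right_inverse 1 rinv *%R}.
Proof. by move=> i /rinvP[]. Qed.
Fact runitP (x y : residue) : y * x = 1 /\ x * y = 1 -> [pred i : residue | i != 0] x.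
Proof.
by case=> h _; apply/eqP => x0; move: h; rewrite x0 mulr0 => /eqP; rewrite eq_sym oner_eq0.
Qed.
Fact rinv_out : {in [predC [pred i : residue | i != 0]], rinv =1 id}.
Proof. by move=> i; rewrite inE /= negbK /rinv => h; rewrite ifT. Qed.

HB.instance Definition _ := GRing.NzRing_hasMulInverse.Build residue
  rmulV rdivV runitP rinv_out.

Fact residue_domain : GRing.integral_domain_axiom residue.
Proof.
move=> x y h; have [_|x0] := eqVneq x 0; first by [].
have [h1 _] := rinvP x0.
by have -> : y = 0; [rewrite -[LHS]mul1r -h1 -mulrA h mulr0|rewrite eqxx orbT].
Qed.

Definition residue_field : finFieldType := FinDomainFieldType residue_domain.

End Residue.

Lemma residue_fieldP (A : nzRingType) (d : residue_data A) :
  exists (k : finFieldType) (red : A -> k),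
  [/\ #|k| = rd_card d,
      (forall x y, rd_ring d x -> rd_ring d y -> red (x + y) = red x + red y) /\
      (forall x y, rd_ring d x -> rd_ring d y -> red (x * y) = red x * red y),
      red 1 = 1,
      (forall x, rd_ring d x -> (red x == 0) <-> rd_ideal d x) &
      (forall c, exists2 x, rd_ring d x & red x = c)].
Proof.
exists (residue_field d), (@red A d); split.
- exact: card_ord.
- by split=> x y hx hy; [exact: (esym (redD hx hy))|exact: (esym (redM hx hy))].
- exact: erefl.
- exact: red_eq0.
- by move=> c; exists (rd_rep c); [exact: rd_ring_rep|exact: red_rep].
Qed.

(** * Frobenius conjugates in a finite field *)

Section FiniteFields.
Variable K : finFieldType.

(** The left hand side is the degree of the polynomial used in the next proof. *)
Lemma sum_pow_bound (q n : nat) : (1 < q)%N -> (0 < n)%N ->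
  (q ^ n.-1 + \sum_(1 <= d < n./2.+1) (q ^ d - 1) < q ^ n)%N.
Proof.
move=> q1 n0.
have geo h : (\sum_(1 <= d < h.+1) (q ^ d - 1) + q <= q ^ h.+1)%N.
  elim: h => [|h IH]; first by rewrite big_geq // expn1.
  rewrite big_nat_recr //= (expnS q h.+1).
  have : (1 <= q ^ h.+1)%N by rewrite expn_gt0; lia.
  by move: IH; set S := (\sum_(_ <= _ < _) _)%N; set Q := (q ^ h.+1)%N; nia.
case: n n0 => // -[|[|n]] _.
- by rewrite big_geq //= expn0 expn1; lia.
- by rewrite big_nat1 /= !expnS expn0 !muln1; nia.
have hh : ((n.+3)./2.+1 <= n.+2)%N by lia.
have := geo (n.+3)./2; have := leq_pexp2l (ltnW q1) hh.
rewrite /= (expnS q n.+2); set S := (\sum_(_ <= _ < _) _)%N; nia.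
Qed.

(** Count roots: the elements of trace zero and the elements of the proper
    subfields are roots of a polynomial whose degree is less than the
    number of elements of the field. *)
Lemma exists_generator_trace_neq0 (q n : nat) :
  (1 < q)%N -> (0 < n)%N -> #|K| = (q ^ n)%N ->
  exists b : K, (forall d, (0 < d < n)%N -> b ^+ (q ^ d) != b) /\
    \sum_(i < n) b ^+ (q ^ i) != 0.
Proof.
move=> q1 n0 cK.
have [|hN] := boolP [exists b : K, [forall d : 'I_n, (0 < d)%N ==> (b ^+ (q ^ d) != b)] &&
   (\sum_(i < n) b ^+ (q ^ i) != 0)].
  move=> /existsP[b /andP[/forallP hb hs]]; exists b; split=> // d /andP[d0 dn].
  by have /implyP := hb (Ordinal dn); apply.
pose T : {poly K} := \sum_(i < n) 'X^(q ^ i).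
pose E : {poly K} := \prod_(1 <= d < n./2.+1) ('X^(q ^ d - 1) - 1).
have q0 : (0 < q)%N by lia.
have qd d : (0 < d)%N -> (0 < q ^ d - 1)%N.
  by move=> d0; rewrite subn_gt0 -(expn0 q) ltn_exp2l.
have sE : (size E <= (\sum_(1 <= d < n./2.+1) (q ^ d - 1)).+1)%N /\ E != 0.
  rewrite /E !big_nat; elim: (index_iota _ _) => [|d s [IHs IH0]].
    by rewrite !big_nil size_poly1 oner_neq0.
  rewrite !big_cons; case: ifP => // /andP[d0 _].
  have sd : size ('X^(q ^ d - 1) - 1 : {poly K}) = (q ^ d - 1).+1.
    by rewrite size_XnsubC // qd.
  split; last by rewrite mulf_neq0 // -size_poly_gt0 sd.
  apply: (leq_trans (size_polyMleq _ _)); rewrite sd; lia.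
have [n' nE] : exists n', n = n'.+1 by exists n.-1; rewrite prednK.
have sT : size T = (q ^ n.-1).+1.
  rewrite /T nE big_ord_recr /= addrC size_polyDl size_polyXn //.
  apply: leq_ltn_trans (size_sum _ _ _) _; apply/bigmax_leqP => i _.
  by rewrite size_polyXn ltn_exp2l.
have T0 : T != 0 by rewrite -size_poly_gt0 sT.
case: sE => sE E0.
have TE0 : T * E != 0 by rewrite mulf_neq0.
have sTE : (size (T * E)%R <= q ^ n)%N.
  apply: (leq_trans (size_polyMleq _ _)); rewrite sT.
  have := sum_pow_bound q1 n0; move: sE; set S := (\sum_(_ <= _ < _) _)%N; lia.
have := max_poly_roots TE0 _ (enum_uniq K).
rewrite -cardT cK => h; have /h : all (root (T * E)) (enum K); last by rewrite ltnNge sTE.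
apply/allP => b _; rewrite rootM; have := hN; rewrite negb_exists => /forallP/(_ b).
rewrite negb_and negbK => /orP[|hT]; last first.
  apply/orP; left; rewrite /root /T horner_sum.
  by under eq_bigr do rewrite hornerXn.
rewrite negb_forall => /existsP[d]; rewrite negb_imply negbK => /andP[d0 /eqP bd].
have [b0|b0] := eqVneq b 0.
  apply/orP; left; rewrite /root /T horner_sum big1 // => i _.
  by rewrite hornerXn b0 expr0n expn_eq0; case: (q) q0.
apply/orP; right.
(* An element fixed by the [d]-th power of Frobenius is also fixed by the
   [(n - d)]-th one, so exponents up to [n / 2] suffice. *)
have key d' : (0 < d' <= n./2)%N -> b ^+ (q ^ d') = b -> root E b.
  move=> /andP[d'0 d'n] bd'; rewrite /root /E horner_prod.
  rewrite (bigD1_seq d') /= ?iota_uniq ?mem_index_iota ?d'0 //.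
  rewrite !hornerE; apply/eqP; rewrite (_ : _ - 1 = 0) ?mul0r //.
  apply/eqP; rewrite subr_eq0 -(inj_eq (mulfI b0)) mulr1 -exprS subn1 prednK ?bd' //.
  by rewrite expn_gt0 q0.
have [dh|dh] := leqP d n./2; first by apply: (key d) => //; rewrite d0.
apply: (key (n - d)%N); first by have := ltn_ord d; lia.
rewrite -{1}bd -exprM -expnD subnKC; last exact/ltnW/ltn_ord.
by rewrite -cK expf_card.
Qed.

Variable q : nat.
Hypothesis frobD : forall x y : K, (x + y) ^+ q = x ^+ q + y ^+ q.
Hypothesis q_gt0 : (0 < q)%N.

Lemma frob_sum (I : Type) (r : seq I) (f : I -> K) :
  (\sum_(i <- r) f i) ^+ q = \sum_(i <- r) f i ^+ q.
Proof. by apply: (big_morph (fun x => x ^+ q)) => //; rewrite expr0n; case: (q) q_gt0. Qed.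

Lemma frobB (x y : K) : (x - y) ^+ q = x ^+ q - y ^+ q.
Proof. by apply: (addIr (y ^+ q)); rewrite -frobD !subrK. Qed.

Lemma frob_inj : injective (fun x : K => x ^+ q).
Proof.
move=> x y /= h; apply/eqP; rewrite -subr_eq0; apply: contraTT isT => h0.
by have := expf_neq0 q h0; rewrite frobB h subrr eqxx.
Qed.

Lemma frobX_inj i : injective (fun x : K => x ^+ (q ^ i)).
Proof.
elim: i => [|i IH] x y /=; first by rewrite !expr1.
by rewrite !expnSr !exprM => /frob_inj/IH.
Qed.

Lemma root_frob (g : {poly K}) (a : K) i : (forall j, g`_j ^+ q = g`_j) ->
  root g a -> root g (a ^+ (q ^ i)).
Proof.
move=> hg; elim: i => [|i IH]; first by rewrite expr1.
move=> /IH /rootP; rewrite expnSr exprM; set b := a ^+ _ => h.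
apply/rootP; rewrite horner_coef.
transitivity ((\sum_(j < size g) g`_j * b ^+ j) ^+ q).
  by rewrite frob_sum; apply: eq_bigr => j _; rewrite exprMn hg exprAC.
by rewrite -horner_coef h expr0n; case: (q) q_gt0.
Qed.

Lemma conj_uniq (a : K) (f : nat) : (forall d, (0 < d < f)%N -> a ^+ (q ^ d) != a) ->
  uniq [seq a ^+ (q ^ (i : nat)) | i <- iota 0 f].
Proof.
move=> h; rewrite map_inj_in_uniq ?iota_uniq // => i j.
rewrite !mem_iota !add0n /=.
wlog ij : i j / (i <= j)%N.
  move=> H hi hj E; have [ij|/ltnW ji] := leqP i j; first exact: H.
  by symmetry; apply: H.
move=> hi hj E; apply/eqP; rewrite eqn_leq ij /= leqNgt; apply/negP => lt.
have := h (j - i)%N; rewrite subn_gt0 lt /= => /(_ _)/negP; case; first lia.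
apply/eqP; apply: (@frobX_inj i); rewrite /= -exprM -expnD subnK //.
Qed.

(** A polynomial with coefficients fixed by Frobenius that kills [a] kills its
    [f] distinct conjugates. *)
Lemma conj_poly0 (a : K) f (g : {poly K}) :
  (forall d, (0 < d < f)%N -> a ^+ (q ^ d) != a) ->
  (forall j, g`_j ^+ q = g`_j) -> (size g <= f)%N -> root g a -> g = 0.
Proof.
move=> ha hg sg ga; apply/eqP; apply: contraTT sg => g0; rewrite -ltnNge.
have := max_poly_roots g0 _ (conj_uniq ha); rewrite size_map size_iota; apply.
by apply/allP => _ /mapP[i _ ->]; exact: root_frob.
Qed.

(** The conjugates of [a] are all the roots of [g]. *)
Lemma conj_poly_trace (a : K) f (g : {poly K}) :
  (forall d, (0 < d < f)%N -> a ^+ (q ^ d) != a) ->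
  (forall j, g`_j ^+ q = g`_j) -> (0 < f)%N -> size g = f.+1 -> g \is monic -> root g a ->
  g`_f.-1 = - \sum_(i < f) a ^+ (q ^ i).
Proof.
move=> ha hg f0 sg gm ga.
have sz : size [seq a ^+ (q ^ (i : nat)) | i <- iota 0 f] = f by rewrite size_map size_iota.
have := @all_roots_prod_XsubC _ g [seq a ^+ (q ^ (i : nat)) | i <- iota 0 f].
rewrite sz sg (monicP gm) scale1r => -> //.
- have := @coefPn_prod_XsubC _ [seq a ^+ (q ^ (i : nat)) | i <- iota 0 f].
  rewrite sz => ->; last by case: (f) f0.
  by rewrite big_map -{1}(subn0 f) -/(index_iota 0 f) big_mkord.
- by apply/allP => _ /mapP[i _ ->]; exact: root_frob.
- by rewrite uniq_rootsE conj_uniq.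
Qed.

Lemma exists_primitive : exists a : K, forall x, x != 0 -> exists k, x = a ^+ k.
Proof.
have /cyclicP[u hu] := field_unit_group_cyclic [set: {unit K}]%G.
exists (val u) => x x0.
have xu : (finField_unit x0 : {unit K}) \in <[u]>%g by rewrite -hu inE.
have [k hk] := cycleP _ _ xu; exists k.
by have := congr1 val hk; rewrite FinRing.val_unitX.
Qed.

End FiniteFields.

(** * Degrees and the reduced trace *)

Section Split.
Variables (F : fieldType) (D : falgType F) (n : nat) (Trd : D -> F).
Hypothesis hTrd : reduced_trace n Trd.
Hypothesis n_gt0 : (0 < n)%N.
Local Notation m := (\dim {:D}).

Definition indep_powers (x : D) (k : nat) : Prop :=
  forall c : 'I_k -> F, \sum_i c i *: x ^+ i = 0 -> forall i, c i = 0.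

Lemma indep_powers_le x k l : (k <= l)%N -> indep_powers x l -> indep_powers x k.
Proof.
move=> kl; rewrite -(subnKC kl); elim: (l - k)%N => [|d IH]; first by rewrite addn0.
rewrite addnS => h; apply: IH => c hc i.
pose c' (j : 'I_(k + d).+1) : F := oapp c 0 (insub (val j)).
have c'i (j : 'I_(k + d)) : c' (widen_ord (leqnSn _) j) = c j by rewrite /c' /= valK.
rewrite -c'i; apply: h; rewrite big_ord_recr /= [X in X *: _](_ : _ = 0).
  by rewrite scale0r addr0 -[RHS]hc; apply: eq_bigr => j _; rewrite c'i.
by rewrite /c' /= insubF // ltnn.
Qed.

Definition power_coords (x : D) (k : nat) : 'M[F]_(k, m) := \matrix_(i, j) crd j (x ^+ i).

Lemma power_coords_mul x k (c : 'rV[F]_k) j : (c *m power_coords x k) 0 j = crd j (\sum_i c 0 i *: x ^+ i).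
Proof.
rewrite mxE /crd linear_sum; apply: eq_bigr => i _.
by rewrite mxE linearZ.
Qed.

Lemma indep_powersP x k : indep_powers x k <-> row_free (power_coords x k).
Proof.
split=> [h|/row_freeP[B hB] c hc i].
  rewrite -kermx_eq0; apply/eqP/row_matrixP => i; rewrite row0.
  have : row i (kermx (power_coords x k)) *m power_coords x k = 0 by rewrite -row_mul mulmx_ker row0.
  move: (row i _) => u hu; apply/rowP => j; rewrite [RHS]mxE.
  apply: (h (fun j => u 0 j)); apply: crd_eq => l.
  by rewrite -power_coords_mul hu mxE /crd linear0.
pose u := \row_i c i.
have u0 : u *m power_coords x k = 0.
  apply/rowP => j; rewrite power_coords_mul mxE.
  rewrite (_ : \sum_i _ = 0) ?/crd ?linear0 // -[RHS]hc.
  by apply: eq_bigr => l _; rewrite mxE.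
have : u = 0 by rewrite -[u]mulmx1 -hB mulmxA u0 mul0mx.
by move/rowP/(_ i); rewrite !mxE.
Qed.

(** The splitting representation maps a basis of [D] to a basis of the matrix
    algebra, and extending scalars does not change the rank of a family of
    coordinate vectors. So the Cayley-Hamilton relation of [rho x] forces
    a relation over [F], which is the reduced characteristic polynomial
    when the first [n] powers are independent. *)
Lemma degree_le_trace x :
  (exists c : 'I_n -> F, x ^+ n = \sum_i c i *: x ^+ i) /\
  (indep_powers x n -> forall c : 'I_n -> F, x ^+ n = \sum_i c i *: x ^+ i ->
     forall i : 'I_n, i = n.-1 :> nat -> Trd x = c i).
Proof.
have [Lf [iota [rho [rholin rho1 rhoM rhob rhoT]]]] := hTrd.
case: n n_gt0 rho rholin rho1 rhoM rhob rhoT => // n' _ rho rholin rho1 rhoM rhob rhoT.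
have rho0 : rho 0 = 0.
  have := rholin 1 0 0; rewrite rmorph1 !scale1r addr0.
  by rewrite -[X in X = _]addr0 => /addrI.
have rhoZ a y : rho (a *: y) = iota a *: rho y.
  by rewrite -[a *: y]addr0 rholin rho0 addr0.
have rhoD y z : rho (y + z) = rho y + rho z.
  by rewrite -[y]scale1r rholin rmorph1 !scale1r.
have rho_sum (I : Type) (r : seq I) (f : I -> D) :
    rho (\sum_(i <- r) f i) = \sum_(i <- r) rho (f i).
  exact: (big_morph rho rhoD rho0).
have rhoX y k : rho (y ^+ k) = (rho y : 'M[Lf]_n'.+1) ^+ k.
  by elim: k => [|k IH]; rewrite ?rho1 // !exprS rhoM IH.
have rho_crd y : rho y = \sum_j iota (crd j y) *: rho (vbasis {:D})`_j.
  by rewrite {1}(crd_sum y) rho_sum; apply: eq_bigr => j _; rewrite rhoZ.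
have rho_free (c : 'rV[Lf]_m) : \sum_j c 0 j *: rho (vbasis {:D})`_j = 0 -> c = 0.
  move=> hc; have [c0 [_ hu]] := rhob 0.
  rewrite -(hu c) // -(hu 0) //.
  by rewrite big1 // => j _; rewrite mxE scale0r.
have comb k (u : 'rV[Lf]_k) :
   \sum_i u 0 i *: rho (x ^+ i) = \sum_j (u *m map_mx iota (power_coords x k)) 0 j *: rho (vbasis {:D})`_j.
  under eq_bigr => i _ do rewrite rho_crd scaler_sumr.
  rewrite exchange_big; apply: eq_bigr => j _; rewrite mxE scaler_suml.
  by apply: eq_bigr => i _; rewrite scalerA !mxE.
pose p := char_poly (rho x); pose u : 'rV[Lf]_n'.+1 := - \row_i p`_i.
have CH : rho (x ^+ n'.+1) = \sum_i u 0 i *: rho (x ^+ i).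
  have sp : size p = n'.+2 by exact: size_char_poly.
  have pm : p`_n'.+1 = 1.
    by have /monicP := char_poly_monic (rho x); rewrite lead_coefE -/p sp.
  have := Cayley_Hamilton (rho x); rewrite -/p -[p]coefK poly_def sp.
  rewrite rmorph_sum /= big_ord_recr /= pm scale1r rmorphXn /= horner_mx_X -rhoX.
  move/eqP; rewrite addrC addr_eq0 => /eqP ->; rewrite -sumrN; apply: eq_bigr => i _.
  by rewrite linearZ /= rmorphXn /= horner_mx_X -rhoX !mxE scaleNr.
have E1 : row ord0 (map_mx iota (\row_j crd j (x ^+ n'.+1))) = u *m map_mx iota (power_coords x n'.+1).
  apply/eqP; rewrite -subr_eq0; apply/eqP/rho_free.
  under eq_bigr => j _ do rewrite mxE [X in _ + X]mxE scalerBl.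
  rewrite sumrB -comb -CH rho_crd [X in X - _](_ : _ = \sum_j iota (crd j (x ^+ n'.+1)) *: rho (vbasis {:D})`_j) ?subrr //.
  by apply: eq_bigr => j _; rewrite !mxE.
split.
  have : (row ord0 (map_mx iota (\row_j crd j (x ^+ n'.+1))) <= map_mx iota (power_coords x n'.+1))%MS.
    by rewrite E1 submxMl.
  rewrite -map_row map_submx => /submxP[c hc]; exists (fun i => c 0 i).
  apply: crd_eq => j; rewrite -power_coords_mul -hc !mxE //.
move=> /indep_powersP hfree c hc i iE.
have cu : map_mx iota (\row_i c i) = u.
  have : row_free (map_mx iota (power_coords x n'.+1)) by rewrite row_free_map.
  move/row_free_inj; apply; rewrite -E1 -map_mxM -map_row; congr map_mx.
  apply/rowP => j; rewrite power_coords_mul !mxE hc; congr crd.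
  by apply: eq_bigr => l _; rewrite mxE.
apply: (fmorph_inj iota); rewrite rhoT.
have := congr1 (fun M : 'rV_n'.+1 => M 0 i) cu; rewrite !mxE => ->.
by rewrite iE (char_poly_trace (rho x)) ?opprK.
Qed.

Lemma indep_powers_degree x k : indep_powers x k -> (k <= n)%N.
Proof.
move=> hk; rewrite leqNgt; apply/negP => nk.
have {hk nk} h := indep_powers_le nk hk.
have [[c hc] _] := degree_le_trace x.
pose c' (j : 'I_n.+1) : F := if insub (val j) is Some i then c i else - 1.
have := h c' _ ord_max; rewrite /c' /= insubF ?ltnn // => /(_ _)/eqP.
rewrite oppr_eq0 oner_eq0 => H; apply/notF/H.
rewrite big_ord_recr /= insubF ?ltnn // scaleN1r hc; apply/eqP; rewrite subr_eq0; apply/eqP.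
by apply: eq_bigr => j _; rewrite valK.
Qed.

Lemma Trd_spec : [/\ (forall a x y, Trd (a *: x + y) = a * Trd x + Trd y) &
  forall x y, Trd (x * y) = Trd (y * x)].
Proof.
have [Lf [iota [rho [rholin rho1 rhoM rhob rhoT]]]] := hTrd.
split=> [a x y|x y]; apply: (fmorph_inj iota).
  by rewrite rmorphD rmorphM !rhoT rholin mxtraceD mxtraceZ.
by rewrite !rhoT !rhoM mxtrace_mulC.
Qed.

End Split.

(** * Ramification index and residue degree *)

(** A canonical representative is chosen in each class, so that repetitions
    can be removed from the list. *)
Lemma exists_transversal (A : nzRingType) (O I : set A) (s : seq A) :
  (forall x, I x -> O x) -> I 0 -> (forall x y, O x -> O y -> O (x - y)) ->
  (forall x y, I x -> I y -> I (x - y)) ->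
  (forall x, O x -> exists2 r, r \in s & I (x - r)) ->
  exists N (r : 'I_N -> A), (forall i, O (r i)) /\
    forall x, O x -> exists! i, I (x - r i).
Proof.
move=> IO I0 OB IB hs.
have IN x : I x -> I (- x) by move=> h; rewrite -sub0r; exact: IB.
have ID x y : I x -> I y -> I (x + y) by move=> hx hy; rewrite -[y]opprK; apply/IB/IN.
pose cn x := xget 0 [set y | O y /\ I (x - y)]%classic.
have cnP x : O x -> O (cn x) /\ I (x - cn x).
  rewrite /cn => hx; case: xgetP => [y _ //|h]; case: (h x); split=> //.
  by rewrite subrr.
have cnE x y : I (x - y) -> cn x = cn y.
  move=> h; rewrite /cn; congr (xget _ _); apply/seteqP.
  split=> z [Oz hz]; split=> //.
    by rewrite -(subrK x y) -addrA; apply: ID => //; rewrite -opprB; exact: IN.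
  by rewrite -(subrK y x) -addrA; exact: ID.
pose t := undup [seq cn x | x <- s & `[< O x >]].
have tP y : y \in t -> exists2 x, O x & y = cn x.
  by rewrite mem_undup => /mapP[x]; rewrite mem_filter => /andP[/asboolP ? _] ->; exists x.
exists (size t), (fun i => t`_i); split=> [i|x hx].
  by have [x Ox ->] := tP _ (mem_nth 0 (ltn_ord i)); have [] := cnP x Ox.
have [r rs hr] := hs x hx.
have Or : O r by rewrite -[r](subKr x); apply: OB => //; exact: IO.
have cnt : cn x \in t.
  rewrite (cnE _ _ hr) mem_undup; apply: map_f.
  by rewrite mem_filter rs andbT; apply/asboolP.
have ix : (index (cn x) t < size t)%N by rewrite index_mem.
exists (Ordinal ix); split=> /=; first by rewrite nth_index //; have [] := cnP x hx.
move=> i hi; apply: val_inj => /=.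
have [x' Ox' E] := tP _ (mem_nth 0 (ltn_ord i)).
have h' : I (x' - x).
  have [_ h1] := cnP x' Ox'; rewrite -E in h1.
  have -> : x' - x = (x' - t`_i) - (x - t`_i) by rewrite opprB addrA subrK.
  exact: IB.
by rewrite -(cnE _ _ h') -E index_uniq ?undup_uniq.
Qed.

Section Structure.
Variables (F : fieldType) (v : F -> int) (q : nat) (hF : local_field v q).
Variables (D : falgType F).
Hypothesis divD : forall x : D, x != 0 -> x \is a GRing.unit.
Local Notation P := (frac_ideal v).
Local Notation m := (\dim {:D}).
Local Notation pi := (unif v).
Local Notation L := (@lattice F v D).
Local Notation w := (@dval F v D).
Local Notation dideal := (@dideal F v D).

(** The ultrametric inequality is an equality when the valuations are
    distinct. *)
Lemma distinct_valuations (I : finType) (f : I -> D) (k : int) :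
  (forall i j, i != j -> f i != 0 -> f j != 0 -> w (f i) != w (f j)) ->
  dideal k (\sum_i f i) -> forall i, dideal k (f i).
Proof.
move=> hd hs i1; have [->|fi1] := eqVneq (f i1) 0; first exact: dideal0.
have [i0 fi0 hmin] := @Order.TotalTheory.arg_minP _ _ _ i1 (fun i => f i != 0) (fun i => w (f i)) fi1.
have [kw|kw] := leP k (w (f i0)); first by right; apply: le_trans kw (hmin _ fi1).
have : dideal (w (f i0) + 1) (f i0).
  have E : f i0 = \sum_i f i - \sum_(i | i != i0) f i by rewrite (bigD1 i0) //= addrK.
  rewrite [X in dideal _ X]E; apply: (didealB hF divD).
    by apply: dideal_le hs; lia.
  apply: (dideal_sum hF divD) => i ni; have [->|fi] := eqVneq (f i) 0; first by left.
  by right; have := hmin _ fi; have /eqP := hd _ _ ni fi fi0; lia.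
by move/(dideal_ge fi0); lia.
Qed.

Lemma dval_scalar a : a != 0 -> w a%:A = v a * m%:Z.
Proof. by move=> a0; rewrite (dvalZ hF divD) ?oner_neq0 // (dval1 hF) addr0. Qed.

(** The valuations of the terms are distinct modulo [m], hence distinct. *)
Lemma powers_distinct (y : D) (g : int) (e : nat) (c : 'I_e -> F) k :
  y != 0 -> w y = g -> 0 < g -> e%:Z * g = m%:Z ->
  dideal k (\sum_i c i *: y ^+ i) -> forall i, c i != 0 -> k <= v (c i) * m%:Z + g * i%:Z.
Proof.
move=> y0 wy g0 eg hs.
have wE i : c i != 0 -> w (c i *: y ^+ i) = v (c i) * m%:Z + g * i%:Z.
  by move=> ci; rewrite (dvalZ hF divD) ?expD_neq0 // (dvalX hF divD) // wy -mulr_natr natz.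
have nz i : (c i *: y ^+ i != 0) = (c i != 0).
  by rewrite scaler_eq0 negb_or expD_neq0 // andbT.
move=> i ci; rewrite -wE //; apply: dideal_ge; first by rewrite nz.
move: i {ci}; apply: distinct_valuations hs => i j ij; rewrite !nz => ci cj.
rewrite !wE //; apply: contra ij => /eqP E; apply/eqP/val_inj => /=.
have li := ltn_ord i; have lj := ltn_ord j.
have h : (v (c i) - v (c j)) * e%:Z = j%:Z - i%:Z.
  apply: (mulfI (lt0r_neq0 g0)); move: E; rewrite -eg; lia.
have : v (c i) - v (c j) = 0 by nia.
by move=> h0; move: h; rewrite h0; lia.
Qed.

Lemma powers_indep (y : D) (g : int) (e : nat) :
  y != 0 -> w y = g -> 0 < g -> e%:Z * g = m%:Z -> indep_powers y e.
Proof.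
move=> y0 wy g0 eg c hc i; apply/eqP; apply: contraT => ci.
have := powers_distinct (k := v (c i) * m%:Z + g * i%:Z + 1) y0 wy g0 eg (c := c).
rewrite hc => /(_ (or_introl erefl) _ ci); lia.
Qed.

(** The values of the valuation are the multiples of the least positive one. *)
Lemma exists_uniformizer : exists y : D, [/\ y != 0, 0 < w y,
  (forall x, x != 0 -> 0 < w x -> w y <= w x) &
  exists2 e : nat, e%:Z * w y = m%:Z & (0 < e)%N].
Proof.
pose Q (k : nat) := `[< (0 < k)%N /\ exists2 x : D, x != 0 & w x = k%:Z >].
have pi0 : pi%:A != 0 :> D by rewrite scaler_eq0 oner_eq0 orbF (unif_neq0 hF).
have wpi : w pi%:A = m%:Z by rewrite dval_scalar ?(unif_neq0 hF) // (valuation_unif hF) mul1r.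
have exQ : exists k, Q k.
  exists m; apply/asboolP; split; first exact: dimD_gt0.
  by exists pi%:A.
case: (ex_minnP exQ) => g /asboolP[g0 [y y0 wy]] gmin.
have gmin' x : x != 0 -> 0 < w x -> w y <= w x.
  move=> x0 wx; have := gmin `|w x|%N; rewrite /Q wy => h.
  have : (g <= `|w x|)%N; last by lia.
  by apply: h; apply/asboolP; split; [lia|exists x => //; lia].
exists y; split=> //; first by rewrite wy; lia.
suff hdiv x : x != 0 -> exists t : int, w x = t * w y.
  have [t ht] := hdiv _ pi0; have := dimD_gt0 D; exists `|t|%N; move: ht; rewrite wpi wy; nia.
move=> x0.
have pw : forall t : nat, w (y ^+ t) = w y * t%:Z by move=> t; rewrite (dvalX hF divD) // -mulr_natr natz.
suff pos x1 : x1 != 0 -> 0 <= w x1 -> exists t : int, w x1 = t * w y.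
  have [/pos|] := leP 0 (w x); first exact.
  move=> wx; have [||t ht] := pos x^-1; rewrite ?invD_neq0 // ?(dvalV hF divD) //; first lia.
  by exists (- t); move: ht; rewrite (dvalV hF divD) // mulNr; lia.
move=> x10 wx1; exists (`|w x1|%N %/ g)%N%:Z.
pose t := (`|w x1|%N %/ g)%N; pose z := x1 * (y ^+ t)^-1.
have z0 : z != 0 by rewrite /z mulD_neq0 ?invD_neq0 ?expD_neq0.
have wz : w z = w x1 - w y * t%:Z.
  by rewrite /z (dvalM hF divD) ?invD_neq0 ?expD_neq0 // (dvalV hF divD) ?expD_neq0 // pw.
have E := divn_eq `|w x1|%N g; have lt := ltn_pmod `|w x1|%N g0.
have := gmin' z z0; rewrite wz wy -/t; move: E lt; rewrite -/t.
move: (t) (_ %% _)%N => T R; nia.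
Qed.

Variables (n : nat) (Trd : D -> F).
Hypotheses (n_gt0 : (0 < n)%N) (hm : m = (n ^ 2)%N) (hTrd : reduced_trace n Trd).

Section ResidueField.
Variables (K : finFieldType) (red : D -> K).
Hypothesis redD : forall x y, dideal 0 x -> dideal 0 y -> red (x + y) = red x + red y.
Hypothesis redM : forall x y, dideal 0 x -> dideal 0 y -> red (x * y) = red x * red y.
Hypothesis red1 : red 1 = 1.
Hypothesis red_eq0 : forall x, dideal 0 x -> (red x == 0) <-> dideal 1 x.
Hypothesis red_surj : forall c, exists2 x, dideal 0 x & red x = c.
Hypothesis frobD : forall x y : K, (x + y) ^+ q = x ^+ q + y ^+ q.
Hypothesis red_fix : forall c, P 0 c -> red c%:A ^+ q = red c%:A.
Hypothesis q_gt1 : (1 < q)%N.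

Lemma dideal_scalar c k : P k c -> dideal (k * m%:Z) (c%:A : D).
Proof. by move=> hc; rewrite -[X in dideal X]addr0; apply: (didealZ hF divD) => //; exact: (dideal1 hF). Qed.

Lemma scalar_dideal1 c : dideal 1 (c%:A : D) -> P 1 c.
Proof.
have [->|c0] := eqVneq c 0; first by left.
have c0' : c%:A != 0 :> D by rewrite scaler_eq0 oner_eq0 orbF.
by move/(dideal_ge c0'); rewrite dval_scalar // => h; right; have := dimD_gt0 D; nia.
Qed.

Lemma redX x k : dideal 0 x -> red (x ^+ k) = red x ^+ k.
Proof. by move=> hx; elim: k => [|k IH]; rewrite ?red1 // !exprS redM ?IH //; exact: (didealX hF divD). Qed.

Lemma dideal_comb k (c : 'I_k -> F) x : (forall i, P 0 (c i)) -> dideal 0 x ->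
  dideal 0 (\sum_i c i *: x ^+ i).
Proof.
by move=> hc hx; apply: (dideal_sum hF divD) => i _; apply: (didealZ0 hF divD) => //; exact: (didealX hF divD).
Qed.

Lemma red0 : red 0 = 0.
Proof. by apply/eqP/red_eq0; exact: dideal0. Qed.

Lemma red_comb k (c : 'I_k -> F) x : (forall i, P 0 (c i)) -> dideal 0 x ->
  red (\sum_i c i *: x ^+ i) = \sum_i red (c i)%:A * red x ^+ i.
Proof.
elim: k c => [|k IH] c hc hx; first by rewrite !big_ord0 red0.
rewrite !big_ord_recr /= redD; last first.
- by apply: (didealZ0 hF divD) => //; exact: (didealX hF divD).
- exact: dideal_comb.
rewrite IH //; congr (_ + _).
rewrite -[c ord_max *: _]mulr_algl redM ?redX //; last exact: (didealX hF divD).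
by have := dideal_scalar (hc ord_max); rewrite mul0r.
Qed.

(** Reduction of a relation between powers to the residue field; its
    coefficients are fixed by Frobenius since they come from [F]. *)
Lemma red_poly_root k (c : 'I_k -> F) x : (forall i, P 0 (c i)) -> dideal 0 x ->
  let g : {poly K} := \poly_(i < k) oapp (fun j => red (c j)%:A) 0 (insub i) in
  [/\ (forall j : 'I_k, g`_j = red (c j)%:A), (forall j, g`_j ^+ q = g`_j) &
      g.[red x] = red (\sum_i c i *: x ^+ i)].
Proof.
move=> hc hx g.
have gE (j : 'I_k) : g`_j = red (c j)%:A by rewrite coef_poly ltn_ord valK.
split=> // [j|].
  rewrite coef_poly; case: ltnP => jk; last by rewrite expr0n; case: (q) q_gt1.
  by rewrite insubT /= red_fix.
rewrite (horner_coef_wide _ (size_poly _ _)) red_comb //.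
by apply: eq_bigr => j _; rewrite gE.
Qed.

(** The reduced relation has degree less than the number of Frobenius
    conjugates of [red a]. *)
Lemma residually_indep (a : D) f (c : 'I_f -> F) : dideal 0 a ->
  (forall d, (0 < d < f)%N -> red a ^+ (q ^ d) != red a) ->
  (forall i, P 0 (c i)) -> dideal 1 (\sum_i c i *: a ^+ i) -> forall i, P 1 (c i).
Proof.
move=> ha hconj hc hs i.
have [gE gq gr] := red_poly_root hc ha.
have g0 := conj_poly0 frobD (ltnW q_gt1) hconj gq (size_poly _ _).
apply: scalar_dideal1; apply/red_eq0.
  by have := dideal_scalar (hc i); rewrite mul0r.
rewrite -gE g0 ?coef0 //; apply/rootP; rewrite gr; apply/eqP/red_eq0 => //.
exact: dideal_comb.
Qed.

(** Divide by the coefficient of least valuation. *)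
Lemma residually_indep_scaled (a : D) f (c : 'I_f -> F) k : dideal 0 a ->
  (forall d, (0 < d < f)%N -> red a ^+ (q ^ d) != red a) ->
  dideal (k * m%:Z) (\sum_i c i *: a ^+ i) -> forall i, P k (c i).
Proof.
move=> ha hconj hs i1; have [->|ci1] := eqVneq (c i1) 0; first by left.
have [i0 ci0 hmin] := @Order.TotalTheory.arg_minP _ _ _ i1 (fun i => c i != 0) (fun i => v (c i)) ci1.
have [kw|kw] := leP k (v (c i0)); first by right; apply: le_trans kw (hmin _ ci1).
pose t := v (c i0).
have hc' i : P 0 (pi ^ (- t) * c i).
  have [->|ci] := eqVneq (c i) 0; first by rewrite mulr0; left.
  by rewrite -(addNr t); apply/(frac_ideal_shift hF); right; exact: hmin.
have hs' : dideal 1 (\sum_i (pi ^ (- t) * c i) *: a ^+ i).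
  under eq_bigr do rewrite -scalerA; rewrite -scaler_sumr.
  apply: (dideal_le _ (didealZ hF divD (frac_ideal_unifz hF (- t)) hs)).
  by have := dimD_gt0 D; rewrite -mulrDl; nia.
have h : P (- t + (t + 1)) (pi ^ (- t) * c i0).
  by rewrite addKr; exact: residually_indep ha hconj hc' hs' i0.
by move/(frac_ideal_shift hF)/(frac_ideal_ge ci0): h; rewrite /t; lia.
Qed.

Lemma residually_indep_powers (a : D) f : dideal 0 a ->
  (forall d, (0 < d < f)%N -> red a ^+ (q ^ d) != red a) -> indep_powers a f.
Proof.
move=> ha hconj c hc i; apply: (frac_ideal_inter0 (v := v)) => k.
by apply: residually_indep_scaled hconj _ i => //; rewrite hc; left.
Qed.

Lemma eq_red x y : dideal 0 x -> dideal 0 y -> red x = red y <-> dideal 1 (x - y).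
Proof.
move=> hx hy; have hxy := didealB hF divD hx hy.
have E : red x = red (x - y) + red y by rewrite -redD // subrK.
rewrite -(red_eq0 hxy) E; split=> [h|/eqP ->]; last by rewrite add0r.
by apply/eqP/(addIr (red y)); rewrite h add0r.
Qed.

(** Let [f] be the number of Frobenius conjugates of a primitive element. All
    elements of [K] are roots of [X^(q^f) - X], which bounds [#|K|] from
    above; independence of the powers of a lift bounds it from below, so
    these powers also span. *)
Lemma residue_generator : exists (a : D) (f : nat), [/\ dideal 0 a, (0 < f)%N, #|K| = (q ^ f)%N,
  (forall d, (0 < d < f)%N -> red a ^+ (q ^ d) != red a) &
  forall x, dideal 0 x -> exists2 c : 'I_f -> F, (forall i, P 0 (c i)) &
    dideal 1 (x - \sum_i c i *: a ^+ i)].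
Proof.
have [g hg] := exists_primitive K; have [a ha ag] := red_surj g.
have exf : exists f, (0 < f)%N && (g ^+ (q ^ f) == g).
  pose h (i : 'I_#|K|.+1) := g ^+ (q ^ i).
  have /injectivePn[i [j ij hij]] : ~~ injectiveb h.
    by apply/injectiveP => /leq_card; rewrite card_ord ltnn.
  wlog lt : i j ij hij / (i < j)%N.
    move=> H; have [|] := ltnP i j; first exact: H.
    rewrite leq_eqVlt => /orP[/eqP/val_inj E|]; first by rewrite E eqxx in ij.
    by apply: H; rewrite // eq_sym.
  exists (j - i)%N; rewrite subn_gt0 lt /=; apply/eqP.
  apply: (@frobX_inj K q frobD i); rewrite /= -exprM -expnD subnK ?(ltnW lt) //.
case: (ex_minnP exf) => f /andP[f0 /eqP gf] fmin.
have hconj d : (0 < d < f)%N -> red a ^+ (q ^ d) != red a.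
  move=> /andP[d0 df]; rewrite ag; apply/negP => gd.
  by have := fmin d; rewrite d0 gd => /(_ isT); rewrite leqNgt df.
have cardK : (#|K| <= q ^ f)%N.
  have q1 : (1 < q ^ f)%N by rewrite -(expn0 q) ltn_exp2l.
  have sz : size ('X^(q ^ f) - 'X : {poly K}) = (q ^ f).+1.
    by rewrite size_polyDl size_polyXn // size_polyN size_polyX.
  rewrite -ltnS -sz cardT; apply: max_poly_roots (enum_uniq _).
    by rewrite -size_poly_gt0 sz.
  apply/allP => x _; apply/rootP; rewrite !hornerE /= -?hornerE.
  have [->|/hg[k ->]] := eqVneq x 0.
    by rewrite expr0n gtn_eqF ?subrr //; apply: ltnW.
  by rewrite -exprM mulnC exprM gf subrr.
have [r [r0 hr]] := residue_card hF.
pose h (c : {ffun 'I_f -> 'I_q}) := red (\sum_i r (c i) *: a ^+ i).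
have h0 (c : {ffun 'I_f -> 'I_q}) : dideal 0 (\sum_i r (c i) *: a ^+ i).
  exact: dideal_comb.
have hinj : injective h.
  move=> c c' E; apply/ffunP => i.
  have E0 : dideal 1 (\sum_i (r (c i) - r (c' i)) *: a ^+ i).
    under eq_bigr do rewrite scalerBl; rewrite sumrB.
    exact/eq_red.
  have := residually_indep ha hconj (fun i => frac_idealB hF (r0 (c i)) (r0 (c' i))) E0 i => h1.
  have [j [_ uj]] := hr (r (c i)) (r0 _).
  transitivity j; last exact: uj.
  by apply/esym/uj; rewrite subrr; exact: frac_ideal0.
have cK : #|K| = (q ^ f)%N.
  apply/eqP; rewrite eqn_leq cardK /=.
  by have := leq_card h hinj; rewrite card_ffun !card_ord.
exists a, f; split=> // x hx.
have [|h' hK h'K] := inj_card_bij hinj; first by rewrite cK card_ffun !card_ord.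
exists (fun i => r (h' (red x) i)) => //.
by apply/eq_red => //; rewrite -/(h _) h'K.
Qed.

(** The residue degree and the ramification index are degrees of elements of
    [D], hence at most [n]. Their product is at least [n^2] because the
    products of powers of a lift [a] of a generator of [K] and of a
    uniformizer [y] span [D]: every integral element is approximated by
    their combinations, and a subspace is closed. *)
Lemma residue_degree_ramification (y : D) (e : nat) :
  y != 0 -> 0 < w y -> (forall x, x != 0 -> 0 < w x -> w y <= w x) ->
  e%:Z * w y = m%:Z -> #|K| = (q ^ n)%N /\ w y = n%:Z.
Proof.
move=> y0 wy ymin ey.
have [a [f [ha f0 cK hconj hspan]]] := residue_generator.
have en : (e <= n)%N.
  apply: (indep_powers_degree hTrd n_gt0 (x := y)).
  exact: powers_indep y0 erefl wy ey.
have fn : (f <= n)%N.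
  by apply: (indep_powers_degree hTrd n_gt0 (x := a)); exact: residually_indep_powers.
pose S := <<[seq (a ^+ i * y ^+ j)%R | i <- iota 0 f, j <- iota 0 e]>>%VS.
have Smem i j : (i < f)%N -> (j < e)%N -> a ^+ i * y ^+ j \in S.
  by move=> hi hj; apply/memv_span/allpairsP; exists (i, j); rewrite !mem_iota !add0n.
(* Expansion in powers of [y] with coefficients in the span of powers of [a];
   [j = e] reaches the uniformizer of [F]. *)
have step1 j x : (j <= e)%N -> dideal 0 x ->
    exists2 s, s \in S & dideal (w y * j%:Z) (x - s).
  elim: j => [|j IH] je hx; first by exists 0; rewrite ?mem0v // mulr0 subr0.
  have [s sS hs] := IH (ltnW je) hx.
  have yj0 := expD_neq0 divD j y0.
  have wyj : w (y ^+ j) = w y * j%:Z by rewrite (dvalX hF divD) // -mulr_natr natz.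
  have hz : dideal 0 ((x - s) * (y ^+ j)^-1).
    rewrite -(subrr (w y * j%:Z)); apply: (didealM hF divD) => //.
    by right; rewrite (dvalV hF divD) // wyj.
  have [c hc hd] := hspan _ hz.
  exists (s + \sum_i c i *: (a ^+ i * y ^+ j)).
    by apply: memvD => //; apply: memv_suml => i _; apply: memvZ; apply: Smem.
  have -> : x - (s + \sum_i c i *: (a ^+ i * y ^+ j)) =
      ((x - s) * (y ^+ j)^-1 - \sum_i c i *: a ^+ i) * y ^+ j.
    rewrite mulrBl mulrVK ?divD // opprD addrA mulr_suml; congr (_ - _).
    by apply: eq_bigr => i _; rewrite -scalerAl.
  have hd' : dideal (w y) ((x - s) * (y ^+ j)^-1 - \sum_i c i *: a ^+ i).
    move: (_ - _) hd => z hd; have [->|z0] := eqVneq z 0; first by left.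
    by right; apply: ymin => //; have := dideal_ge z0 hd; lia.
  rewrite intS mulrDr mulr1; apply: (didealM hF divD) => //.
  by right; rewrite wyj.
have step2 (t : nat) x : dideal 0 x -> exists2 s, s \in S & dideal (t%:Z * m%:Z) (x - s).
  elim: t => [|t IH] hx; first by exists 0; rewrite ?mem0v // mul0r subr0.
  have [s sS hs] := IH hx.
  have hz : dideal 0 (pi ^ (- t%:Z) *: (x - s)).
    have := didealZ hF divD (frac_ideal_unifz hF (- t%:Z)) hs.
    by rewrite mulNr addNr.
  have [s' s'S] := step1 e _ (leqnn e) hz; rewrite mulrC ey => hs'.
  exists (s + pi ^ t%:Z *: s'); first by apply: memvD => //; apply: memvZ.
  have -> : x - (s + pi ^ t%:Z *: s') = pi ^ t%:Z *: (pi ^ (- t%:Z) *: (x - s) - s').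
    rewrite scalerBr scalerA -expfzDr ?(unif_neq0 hF) // subrr scale1r.
    by rewrite opprD addrA.
  have := didealZ hF divD (frac_ideal_unifz hF t%:Z) hs'.
  by rewrite intS mulrDl mul1r addrC.
(* [phi] is linear with kernel [S], hence continuous, and integral elements
   are limits of elements of [S]. *)
have SD : S = fullv.
  apply/eqP; rewrite eqEsubv subvf /=; apply/subvP => x _.
  pose phi (z : D) := z - projv S z.
  have phiS z : z \in S -> phi z = 0 by move=> zS; rewrite /phi projv_id ?subrr.
  have [M hM] := dideal_lattice hF divD.
  have [C hC] : exists C : nat, forall k z, L k z -> L (k - C%:Z) (phi z).
    have H (i : 'I_m) : exists c : nat, L (- c%:Z) (phi (vbasis {:D})`_i) by exact: lattice_exhaust.
    have [gc hgc] := choice H; exists (\sum_i gc i)%N => k z Lz.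
    have -> : phi z = \sum_i crd i z *: phi (vbasis {:D})`_i.
      rewrite {1}(crd_sum z) /phi linear_sum -sumrB; apply: eq_bigr => i _.
      by rewrite linearZ /= scalerBr.
    apply: (lattice_sum hF) => i _; apply: (latticeZ hF) => //.
    by apply: lattice_le (hgc i); rewrite (bigD1 i) //=; lia.
  suff main z : dideal 0 z -> phi z = 0.
    have [k Lk] := lattice_exhaust v x; have [M' hM'] := lattice_dideal hF divD.
    have hz : dideal 0 (pi ^ (k + M')%N%:Z *: x).
      have := hM' _ _ ((lattice_shift hF (k + M')%N%:Z _ _).2 Lk).
      by apply: dideal_le; have := dimD_gt0 D; nia.
    have := main _ hz; rewrite /phi linearZ /= -scalerBr => /eqP.
    rewrite scaler_eq0 (negPf (unifz_neq0 hF _)) /= subr_eq0 => /eqP ->.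
    exact: memv_proj.
  move=> hz; apply: crd_eq => j; rewrite [RHS]/crd linear0.
  apply: (frac_ideal_inter0 (v := v)) => k.
  have [s sS hs] := step2 (`|k| + M + C)%N z hz.
  have -> : phi z = phi (z - s) by rewrite /phi linearB /= (projv_id sS) opprB addrA subrK.
  have Lzs : L ((`|k| + C)%N%:Z) (z - s).
    set t := (`|k| + M + C)%N%:Z in hs.
    have := hM (pi ^ (- t) *: (z - s)) _.
    rewrite -(lattice_shiftE hF) => h; apply: lattice_le (h _); first by rewrite /t; lia.
    have := didealZ hF divD (frac_ideal_unifz hF (- t)) hs; by rewrite mulNr addNr.
  by apply: frac_ideal_le (hC _ _ Lzs j); lia.
have mef : (m <= e * f)%N.
  rewrite -SD; apply: (leq_trans (dim_span _)).
  by rewrite size_allpairs !size_iota mulnC.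
have [eE fE] : e = n /\ f = n.
  by move: mef; rewrite hm -mulnn; split; nia.
split; first by rewrite cK fE.
by move: ey; rewrite hm eE; nia.
Qed.

(** An element of least positive valuation satisfies a relation of degree [n]
    of Eisenstein type, and the maximal ideal is generated additively by
    such elements. *)
Lemma Trd_maximal_ideal (y : D) :
  y != 0 -> 0 < w y -> (forall x, x != 0 -> 0 < w x -> w y <= w x) -> w y = n%:Z ->
  forall x, dideal 1 x -> P 1 (Trd x).
Proof.
move=> y0 wy ymin wyn x hx.
have main z : z != 0 -> w z = n%:Z -> P 1 (Trd z).
  move=> z0 wz.
  have nn : n%:Z * n%:Z = m%:Z by rewrite hm -mulnn PoszM.
  have hi : indep_powers z n by apply: (powers_indep z0 wz) => //; lia.
  have [[c hc] hT] := degree_le_trace hTrd n_gt0 z.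
  have ni : (n.-1 < n)%N by rewrite prednK.
  rewrite (hT hi c hc (Ordinal ni) erefl).
  have [->|c0] := eqVneq (c (Ordinal ni)) 0; first by left.
  have := powers_distinct (k := m%:Z) z0 wz _ nn (c := c).
  rewrite -hc => /(_ _ _ _ c0) h; right.
  have : m%:Z <= v (c (Ordinal ni)) * m%:Z + n%:Z * (Ordinal ni : nat)%:Z.
    apply: h; first lia.
    by right; rewrite (dvalX hF divD) // wz -mulr_natr natz nn.
  rewrite -nn /=; nia.
have [hlin _] := Trd_spec hTrd.
have TB a b : Trd (a - b) = Trd a - Trd b.
  by have := hlin (-1) b a; rewrite scaleN1r mulN1r addrC [RHS]addrC.
have [->|x0] := eqVneq x 0.
  by rewrite -(subrr 0) TB subrr; left.
have wx : w y <= w x by apply: ymin => //; have := dideal_ge x0 hx; lia.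
have [E|ne] := eqVneq (w x) (w y); first by apply: main => //; rewrite E.
have hx1 : dideal (w y + 1) x by right; lia.
(* Here [x] has larger valuation than [y], so [x + y] has the valuation of [y],
   and [x] is the difference of [x + y] and [y]. *)
have ny1 z : dideal (w y + 1) z -> z - x = y -> False.
  move=> hz E; have : dideal (w y + 1) y by rewrite -{2}E; exact: (didealB hF divD).
  by move/(dideal_ge y0); lia.
have xy0 : x + y != 0.
  by apply/eqP => E; apply: (ny1 0); [left|rewrite -E addrAC subrr add0r].
have wxy : w (x + y) = n%:Z.
  apply/eqP; rewrite eq_le -wyn; apply/andP; split; last exact: (dval_add hF divD).
  rewrite leNgt; apply/negP => lt; apply: (ny1 (x + y)); last by rewrite addrAC subrr add0r.
  by right; lia.
have -> : Trd x = Trd (x + y) - Trd y by rewrite -TB addrK.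
by apply: (frac_idealB hF); exact: main.
Qed.

(** The reduced characteristic polynomial of a lift of a generator of the
    residue field reduces to the minimal polynomial of the generator, so
    the reduced trace lifts the trace of the residue field. *)
Lemma Trd_integral_unit : #|K| = (q ^ n)%N ->
  exists b, [/\ dideal 0 b, P 0 (Trd b) & ~ P 1 (Trd b)].
Proof.
move=> cK; have [beta [hconj htr]] := exists_generator_trace_neq0 q_gt1 n_gt0 cK.
have [b hb bE] := red_surj beta; rewrite -bE in hconj htr.
have [[c hc] hT] := degree_le_trace hTrd n_gt0 b.
have hi : indep_powers b n by exact: residually_indep_powers.
have ni : (n.-1 < n)%N by rewrite prednK.
have {hT} hT := hT hi c hc (Ordinal ni) erefl.
have c0 i : P 0 (c i).
  apply: (residually_indep_scaled hb hconj (k := 0)); rewrite mul0r -hc.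
  exact: (didealX hF divD).
exists b; rewrite hT; split=> // h1.
have [gE gq gr] := red_poly_root c0 hb.
set g : {poly K} := \poly_(i < n) _ in gE gq gr.
pose G := 'X^n - g.
have sg : (size g < n.+1)%N by rewrite ltnS size_poly.
have sG : size G = n.+1 by rewrite /G size_polyDl ?size_polyXn // size_polyN.
have GM : G \is monic by rewrite monicE lead_coefE sG coefB coefXn eqxx nth_default ?subr0.
have Gq j : G`_j ^+ q = G`_j.
  rewrite coefB coefXn (frobB frobD) gq; congr (_ - _).
  by case: eqP => _; rewrite ?expr1n // expr0n; case: (q) q_gt1.
have Gr : root G (red b).
  by apply/rootP; rewrite hornerD hornerN hornerXn gr -hc redX // subrr.
have := conj_poly_trace frobD (ltnW q_gt1) hconj Gq n_gt0 sG GM Gr.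
rewrite coefB coefXn => E; have gEn : g`_n.-1 = red (c (Ordinal ni))%:A := gE (Ordinal ni).
have r0 : red (c (Ordinal ni))%:A = 0.
  apply/eqP/red_eq0; first by have := dideal_scalar (c0 (Ordinal ni)); rewrite mul0r.
  by apply: dideal_le (dideal_scalar h1); have := dimD_gt0 D; lia.
move: E; rewrite gEn r0 eqn_leq [(n <= _)%N]leqNgt ni andbF subr0 => /esym/eqP.
by rewrite oppr_eq0 (negPf htr).
Qed.

End ResidueField.

Lemma field_residue_data : exists d : residue_data F,
  [/\ rd_ring d = P 0, rd_ideal d = P 1 & rd_card d = q].
Proof.
have [r [r0 hr]] := residue_card hF.
unshelve eexists (@ResidueData F (P 0) (P 1) q r _ _ _ _ _ _ _ _ _ r0 hr).
- exact: (frac_ideal1 hF).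
- exact: (frac_idealB hF).
- exact: (frac_ideal_mull hF).
- exact: (frac_idealB hF).
- exact: (frac_ideal_mull hF).
- exact: (frac_ideal_mulr hF).
- by move=> x; exact: frac_ideal_le ler01.
- by move/(frac_ideal_ge (oner_neq0 _)); rewrite (valuation1 hF).
- move=> x hx hx1; have x0 : x != 0 by apply/eqP => E; apply: hx1; left.
  have vx : v x = 0.
    have := frac_ideal_ge x0 hx; rewrite le_eqVlt => /orP[/eqP //|lt].
    by case: hx1; right; lia.
  exists x^-1; first by right; rewrite (valuationV hF) // vx.
  by rewrite mulVf // mulfV // subrr; split; left.
- by [].
Qed.

Lemma division_residue_data : exists d : residue_data D,
  rd_ring d = dideal 0 /\ rd_ideal d = dideal 1.
Proof.
have [M hM] := dideal_lattice hF divD; have [M' hM'] := lattice_dideal hF divD.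
have [s hs] := lattice_transversal hF D (- M%:Z) (M' + 1)%N%:Z.
have sub x : dideal 1 x -> dideal 0 x by exact: dideal_le ler01.
have [||||N [r [r0 hr]]] := @exists_transversal D (dideal 0) (dideal 1) s sub.
- by left.
- exact: (didealB hF divD).
- exact: (didealB hF divD).
- move=> x hx; have [r rs hr] := hs x (hM x hx); exists r => //.
  by have := hM' _ _ hr; apply: dideal_le; have := dimD_gt0 D; nia.
unshelve eexists (@ResidueData D (dideal 0) (dideal 1) N r _ _ _ _ _ _ _ _ _ r0 hr).
- exact: (dideal1 hF).
- exact: (didealB hF divD).
- by move=> x y hx hy; rewrite -[0]addr0; exact: (didealM hF divD).
- exact: (didealB hF divD).
- by move=> x y hx hy; rewrite -[1]add0r; exact: (didealM hF divD).
- by move=> x y hx hy; rewrite -[1]addr0; exact: (didealM hF divD).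
- exact: sub.
- by move/(dideal_ge (oner_neq0 _)); rewrite (dval1 hF).
- move=> x hx hx1; have x0 : x != 0 by apply/eqP => E; apply: hx1; left.
  have wx : w x = 0.
    have := dideal_ge x0 hx; rewrite le_eqVlt => /orP[/eqP //|lt].
    by case: hx1; right; lia.
  exists x^-1; first by right; rewrite (dvalV hF) // wx.
  by rewrite mulVr ?mulrV ?divD // subrr; split; left.
- by [].
Qed.

(** This makes the character [psi] trivial on the maximal ideal and non-
    trivial on the maximal order. Frobenius is additive on the residue
    field of [D] because [q] is a power of the residue characteristic. *)
Lemma Trd_residue :
  (forall x, dideal 1 x -> P 1 (Trd x)) /\
  exists b, [/\ dideal 0 b, P 0 (Trd b) & ~ P 1 (Trd b)].
Proof.
have [dF [rF iF cF]] := field_residue_data.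
have [kF [redF [ckF [redFD redFM] redF1 redF0 redFs]]] := residue_fieldP dF.
rewrite rF iF cF in ckF redFD redFM redF0 redFs.
have [dD [rD iD]] := division_residue_data.
have [K [red [_ [redD redM] red1 red_eq0 red_surj]]] := residue_fieldP dD.
rewrite rD iD in redD redM red_eq0 red_surj.
have q1 : (1 < q)%N by rewrite -ckF; exact: finRing_gt1.
have [p p_pr pchF] := finPcharP kF.
have qE : q = (p ^ logn p q)%N by rewrite -ckF; exact: card_pprimeChar.
have nat0 k : P 0 (k%:R : F) by exact: (frac_ideal_nat hF).
have scal c : P 0 c -> dideal 0 (c%:A : D).
  by move=> /dideal_scalar; rewrite mul0r.
have redF_nat k : redF k%:R = k%:R.
  elim: k => [|k IH]; first by apply/eqP/redF0; [exact: nat0|left].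
  by rewrite -natr1 redFD ?IH ?redF1 ?natr1 //; exact: (frac_ideal1 hF).
have red_nat k : red (k%:R%:A) = k%:R.
  elim: k => [|k IH].
    by rewrite scale0r; apply/eqP/red_eq0; left.
  rewrite -natr1 scalerDl redD ?IH ?scale1r ?red1 ?natr1 //; first exact: scal.
  exact: (dideal1 hF).
have red_P1 c : P 1 c -> red c%:A = 0.
  move=> hc; apply/eqP/red_eq0; first by apply: scal; exact: frac_ideal_le ler01 hc.
  by apply: dideal_le (dideal_scalar hc); have := dimD_gt0 D; lia.
have pchK : p \in [pchar K].
  rewrite inE p_pr -red_nat; apply/eqP/red_P1/redF0; first exact: nat0.
  by rewrite redF_nat (pcharf0 pchF).
have frobD (x y : K) : (x + y) ^+ q = x ^+ q + y ^+ q.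
  apply: exprDn_pchar; rewrite qE pnatX; apply/orP; left.
  by rewrite (eq_pnat _ (pcharf_eq pchK)) pnat_id.
have powF (c : F) k : P 0 c -> P 0 (c ^+ k) /\ redF (c ^+ k) = redF c ^+ k.
  move=> hc; elim: k => [|k [IH1 IH2]]; first by rewrite !expr0; split; [exact: (frac_ideal1 hF)|].
  by rewrite !exprS redFM // IH2; split=> //; exact: (frac_ideal_mull hF).
have powD (c : F) k : P 0 c -> red (c ^+ k)%:A = red c%:A ^+ k.
  move=> hc; elim: k => [|k IH]; first by rewrite !expr0 scale1r.
  rewrite !exprS -IH -redM; [|exact: scal|by apply: scal; case: (powF c k hc)].
  by rewrite mulr_algl scalerA.
have red_fix (c : F) : P 0 c -> red c%:A ^+ q = red c%:A.
  move=> hc; rewrite -powD //; apply/eqP; rewrite -subr_eq0; apply/eqP.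
  have [hcq cq] := powF c q hc.
  have hd : P 1 (c ^+ q - c).
    apply/redF0; first exact: (frac_idealB hF).
    have : redF (c ^+ q - c + c) = redF (c ^+ q - c) + redF c.
      by apply: redFD => //; exact: (frac_idealB hF).
    rewrite subrK cq -[X in _ ^+ X]ckF expf_card => /eqP.
    by rewrite -{1}[redF c]add0r (inj_eq (addIr _)) eq_sym.
  have : red (c ^+ q - c)%:A + red c%:A = red (c ^+ q)%:A.
    rewrite -redD; [by rewrite -scalerDl subrK| |exact: scal].
    by apply: scal; exact: (frac_idealB hF).
  by rewrite (red_P1 _ hd) add0r => ->; rewrite subrr.
have [y [y0 wy ymin [e ey _]]] := exists_uniformizer.
have [cK wyn] := residue_degree_ramification redD redM red1 red_eq0 red_surj frobD red_fix q1 y0 wy ymin ey.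
split; first exact: Trd_maximal_ideal y0 wy ymin wyn.
exact: (Trd_integral_unit redD redM red1 red_eq0 red_surj frobD red_fix q1).
Qed.


End Structure.

(** * The inducing representation *)

Section TensorMaps.
Variable K : fieldType.

Lemma free_mod_ind (V W : lmodType K) (Q : free_mod V W -> Prop) :
  Q 0 -> (forall a x y z, Q z -> Q (a *: gen x y + z)) -> forall z, Q z.
Proof.
move=> Q0 QD z.
have U k (p : V * W) : (<< k *g p >> : free_mod V W) = k *: gen p.1 p.2.
  by apply/eqP/freeg_eqP => p'; rewrite coeffZ !coeffU mul1r -surjective_pairing.
rewrite -[z]freeg_sumE; elim: (dom z) => [|p s IH]; first by rewrite big_nil.
by rewrite big_cons U; exact: QD.
Qed.

Lemma tensor_map_comp (V W V' W' V'' W'' : lmodType K)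
    (f : V -> V') (g : W -> W') (f' : V' -> V'') (g' : W' -> W'') :
  linear f -> linear g -> linear f' -> linear g' ->
  forall z, tensor_map (f' \o f) (g' \o g) z = tensor_map f' g' (tensor_map f g z).
Proof.
move=> lf lg lf' lg' z; have [x <-] := qproj_surj z.
have lff : linear (f' \o f) by move=> a u u'; rewrite /= lf lf'.
have lgg : linear (g' \o g) by move=> a u u'; rewrite /= lg lg'.
rewrite !tensor_map_qproj //; congr (qproj _ _); elim/free_mod_ind: x => [|a x y x' IH].
  by rewrite !free_map0.
by rewrite !(free_mapD, free_mapZ) IH !free_map_gen.
Qed.

Lemma tensor_map_id (V W : lmodType K) (z : tensor V W) : tensor_map id id z = z.
Proof.
have [x <-] := qproj_surj z; rewrite tensor_map_qproj //; congr (qproj _ _).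
elim/free_mod_ind: x => [|a x y x' IH]; first by rewrite free_map0.
by rewrite !(free_mapD, free_mapZ) IH !free_map_gen.
Qed.

End TensorMaps.

Section UnitGroupD.
Variables (F : fieldType) (D : falgType F).
Hypothesis divD : forall x : D, x != 0 -> x \is a GRing.unit.
Local Notation Dx := (unit_group D).

Lemma unit_neq0 (d : Dx) : val d != 0.
Proof.
have [h _] := uinv_valP d; apply/eqP => E; move: h; rewrite E mulr0.
by move/esym/eqP; rewrite oner_eq0.
Qed.

Lemma unit_valV (d : Dx) : val (d^-1)%g = (val d)^-1.
Proof.
have [h _] := uinv_valP d; apply: (mulIr (divD (unit_neq0 d))).
by rewrite mulVr ?divD ?unit_neq0.
Qed.

Fact is_unitD (x : D) : x != 0 -> is_unit x.
Proof. by move=> x0; apply/asboolP; exists x^-1; rewrite mulVr ?mulrV ?divD. Qed.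

Definition dunit (x : D) : Dx := insubd (1%g : Dx) x.

Lemma dunitK (x : D) : x != 0 -> val (dunit x) = x.
Proof. by move=> x0; rewrite /dunit insubdK //; exact: is_unitD. Qed.

Lemma dunitE (d : Dx) : dunit (val d) = d.
Proof. by apply: val_inj; rewrite dunitK // unit_neq0. Qed.

Lemma dunitM (x y : D) : x != 0 -> y != 0 -> dunit (x * y) = (dunit x * dunit y)%g.
Proof. by move=> x0 y0; apply: val_inj; rewrite /= !dunitK // mulD_neq0. Qed.

End UnitGroupD.

Section InducingRepresentation.
Variables (R : realType) (F : fieldType) (v : F -> int) (q : nat) (hF : local_field v q).
Variables (D : falgType F).
Hypothesis divD : forall x : D, x != 0 -> x \is a GRing.unit.
Local Notation C := R[i].
Local Notation Dx := (unit_group D).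
Local Notation w := (@dval F v D).
Local Notation dideal := (@dideal F v D).

Lemma residue_card_gt0 : (0 < q)%N.
Proof. by have [r [_ h]] := residue_card hF; have [i _] := h 1 (frac_ideal1 hF); exact: leq_ltn_trans (ltn_ord i). Qed.

Lemma modulusE (a d : Dx) :
  modulus R v q a d = q%:R ^ (- (w (val a) + drval v (val d)^-1)).
Proof.
have d0 := invD_neq0 (unit_neq0 d).
rewrite /modulus -/(dmat _) dmat_comp det_mulmx (Defs.valM hF) ?(unit_valV divD); last first.
- exact: (ldet_neq0 divD (unit_neq0 a)).
- exact: (rdet_neq0 divD d0).
by rewrite addrC.
Qed.

Lemma sqrt_modulusM (a b c d : Dx) :
  sqrt_modulus R v q (a * b)%g (c * d)%g = sqrt_modulus R v q a c * sqrt_modulus R v q b d.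
Proof.
rewrite /sqrt_modulus -rmorphM /= -sqrtrM; last by rewrite modulusE exprz_ge0.
congr (Num.sqrt _)%:C%C; rewrite !modulusE -expfzDr ?pnatr_eq0 -?lt0n ?residue_card_gt0 //.
congr (_ ^ _); rewrite -[val (a * b)%g]/(val a * val b) -[val (c * d)%g]/(val c * val d).
rewrite (dvalM hF divD) ?unit_neq0 //.
have -> : (val c * val d)^-1 = (val d)^-1 * (val c)^-1.
  by rewrite invrM ?divD ?unit_neq0.
rewrite /drval rdetM (Defs.valM hF) ?(rdet_neq0 divD) ?invD_neq0 ?unit_neq0 //.
lia.
Qed.

(** A unit of the valuation ring and its inverse are both power-bounded. *)
Lemma drval_unit x : x != 0 -> w x = 0 -> drval v x = 0.
Proof.
move=> x0 wx; have [M hM] := dideal_lattice hF divD.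
have ge0 y : y != 0 -> w y = 0 -> 0 <= drval v y.
  move=> y0 wy; apply: (drval_powers_ge0 hF divD y0 (C := - M%:Z)) => k.
  by apply/hM/(didealX hF divD); right; rewrite wy.
have h1 := ge0 x x0 wx.
have := ge0 x^-1 (invD_neq0 x0); rewrite (dvalV hF) // wx (drvalV hF) // => /(_ erefl).
lia.
Qed.

Lemma dideal1_unit x : dideal 1 (x - 1) -> x != 0 /\ w x = 0.
Proof.
move=> h; have x0 : x != 0.
  apply/eqP => E; move: h; rewrite E sub0r.
  move/(didealN hF divD); rewrite opprK => /(dideal_ge (oner_neq0 _)).
  by rewrite (dval1 hF).
split=> //; apply/eqP; rewrite eq_le; apply/andP; split; last first.
  apply: (dideal_ge x0); rewrite -(subrK 1 x); apply: (didealD hF divD); last exact: (dideal1 hF).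
  exact: dideal_le ler01 h.
rewrite leNgt; apply/negP => lt.
have hx : dideal 1 x by right; lia.
have := didealB hF divD hx h; rewrite opprB addrCA subrr addr0.
by move/(dideal_ge (oner_neq0 _)); rewrite (dval1 hF).
Qed.

Lemma sqrt_modulus_pro (a d : Dx) : dideal 1 (val a - 1) -> dideal 1 (val d - 1) ->
  sqrt_modulus R v q a d = 1.
Proof.
move=> /dideal1_unit[a0 wa] /dideal1_unit[d0 wd].
rewrite /sqrt_modulus modulusE wa (drvalV hF) // (drval_unit d0 wd) -[- _]/(0 : int).
by rewrite expr0z sqrtr1.
Qed.

Variables (V1 V2 : lmodType C) (tau1 : rep Dx V1) (tau2 : rep Dx V2).
Local Notation W := (tensor V1 V2).

(** The representation of the diagonal torus from which the space is induced,
    twisted by the modulus character. *)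
Definition sigma (a d : Dx) (u : W) : W :=
  sqrt_modulus R v q a d *: tensor_map (tau1 a) (tau2 d) u.

Lemma sigma_linear a d : linear (sigma a d).
Proof.
move=> c x y; rewrite /sigma (tensor_map_linear (rep_linear tau1 a) (rep_linear tau2 d)).
by rewrite scalerDr !scalerA mulrC.
Qed.

Lemma sigma0 a d : sigma a d 0 = 0.
Proof.
have := sigma_linear a d 1 0 0; rewrite !scale1r addr0.
by rewrite -[X in X = _]addr0 => /addrI <-.
Qed.

Lemma sigmaZ a d c x : sigma a d (c *: x) = c *: sigma a d x.
Proof. by rewrite -[c *: x]addr0 sigma_linear sigma0 addr0. Qed.

Lemma sigmaM a b c d u : sigma (a * b)%g (c * d)%g u = sigma a c (sigma b d u).
Proof.
rewrite sigmaZ /sigma scalerA mulrC sqrt_modulusM; congr (_ *: _).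
rewrite -tensor_map_comp; try exact: rep_linear.
by congr tensor_map; apply/funext => x /=; exact: repM.
Qed.

Hypotheses (dz1 : depth_zero tau1 (dideal 1)) (dz2 : depth_zero tau2 (dideal 1)).

Lemma sigma_pro a d u : dideal 1 (val a - 1) -> dideal 1 (val d - 1) -> sigma a d u = u.
Proof.
move=> ha hd; rewrite /sigma sqrt_modulus_pro // scale1r -[RHS]tensor_map_id.
by congr tensor_map; apply/funext => x /=; [exact: dz1|exact: dz2].
Qed.

Lemma sigma1 u : sigma 1%g 1%g u = u.
Proof. by apply: sigma_pro; rewrite subrr; left. Qed.

End InducingRepresentation.

(** * The Bruhat decomposition *)

Section GL2D.
Variables (F : fieldType) (D : falgType F).
Hypothesis divD : forall x : D, x != 0 -> x \is a GRing.unit.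
Local Notation Dx := (unit_group D).
Local Notation G := (unit_group 'M[D]_2).

Lemma ord2P (i : 'I_2) : i = 0 \/ i = 1.
Proof. by case: i => [[|[|k]]] hi //; [left|right]; exact: val_inj. Qed.

Lemma mx22_eq (A B : 'M[D]_2) : A 0 0 = B 0 0 -> A 0 1 = B 0 1 -> A 1 0 = B 1 0 ->
  A 1 1 = B 1 1 -> A = B.
Proof.
move=> h1 h2 h3 h4; apply/matrixP => i j.
by case: (ord2P i) => ->; case: (ord2P j) => ->.
Qed.

Lemma mul22E (A B : 'M[D]_2) i j : (A *m B) i j = A i 0 * B 0 j + A i 1 * B 1 j.
Proof.
rewrite mxE big_ord_recl big_ord1; congr (_ + A i _ * B _ j); exact: val_inj.
Qed.

Lemma mulr22E (A B : 'M[D]_2) i j : (A * B) i j = A i 0 * B 0 j + A i 1 * B 1 j.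
Proof. exact: mul22E. Qed.

Lemma one22E : ((1 : 'M[D]_2) 0 0 = 1) * ((1 : 'M[D]_2) 0 1 = 0) *
  ((1 : 'M[D]_2) 1 0 = 0) * ((1 : 'M[D]_2) 1 1 = 1).
Proof. by rewrite !mxE. Qed.

Lemma mx22E (a b c d : D) : (mx22 a b c d 0 0 = a) * (mx22 a b c d 0 1 = b) *
  (mx22 a b c d 1 0 = c) * (mx22 a b c d 1 1 = d).
Proof. by rewrite !mxE. Qed.

Lemma val_mulG (g h : G) : val (g * h)%g = val g * val h. Proof. by []. Qed.

Lemma lower_unit (x : D) : is_unit (mx22 1 0 x 1).
Proof.
apply/asboolP; exists (mx22 1 0 (- x) 1).
by split; apply: mx22_eq; rewrite mulr22E !mx22E !one22E
  ?mul1r ?mulr1 ?mul0r ?mulr0 ?addr0 ?add0r ?addrN ?addNr.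
Qed.

Lemma weyl_unit : is_unit (mx22 0 1 1 0 : 'M[D]_2).
Proof.
apply/asboolP; exists (mx22 0 1 1 0).
by split; apply: mx22_eq; rewrite mulr22E !mx22E !one22E
  ?mul1r ?mulr1 ?mul0r ?mulr0 ?addr0 ?add0r.
Qed.

Lemma upper_unit (a d : Dx) (x : D) : is_unit (mx22 (val a) x 0 (val d)).
Proof.
have a0 := divD (unit_neq0 a); have d0 := divD (unit_neq0 d).
apply/asboolP; exists (mx22 (val a)^-1 (- ((val a)^-1 * x * (val d)^-1)) 0 (val d)^-1).
split; apply: mx22_eq; rewrite mulr22E !mx22E !one22E ?mul0r ?mulr0 ?addr0 ?add0r ?mulVr ?mulrV //.
  by rewrite mulNr mulrVK // addrN.
by rewrite mulrN mulrA mulrA mulrV // mul1r addNr.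
Qed.

Definition upper (a d : Dx) (x : D) : G := UnitGroup (upper_unit a d x).
Definition upper_unip (x : D) : G := upper 1%g 1%g x.
Definition lower_unip (x : D) : G := UnitGroup (lower_unit x).
Definition weyl : G := UnitGroup weyl_unit.

Lemma upper_unipE x : val (upper_unip x) = mx22 1 x 0 1. Proof. by []. Qed.

Lemma upper_unipD x y : upper_unip (x + y) = (upper_unip x * upper_unip y)%g.
Proof.
by apply: val_inj; apply: mx22_eq; rewrite val_mulG mulr22E !upper_unipE !mx22E
  ?mul1r ?mulr1 ?mul0r ?mulr0 ?addr0 ?add0r // addrC.
Qed.

Lemma upper_unip0 : upper_unip 0 = 1%g.
Proof. by apply: val_inj; apply: mx22_eq; rewrite upper_unipE !mx22E !one22E. Qed.

Lemma mx_unit_row (g : G) : ~ (val g 1 0 = 0 /\ val g 1 1 = 0).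
Proof.
have [_ h] := uinv_valP g; case=> h0 h1.
have := congr1 (fun M : 'M[D]_2 => M 1 1) h.
by rewrite mulr22E h0 h1 !mul0r addr0 one22E => /esym/eqP; rewrite oner_eq0.
Qed.

Lemma mx_unit_col (g : G) : ~ (val g 0 0 = 0 /\ val g 1 0 = 0).
Proof.
have [h _] := uinv_valP g; case=> h0 h1.
have := congr1 (fun M : 'M[D]_2 => M 0 0) h.
by rewrite mulr22E h0 h1 !mulr0 addr0 one22E => /esym/eqP; rewrite oner_eq0.
Qed.

Lemma upperP (g : G) : val g 1 0 = 0 ->
  [/\ val g 0 0 != 0, val g 1 1 != 0 &
    g = upper (dunit (val g 0 0)) (dunit (val g 1 1)) (val g 0 1)].
Proof.
move=> h; have a0 : val g 0 0 != 0 by apply/eqP => E; apply: (@mx_unit_col g).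
have d0 : val g 1 1 != 0 by apply/eqP => E; apply: (@mx_unit_row g).
by split=> //; apply: val_inj; apply: mx22_eq; rewrite /= !mx22E ?dunitK.
Qed.

(** Coordinates on the big cell: [cell_z g] is the point of [N]; [cell_a g]
    and the lower left entry of [g] are the diagonal of the Borel factor. *)
Definition cell_z (g : G) : D := (val g 1 0)^-1 * val g 1 1.
Definition cell_a (g : G) : D := val g 0 1 - val g 0 0 * cell_z g.

Lemma big_cellP (g : G) : val g 1 0 != 0 ->
  cell_a g != 0 /\
  g = (upper (dunit (cell_a g)) (dunit (val g 1 0)%R) (val g 0 0)%R * (weyl * upper_unip (cell_z g)))%g.
Proof.
move=> c0; pose h := (g * upper_unip (- cell_z g) * weyl)%g.
have hE : [/\ val h 0 0 = cell_a g, val h 1 0 = 0 & val h 1 1 = val g 1 0].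
  rewrite /h !val_mulG !mulr22E !upper_unipE /= !mx22E !(mulr0, mulr1, addr0, add0r).
  split=> //; first by rewrite mulrN addrC.
  by rewrite mulrN /cell_z mulVKr ?divD // addNr.
case: hE => h00 h10 h11; have [a0 _ _] := upperP h10; rewrite h00 in a0; split=> //.
have Ez : val g 1 0 * cell_z g = val g 1 1 by rewrite /cell_z mulVKr ?divD.
apply: val_inj; apply: mx22_eq; rewrite !val_mulG !mulr22E !upper_unipE /= !mx22E;
  rewrite !(mulr0, mulr1, mul0r, mul1r, addr0, add0r) ?dunitK //.
  by rewrite /cell_a subrK.
Qed.

End GL2D.

(** * The Iwahori subgroup *)

Section IwahoriSubgroups.
Variables (F : fieldType) (v : F -> int) (q : nat) (hF : local_field v q).
Variables (D : falgType F).
Hypothesis divD : forall x : D, x != 0 -> x \is a GRing.unit.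
Local Notation Dx := (unit_group D).
Local Notation G := (unit_group 'M[D]_2).
Local Notation m := (\dim {:D}).
Local Notation w := (@dval F v D).
Local Notation dideal := (@dideal F v D).
Local Notation Iw1 := (@Iwahori1 F D (dideal 0) (dideal 1)).
Local Notation upper_unip := (upper_unip divD).

Lemma dideal0M x y : dideal 0 x -> dideal 0 y -> dideal 0 (x * y).
Proof. by move=> hx hy; rewrite -[0]addr0; exact: (didealM hF divD). Qed.
Lemma dideal1_mull x y : dideal 0 x -> dideal 1 y -> dideal 1 (x * y).
Proof. by move=> hx hy; rewrite -[1]add0r; exact: (didealM hF divD). Qed.
Lemma dideal1_mulr x y : dideal 1 x -> dideal 0 y -> dideal 1 (x * y).
Proof. by move=> hx hy; rewrite -[1]addr0; exact: (didealM hF divD). Qed.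
Lemma dideal1_sub x : dideal 1 x -> dideal 0 x.
Proof. exact: dideal_le ler01. Qed.
Lemma principal_unit x : dideal 1 (x - 1) -> [/\ x != 0, dideal 0 x, dideal 0 x^-1 & dideal 1 (x^-1 - 1)].
Proof.
move=> h; have [x0 wx] := dideal1_unit hF divD h.
have xV : dideal 0 x^-1 by right; rewrite (dvalV hF) // wx.
split=> //; first by right; rewrite wx.
have -> : x^-1 - 1 = - (x^-1 * (x - 1)) by rewrite mulrBr mulr1 mulVr ?divD // opprB.
exact/(didealN hF divD)/dideal1_mull.
Qed.

Lemma notin_dideal0_inv x : ~ dideal 0 x -> x != 0 /\ dideal 1 x^-1.
Proof.
move=> h; have x0 : x != 0 by apply/eqP => E; apply: h; left.
split=> //; right; rewrite (dvalV hF) //.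
have : ~ 0 <= w x by move=> hx; apply: h; right.
by move/negP; rewrite -ltNge; lia.
Qed.

Lemma mulGV (g : G) : val g * val (g^-1)%g = 1. Proof. by have [] := uinv_valP g. Qed.

Lemma ord2_all (Q : 'I_2 -> 'I_2 -> Prop) : Q 0 0 -> Q 0 1 -> Q 1 0 -> Q 1 1 -> forall i j, Q i j.
Proof. by move=> ? ? ? ? i j; case: (ord2P i) => ->; case: (ord2P j) => ->. Qed.

Lemma Iwahori1V (g : G) : Iw1 g -> Iw1 (g^-1)%g.
Proof.
case=> -[hO h10] h00 h11.
have gO i j : dideal 0 (val g i j) by have [] := hO i j.
have hg i j : dideal 0 (val (g^-1)%g i j) by have [] := hO i j.
have := mulGV g; set k := val (g^-1)%g in hg *; set A := val g in gO h10 h00 h11 *.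
move=> E; have e i j := congr1 (fun M : 'M[D]_2 => M i j) E.
have [d0 _ dV _] := principal_unit h11.
have k10 : dideal 1 (k 1 0).
  have := e 1 0; rewrite mulr22E one22E => /eqP; rewrite addrC addr_eq0 => /eqP E1.
  have -> : k 1 0 = (A 1 1)^-1 * - (A 1 0 * k 0 0) by rewrite -E1 mulKr ?divD.
  by apply: dideal1_mull => //; apply/(didealN hF divD)/dideal1_mulr.
split.
- split; last exact: k10.
  by move=> i j; split; [exact: hg|rewrite invgK; exact: gO].
- have := e 0 0; rewrite mulr22E one22E => E1.
  have -> : k 0 0 - 1 = - ((A 0 0 - 1) * k 0 0 + A 0 1 * k 1 0).
    by rewrite mulrBl mul1r addrAC E1 opprB.
  by apply/(didealN hF divD)/(didealD hF divD); [exact: dideal1_mulr|exact: dideal1_mull].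
- have := e 1 1; rewrite mulr22E one22E => E1.
  have -> : k 1 1 - 1 = - (A 1 0 * k 0 1 + (A 1 1 - 1) * k 1 1).
    by rewrite mulrBl mul1r addrA E1 opprB.
  by apply/(didealN hF divD)/(didealD hF divD); apply: dideal1_mulr.
Qed.

Lemma invg_uniq (H : groupType) (x y : H) : (x * y)%g = 1%g -> (x^-1)%g = y.
Proof. by move=> h; rewrite -[RHS](mulKg x) h mulg1. Qed.

Lemma upper_unipV x : (upper_unip x)^-1%g = upper_unip (- x).
Proof. by apply: invg_uniq; rewrite -upper_unipD subrr upper_unip0. Qed.

Lemma lower_unipV x : ((lower_unip x)^-1%g : G) = lower_unip (- x).
Proof.
apply/invg_uniq/val_inj; apply: mx22_eq;
 by rewrite val_mulG mulr22E /= !mx22E !one22E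
  ?mul1r ?mulr1 ?mul0r ?mulr0 ?addr0 ?add0r ?addrN.
Qed.

Lemma dideal00 : dideal 0 0. Proof. exact: dideal0. Qed.
Lemma dideal01 : dideal 0 1. Proof. exact: (dideal1 hF). Qed.

Lemma upper_unip_Iwahori1 x : dideal 0 x -> Iw1 (upper_unip x).
Proof.
move=> hx; have hN := didealN hF divD hx.
split; last 2 first.
- by rewrite upper_unipE mx22E subrr; left.
- by rewrite upper_unipE mx22E subrr; left.
split; last by rewrite upper_unipE mx22E; left.
by move=> i j; rewrite upper_unipV !upper_unipE; move: i j; apply: ord2_all; rewrite !mx22E;
  split; rewrite ?mx22E; first [exact: dideal01|exact: dideal00|by []].
Qed.

Lemma lower_unip_Iwahori1 x : dideal 1 x -> Iw1 (lower_unip x).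
Proof.
move=> hx; have hN := didealN hF divD hx.
split; last 2 first.
- by rewrite /= mx22E subrr; left.
- by rewrite /= mx22E subrr; left.
split; last by rewrite /= mx22E.
move=> i j; rewrite lower_unipV /=; move: i j; apply: ord2_all; rewrite !mx22E;
  split; first [exact: dideal01|exact: dideal00|exact: dideal1_sub].
Qed.

(** The inverse [k] satisfies [k = 1 - (g - 1) * k], which improves any bound
    on the denominators of its entries until they are integral. *)
Lemma congruence_Iwahori1 (g : G) : (forall i j, dideal 1 ((val g - 1) i j)) -> Iw1 g.
Proof.
move=> hg; set k := val (g^-1)%g.
have gE i j : val g i j = (val g - 1) i j + (1 : 'M[D]_2) i j by rewrite !mxE subrK.
have one_O i j : dideal 0 ((1 : 'M[D]_2) i j).
  by move: i j; apply: ord2_all; rewrite one22E; first [exact: dideal01|exact: dideal00].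
have gO i j : dideal 0 (val g i j).
  by rewrite gE; apply: (didealD hF divD) => //; exact: dideal1_sub.
have kE : k = 1 - (val g - 1) * k by rewrite mulrBl mulGV mul1r opprB addrC subrK.
have kN (N : nat) : (forall i j, dideal (- N%:Z) (k i j)) -> forall i j, dideal 0 (k i j).
  elim: N => [|N IH]; first by rewrite oppr0.
  move=> hk; apply: IH => i j; rewrite kE mxE; apply: (didealD hF divD).
    by apply: dideal_le (one_O i j); lia.
  rewrite mxE; apply: (didealN hF divD); rewrite mulr22E.
  have -> : - N%:Z = 1 + - N.+1%:Z by lia.
  by apply: (didealD hF divD); apply: (didealM hF divD).
have kO : forall i j, dideal 0 (k i j).
  apply: (kN (\sum_(p : 'I_2 * 'I_2) `|w (k p.1 p.2)|)%N) => i j; right.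
  by rewrite (bigD1 (i, j)) //=; lia.
have h i : val g i i - 1 = (val g - 1) i i by rewrite !mxE eqxx.
split; [split|rewrite h; exact: hg|rewrite h; exact: hg].
  by move=> i j; split.
by rewrite gE one22E addr0.
Qed.

Lemma diag_conj_entry (d : Dx) (g : G) i j :
  val (diag d * g * (diag d)^-1)%g i j = val d * val g i j * (val d)^-1.
Proof.
have -> : (diag d)^-1%g = diag (d^-1)%g.
  by apply: invg_uniq; rewrite -diagM mulgV diag1.
have s (a : D) : ((a%:M : 'M[D]_2) 0 0 = a) * ((a%:M : 'M[D]_2) 0 1 = 0) *
  ((a%:M : 'M[D]_2) 1 0 = 0) * ((a%:M : 'M[D]_2) 1 1 = a) by rewrite !mxE.
rewrite !val_mulG /= -(unit_valV divD); move: i j; apply: ord2_all;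
by rewrite !mulr22E !s !mul0r ?mulr0 ?addr0 ?add0r.
Qed.

Lemma dideal_conj k x y : x != 0 -> dideal k y -> dideal k (x * y * x^-1).
Proof.
move=> x0; have [->|y0] := eqVneq y 0; first by rewrite mulr0 mul0r; left.
by move/(dideal_ge y0) => h; right; rewrite (dval_conj hF divD).
Qed.

Lemma Iwahori1_conj (d : Dx) (g : G) : Iw1 g -> Iw1 (diag d * g * (diag d)^-1)%g.
Proof.
case=> -[hO h10] h00 h11; have d0 := unit_neq0 d.
have c1 x : val d * x * (val d)^-1 - 1 = val d * (x - 1) * (val d)^-1.
  by rewrite mulrBr mulr1 mulrBl divrr ?divD.
split; [split|rewrite diag_conj_entry c1; exact: dideal_conj|rewrite diag_conj_entry c1; exact: dideal_conj].
  move=> i j; have [h1 h2] := hO i j.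
  have -> : ((diag d * g * (diag d)^-1)^-1)%g = (diag d * g^-1 * (diag d)^-1)%g.
    by rewrite !invgM invgK mulgA.
  by rewrite !diag_conj_entry; split; exact: dideal_conj.
by rewrite diag_conj_entry; exact: dideal_conj.
Qed.

End IwahoriSubgroups.

(** * Whittaker functionals on the induced representation *)

Definition rep_space (K : fieldType) (H : groupType) (V : lmodType K) (r : rep H V) :
  lmodType K := V.

Section Whittaker.
Variables (R : realType) (F : fieldType) (v : F -> int) (q : nat) (hF : local_field v q).
Variables (D : falgType F).
Hypothesis divD : forall x : D, x != 0 -> x \is a GRing.unit.
Local Notation C := R[i].
Local Notation Dx := (unit_group D).
Local Notation G := (unit_group 'M[D]_2).
Local Notation m := (\dim {:D}).
Local Notation w := (@dval F v D).
Local Notation L := (@lattice F v D).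
Local Notation dideal := (@dideal F v D).
Local Notation Iw1 := (@Iwahori1 F D (dideal 0) (dideal 1)).
Local Notation upper_unip := (upper_unip divD).
Local Notation weyl := (@weyl F D).
Local Notation upper := (upper divD).
Hypothesis hO : is_order v (dideal 0).
Variables (V1 V2 : lmodType C) (tau1 : rep Dx V1) (tau2 : rep Dx V2).
Hypotheses (dz1 : depth_zero tau1 (dideal 1)) (dz2 : depth_zero tau2 (dideal 1)).
Local Notation W := (tensor V1 V2).
Local Notation pi := (parabolic_induction hF hO tau1 tau2).
Local Notation IV := (rep_space pi).
Local Notation sigma := (sigma v q tau1 tau2).

Variable psi : D -> C.
Hypothesis psiD : forall x y, psi (x + y) = psi x * psi y.
Hypothesis psi_p : forall x, dideal 1 x -> psi x = 1.
Hypothesis psi_nt : exists2 x, dideal 0 x & psi x != 1.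
Hypothesis psi_conj : forall x y, x != 0 -> psi (x * y * x^-1) = psi y.

Lemma psi_0 : psi 0 = 1. Proof. by apply: psi_p; left. Qed.
Lemma psiNl x : psi (- x) * psi x = 1. Proof. by rewrite -psiD addNr psi_0. Qed.

Definition ev (f : IV) (g : G) : W := submod_val f g.

Lemma ev_add (f f' : IV) g : ev (f + f') g = ev f g + ev f' g. Proof. by []. Qed.
Lemma ev_scale c (f : IV) g : ev (c *: f) g = c *: ev f g. Proof. by []. Qed.
Lemma ev_opp (f : IV) g : ev (- f) g = - ev f g. Proof. by []. Qed.
Lemma ev0 g : ev 0 g = 0. Proof. by []. Qed.
Lemma ev_sum (I : Type) (r : seq I) (u : I -> IV) g :
  ev (\sum_(i <- r) u i) g = \sum_(i <- r) ev (u i) g.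
Proof.
by elim: r => [|a r IH]; [rewrite !big_nil|rewrite !big_cons ev_add IH].
Qed.
Lemma ev_pi h (f : IV) g : ev (pi h f) g = ev f (g * h)%g. Proof. by []. Qed.
Lemma ev_inj (f f' : IV) : (forall g, ev f g = ev f' g) -> f = f'.
Proof. by move=> h; apply: val_inj; apply/funext. Qed.

Lemma ev_upper (f : IV) a d x g : ev f (upper a d x * g)%g = sigma a d (ev f g).
Proof. by have /asboolP[h _] := submod_valP f; rewrite /ev (h _ _ a d x). Qed.

Lemma ev_smooth (f : IV) : exists2 y : F, y != 0 &
  forall k g, nbhsG (dideal 0) y k -> ev f (g * k)%g = ev f g.
Proof. by have /asboolP[_ h] := submod_valP f. Qed.

Lemma scale_lattice (y : F) : y != 0 -> exists l : nat, forall t, L l%:Z t ->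
  exists2 x, dideal 0 x & t = y *: x.
Proof.
move=> y0; have [M hM] := lattice_dideal hF divD; exists (`|v y| + M)%N => t Lt.
exists (y^-1 *: t); last by rewrite scalerA divff // scale1r.
have := didealZ hF divD (frac_idealV hF y0) (hM _ _ Lt).
by apply: dideal_le; have := dimD_gt0 D; nia.
Qed.

Lemma ev_upper_unip_smooth (f : IV) : exists l : nat, forall g t, L l%:Z t ->
  ev f (g * upper_unip t)%g = ev f g.
Proof.
have [y y0 hy] := ev_smooth f; have [l hl] := scale_lattice y0.
exists l => g t /hl[x hx tE]; apply: hy; apply: ord2_all;
  rewrite !mxE /= ?subrr ?subr0; try by exists 0; rewrite ?scaler0 //; left.
by exists x.
Qed.

(** By the Bruhat decomposition every element of the group is the product of
    an upper triangular matrix and either 1 or an element of [weyl * N]. *)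
Lemma ev_determined (f f' : IV) : ev f 1%g = ev f' 1%g ->
  (forall z, ev f (weyl * upper_unip z)%g = ev f' (weyl * upper_unip z)%g) -> f = f'.
Proof.
move=> h1 hw; apply: ev_inj => g.
have [c0|c0] := eqVneq (val g 1 0) 0.
  have [_ _ ->] := upperP divD c0.
  by rewrite -[upper _ _ _]mulg1 !ev_upper h1.
by have [_ ->] := big_cellP divD c0; rewrite !ev_upper hw.
Qed.

(** Far away in [N], the big cell is close to the Borel subgroup. *)
Lemma weyl_upper_lower x : x != 0 ->
  (weyl * upper_unip x)%g = (upper (dunit (- x^-1)%R) (dunit x) 1%R * lower_unip (x^-1)%R)%g.
Proof.
move=> x0; have xV0 : - x^-1 != 0 by rewrite oppr_eq0 invD_neq0.
apply: val_inj; apply: mx22_eq; rewrite !val_mulG !mulr22E upper_unipE /= !mx22E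
  !(mulr0, mulr1, mul0r, mul1r, addr0, add0r) ?dunitK //.
  by rewrite addNr.
by rewrite mulrV ?divD.
Qed.

Lemma ev_weyl_low (f : IV) x : x != 0 -> ev f (lower_unip x^-1) = 0 -> ev f (weyl * upper_unip x)%g = 0.
Proof. by move=> x0 h; rewrite weyl_upper_lower // ev_upper h sigma0. Qed.

(** Right multiplication by [k] translates the point of [N] by the upper right
    entry of [k] and changes the diagonal by units congruent to 1; this is
    why a function on the big cell that transforms by [psi] transforms
    under the whole group by the character of [k]. *)
Lemma weyl_cell (k : G) z : Iw1 k -> dideal 0 z ->
  let h := (weyl * upper_unip z * k)%g in
  [/\ val h 1 0 != 0, dideal 1 (val h 1 0 - 1), cell_a h != 0, dideal 1 (cell_a h - 1) &
      dideal 0 (cell_z h) /\ psi (cell_z h) = psi (val k 0 1) * psi z].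
Proof.
move=> [[kO k10] k00 k11] hz h.
have kE i j : dideal 0 (val k i j) by have [] := kO i j.
have h10 : val h 1 0 = val k 0 0 + z * val k 1 0.
  by rewrite /h !val_mulG !mulr22E upper_unipE /= !mx22E !(mulr0, mulr1, mul0r, mul1r, addr0, add0r).
have h11 : val h 1 1 = val k 0 1 + z * val k 1 1.
  by rewrite /h !val_mulG !mulr22E upper_unipE /= !mx22E !(mulr0, mulr1, mul0r, mul1r, addr0, add0r).
have h00 : val h 0 0 = val k 1 0.
  by rewrite /h !val_mulG !mulr22E upper_unipE /= !mx22E !(mulr0, mulr1, mul0r, mul1r, addr0, add0r).
have h01 : val h 0 1 = val k 1 1.
  by rewrite /h !val_mulG !mulr22E upper_unipE /= !mx22E !(mulr0, mulr1, mul0r, mul1r, addr0, add0r).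
have u1 : dideal 1 (val h 1 0 - 1).
  by rewrite h10 addrAC; apply: (didealD hF divD) => //; exact: (dideal1_mull hF divD).
have [u0 _ uV uV1] := principal_unit hF divD u1.
have z'O : dideal 0 (cell_z h).
  rewrite /cell_z h11; apply: (dideal0M hF divD) => //; apply: (didealD hF divD) => //.
  exact: (dideal0M hF divD).
have a1 : dideal 1 (cell_a h - 1).
  rewrite /cell_a h01 h00 addrAC; apply: (didealB hF divD) => //.
  exact: (dideal1_mulr hF divD).
have [a0 _ _ _] := principal_unit hF divD a1.
split=> //; split=> //.
have zid (a b c d : D) : a = b + (d + ((a - (b + c)) + (c - d))).
  by rewrite opprD (addrA a) (addrA _ c) subrK [d + _]addrC subrK [b + _]addrC subrK.
have -> : cell_z h = val k 0 1 + (z + (((val h 1 0)^-1 - 1) * val h 1 1 + z * (val k 1 1 - 1))).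
  rewrite mulrBl mulrBr mul1r mulr1 -/(cell_z h) h11.
  exact: zid.
rewrite psiD (psiD z) [X in _ * (_ * X)]psi_p ?mulr1 //.
apply: (didealD hF divD); last exact: (dideal1_mull hF divD).
apply: (dideal1_mulr hF divD) => //; rewrite h11; apply: (didealD hF divD) => //.
exact: (dideal0M hF divD).
Qed.

Lemma cell_z_upper a d x (g : G) : cell_z (upper a d x * g)%g = cell_z g.
Proof.
rewrite /cell_z val_mulG !mulr22E /= !mx22E !mul0r !add0r.
have d0 := unit_neq0 d.
have [->|c0] := eqVneq (val g 1 0) 0; first by rewrite mulr0 invr0 !mul0r.
by rewrite invrM ?divD // -mulrA mulKr ?divD.
Qed.

Lemma cell_a_upper a d x (g : G) : val g 1 0 != 0 ->
  cell_a (upper a d x * g)%g = val a * cell_a g.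
Proof.
move=> c0; rewrite /cell_a cell_z_upper val_mulG !mulr22E /= !mx22E.
have E : val g 1 0 * cell_z g = val g 1 1 by rewrite /cell_z mulVKr ?divD.
by rewrite -E mulrDl mulrBr !mulrA opprD addrACA subrr addr0.
Qed.

Definition in_cell (g : G) : Prop := val g 1 0 != 0 /\ dideal 0 (cell_z g).

(** The vector of the induced space with value [u] at [weyl] on which the
    pro-p Iwahori subgroup acts by its character; its support is the set
    of [in_cell]. *)
Definition cell_fun (u : W) (g : G) : W :=
  if `[< in_cell g >] then
    psi (cell_z g) *: sigma (dunit (cell_a g)) (dunit (val g 1 0)) u
  else 0.

Lemma in_cell_upper a d x (g : G) : in_cell (upper a d x * g)%g <-> in_cell g.
Proof.
rewrite /in_cell cell_z_upper val_mulG mulr22E /= !mx22E mul0r add0r.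
have d0 := unit_neq0 d; suff -> : (uval d * val g 1 0 != 0) = (val g 1 0 != 0) by [].
have [->|c0] := eqVneq (val g 1 0) 0; first by rewrite mulr0 eqxx.
by rewrite mulD_neq0.
Qed.

Lemma cell_fun_upper u a d x (g : G) : cell_fun u (upper a d x * g)%g = sigma a d (cell_fun u g).
Proof.
rewrite /cell_fun; have [h|h] := asboolP (in_cell g); last first.
  by rewrite asboolF ?sigma0 // => /in_cell_upper.
rewrite asboolT; last exact/in_cell_upper.
have c0 := h.1; have [a0 _] := big_cellP divD c0.
rewrite cell_z_upper.
rewrite cell_a_upper //.
have -> : val (upper a d x * g)%g 1 0 = val d * val g 1 0.
  by rewrite val_mulG mulr22E /= !mx22E mul0r add0r.
rewrite [RHS]sigmaZ.
rewrite -(sigmaM hF divD) (dunitM divD (unit_neq0 a) a0) (dunitM divD (unit_neq0 d) c0).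
by rewrite (dunitE divD a) (dunitE divD d).
Qed.

Lemma cell_fun_weyl u z : dideal 0 z -> cell_fun u (weyl * upper_unip z)%g = psi z *: u.
Proof.
move=> hz; pose h := (weyl * upper_unip z)%g.
have hE : [/\ val h 0 0 = 0, val h 0 1 = 1, val h 1 0 = 1 & val h 1 1 = z].
  by rewrite /h !val_mulG !mulr22E upper_unipE /= !mx22E !(mulr0, mulr1, mul0r, mul1r, addr0, add0r).
case: hE => h00 h01 h10 h11.
have zE : cell_z h = z by rewrite /cell_z h10 h11 invr1 mul1r.
have aE : cell_a h = 1 by rewrite /cell_a h00 h01 mul0r subr0.
rewrite /cell_fun asboolT; last by split; rewrite ?h10 ?oner_neq0 // zE.
rewrite -/h zE aE h10.
have -> : dunit (1 : D) = 1%g by apply: val_inj; rewrite dunitK ?oner_neq0.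
by rewrite (sigma1 hF divD dz1 dz2).
Qed.

Lemma cell_fun_weyl0 u z : ~ dideal 0 z -> cell_fun u (weyl * upper_unip z)%g = 0.
Proof.
move=> hz; rewrite /cell_fun asboolF // => -[_]; rewrite /cell_z.
by rewrite !val_mulG !mulr22E upper_unipE /= !mx22E !(mulr0, mulr1, mul0r, mul1r, addr0, add0r) invr1 mul1r.
Qed.

Lemma cell_fun1 u : cell_fun u 1%g = 0.
Proof. by rewrite /cell_fun asboolF // => -[]; rewrite one22E eqxx. Qed.

Lemma in_cell_Iwahori1 g k : Iw1 k -> in_cell g -> in_cell (g * k)%g /\
  forall u, cell_fun u (g * k)%g = psi (val k 0 1) *: cell_fun u g.
Proof.
move=> hk [c0 hz]; have [_ gE] := big_cellP divD c0.
have [h10 h10' ha ha' [hz' hpsi]] := weyl_cell hk hz.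
have -> : (g * k)%g = (upper (dunit (cell_a g)) (dunit (val g 1 0)%R) (val g 0 0)%R *
   (weyl * upper_unip (cell_z g) * k))%g by rewrite mulgA -gE.
split; first by apply/in_cell_upper.
move=> u; rewrite cell_fun_upper [in RHS]gE cell_fun_upper -sigmaZ; congr (sigma _ _ _).
have Ew := cell_fun_weyl u hz; rewrite Ew /cell_fun asboolT; last by [].
rewrite hpsi.
by rewrite (sigma_pro hF divD dz1 dz2) ?dunitK // scalerA.
Qed.

(** The support is stable because the subgroup is stable under inversion. *)
Lemma cell_fun_Iwahori1 u g k : Iw1 k -> cell_fun u (g * k)%g = psi (val k 0 1) *: cell_fun u g.
Proof.
move=> hk; have [h|h] := pselect (in_cell g); first by have [_ ->] := in_cell_Iwahori1 hk h.
have h' : ~ in_cell (g * k)%g.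
  move=> h'; apply: h; have [] := in_cell_Iwahori1 (Iwahori1V hF divD hk) h'.
  by rewrite mulgK.
by rewrite /cell_fun !asboolF ?scaler0.
Qed.

Lemma nbhsG_congruence (k : G) : nbhsG (dideal 0) (unif v) k ->
  forall i j, dideal 1 ((val k - 1) i j).
Proof.
move=> h i j; have [x hx ->] := h i j.
have := didealZ hF divD (frac_ideal_unifz hF 1) hx; rewrite expr1z mul1r addr0.
by apply: dideal_le; have := dimD_gt0 D; lia.
Qed.

Lemma cell_fun_ind u : cell_fun u \in ind_space v q (dideal 0) tau1 tau2.
Proof.
apply/asboolP; split=> [b g a d x bE|].
  have -> : b = upper a d x by apply: val_inj.
  exact: cell_fun_upper.
exists (unif v); first exact: (unif_neq0 hF).
move=> k g /nbhsG_congruence hk.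
rewrite cell_fun_Iwahori1; last exact: (congruence_Iwahori1 hF divD).
rewrite psi_p ?scale1r //.
have -> : val k 0 1 = (val k - 1) 0 1 by rewrite !mxE subr0.
exact: hk.
Qed.

Definition cell_vector (u : W) : IV := Submod (cell_fun_ind u).

Lemma ev_cell_vector u g : ev (cell_vector u) g = cell_fun u g. Proof. by []. Qed.

Local Notation inv := (psi0_invariants (dideal 0) (dideal 1) psi pi).

Lemma cell_vector_inv u : (cell_vector u : submod _) \in inv.
Proof.
apply/asboolP => k hk; apply: ev_inj => g.
by rewrite ev_pi ev_scale !ev_cell_vector cell_fun_Iwahori1.
Qed.

(** At 1, invariance on the left under [N] conflicts with the non-trivial
    character on the right. Off the integral points, [weyl * upper_unip z]
    is the product of an upper triangular matrix and an element of the
    Iwahori subgroup on which the character is trivial. *)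
Lemma invariant_values (f : IV) : f \in inv -> ev f 1%g = 0 /\
  (forall z, ev f (weyl * upper_unip z)%g = if `[< dideal 0 z >] then psi z *: ev f weyl else 0).
Proof.
move=> /asboolP hf.
have evI k g : Iw1 k -> ev f (g * k)%g = psi (val k 0 1) *: ev f g.
  by move=> hk; rewrite -ev_pi -ev_scale; congr (ev _ g); exact: hf.
have f1 : ev f 1%g = 0.
  have [x hx nx] := psi_nt.
  have := evI (upper_unip x) 1%g (upper_unip_Iwahori1 hF divD hx); rewrite upper_unipE mx22E mul1g.
  rewrite -{1}[upper_unip x]mulg1 ev_upper (sigma1 hF divD dz1 dz2) => /eqP.
  rewrite -subr_eq0 -{1}[ev f 1%g]scale1r -scalerBl scaler_eq0 subr_eq0 eq_sym (negPf nx) /=.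
  by move/eqP.
split=> // z; have [hz|hz] := asboolP (dideal 0 z).
  by rewrite evI ?upper_unipE ?mx22E //; exact: (upper_unip_Iwahori1 hF divD).
have [z0 hi] := notin_dideal0_inv hF divD hz; apply: ev_weyl_low => //.
by rewrite -[lower_unip _]mul1g evI ?f1 ?scaler0 //; exact: (lower_unip_Iwahori1 hF divD).
Qed.

Local Notation rel := (lspan (twisted_relations psi pi)).

Lemma mem_lspan (K : fieldType) (V : lmodType K) (A : set V) x : A x -> x \in lspan A.
Proof.
move=> Ax; apply/asboolP; exists 1%N, (fun=> 1), (fun=> x); split=> //.
by rewrite big_ord1 scale1r.
Qed.

Lemma twisted_relation_mem b (f : IV) : pi (upper_unip b) f - psi b *: f \in rel.
Proof. by apply: mem_lspan; exists (upper_unip b), b, f; rewrite upper_unipE. Qed.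

(** Up to the factor [size s], the projection to the vectors on which a
    lattice in [N] acts by [psi]. *)
Definition twisted_average (s : seq D) (f : IV) : IV := \sum_(x <- s) psi (- x) *: pi (upper_unip x) f.

(** Modulo the relations, [upper_unip x] acts as the scalar [psi x]. *)
Lemma twisted_average_rel s f : twisted_average s f - (size s)%:R *: f \in rel.
Proof.
rewrite /twisted_average; elim: s => [|x s IH]; first by rewrite big_nil scale0r subr0 rpred0.
rewrite big_cons /= -nat1r scalerDl scale1r opprD addrACA; apply: rpredD => //.
have -> : psi (- x) *: pi (upper_unip x) f - f = psi (- x) *: (pi (upper_unip x) f - psi x *: f).
  by rewrite scalerBr scalerA psiNl scale1r.
by apply: rpredZ; exact: twisted_relation_mem.
Qed.

(** Invariance under the lattice [L l] in [N], which allows summation over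
    finite quotients. *)
Definition level (l : int) (f : IV) : Prop := forall g t, L l t -> ev f (g * upper_unip t)%g = ev f g.

Lemma level_ex (f : IV) : exists l : nat, level l%:Z f.
Proof. by have [l hl] := ev_upper_unip_smooth f; exists l. Qed.

Lemma level_le k l f : k <= l -> level k f -> level l f.
Proof. by move=> kl h g t Lt; apply: h; exact: lattice_le Lt. Qed.

Lemma deep_lattice : exists l : nat, forall t, L l%:Z t -> dideal 1 t.
Proof.
have [M hM] := lattice_dideal hF divD; exists (M + 1)%N => t /hM.
by apply: dideal_le; have := dimD_gt0 D; nia.
Qed.

(** The Whittaker functional: up to a positive factor, the integral of [psi
    x]^-1 times the value at [weyl * upper_unip x]. *)
Definition whittaker_sum (s : seq D) (f : IV) : W := \sum_(x <- s) psi (- x) *: ev f (weyl * upper_unip x)%g.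

Lemma ev_twisted_average s f g : ev (twisted_average s f) g = \sum_(x <- s) psi (- x) *: ev f (g * upper_unip x)%g.
Proof. by rewrite /twisted_average ev_sum. Qed.

Section Averages.
Variables (k l : int) (s : seq D).
Hypothesis hs : averages (L k) (L l) s.
Hypothesis l_deep : forall t, L l t -> dideal 1 t.

(** Translation invariance of the sum turns a translation of [f] into the
    factor [psi z]. *)
Lemma whittaker_sum_translate f z : level l f -> L k z ->
  \sum_(x <- s) psi (- x) *: ev f (weyl * upper_unip (x + z))%g = psi z *: whittaker_sum s f.
Proof.
move=> hf hz; have [_ _ h] := hs.
pose a (y : D) : W := psi (- y) *: ev f (weyl * upper_unip y)%g.
rewrite /whittaker_sum -[X in psi z *: X]/(\sum_(x <- s) a x).
rewrite -(h W a _ z hz) => [|x t Lt]; last first.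
  rewrite /a upper_unipD mulgA (hf _ _ Lt) opprD psiD [psi (- t)]psi_p ?mulr1 //.
  by apply/(didealN hF divD)/l_deep.
rewrite scaler_sumr; apply: eq_bigr => x _.
have Ez : psi z * psi (- (x + z)) = psi (- x).
  by rewrite opprD psiD mulrCA [psi z * _]mulrC psiNl mulr1.
by rewrite /a -Ez -scalerA.
Qed.

Lemma whittaker_sum_rel f b : level l f -> L k b -> whittaker_sum s (pi (upper_unip b) f - psi b *: f) = 0.
Proof.
move=> hf hb; rewrite /whittaker_sum.
under eq_bigr => x _ do rewrite ev_add ev_opp ev_scale ev_pi -mulgA -upper_unipD scalerBr.
rewrite sumrB whittaker_sum_translate // scaler_sumr; apply/eqP; rewrite subr_eq0; apply/eqP.
by apply: eq_bigr => x _; rewrite !scalerA mulrC.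
Qed.

(** Some element of [s] lies in the small lattice, hence is integral, so the
    count is positive. *)
Lemma cell_count : (forall t, dideal 0 t -> L k t) -> exists2 N : nat, (0 < N)%N &
  forall a : W, \sum_(x <- s) (if `[< dideal 0 x >] then a else 0) = N%:R *: a.
Proof.
move=> Ok; exists (count (fun x => `[< dideal 0 x >]) s); last first.
  move=> a; elim: (s) => [|x s' IH]; first by rewrite big_nil scale0r.
  rewrite big_cons IH /= natrD scalerDl; congr (_ + _).
  by case: asboolP => _; rewrite ?scale1r ?scale0r.
rewrite -has_count; apply/hasP.
have [r rs hr] : exists2 r, r \in s & L l (0 - r).
  apply: averages_repr hs _; [exact: (latticeN hF)|exact: lattice0|exact: (latticeB hF)|exact: lattice0].
exists r => //; apply/asboolP; rewrite -[r]opprK; apply: (didealN hF divD).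
by apply: (dideal_le ler01); apply: l_deep; rewrite -sub0r.
Qed.

End Averages.

Lemma whittaker_sum_inv (f : IV) k l s : f \in inv -> averages (L k) (L l) s ->
  (forall t, L l t -> dideal 1 t) -> (forall t, dideal 0 t -> L k t) ->
  whittaker_sum s f = 0 -> ev f weyl = 0.
Proof.
move=> fi hs hl hk w0; have [N N0 hN] := cell_count hs hl hk.
have [_ fz] := invariant_values fi; move: w0; rewrite /whittaker_sum.
have E x : psi (- x) *: ev f (weyl * upper_unip x)%g = if `[< dideal 0 x >] then ev f weyl else 0.
  by rewrite fz; case: asboolP => _; rewrite ?scaler0 // scalerA psiNl scale1r.
under eq_bigr do rewrite E; rewrite hN => /eqP.
by rewrite scaler_eq0 pnatr_eq0 eqn0Ngt N0 /= => /eqP.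
Qed.

Lemma invariant_weyl0 (f : IV) : f \in inv -> ev f weyl = 0 -> f = 0.
Proof.
move=> fi fw; have [f1 fz] := invariant_values fi.
apply: ev_determined; rewrite ?ev0 // => z.
by rewrite fz fw scaler0 ev0; case: asboolP.
Qed.

(** Over a lattice that contains all the points of [N] occurring in the
    relations, the Whittaker functional vanishes at [f]; on invariants it
    is a positive multiple of the value at [weyl]. *)
Lemma whittaker_inj (f : IV) : f \in inv -> f \in rel -> f = 0.
Proof.
move=> fi /asboolP[n [c [u [hu fE]]]]; apply: invariant_weyl0 => //.
have H (i : 'I_n) : exists p : D * IV, u i = pi (upper_unip p.1) p.2 - psi p.1 *: p.2.
  have [g [b [x [gE ->]]]] := hu i; exists (b, x) => /=.
  by have -> : g = upper_unip b by apply: val_inj; rewrite gE upper_unipE.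
have [p hp] := choice H.
have H1 (i : 'I_n) : exists k : nat, L (- k%:Z) (p i).1 by exact: lattice_exhaust.
have [kk hkk] := choice H1.
have H2 (i : 'I_n) : exists l : nat, level l%:Z (p i).2 by exact: level_ex.
have [ll hll] := choice H2.
have [M hM] := dideal_lattice hF divD; have [l0 hl0] := deep_lattice.
pose k : int := - ((\sum_i kk i) + M)%N%:Z; pose l : int := ((\sum_i ll i) + l0)%N%:Z.
have kl : k <= l by rewrite /k /l; lia.
have [s hs] := lattice_averages hF D kl.
have hl t : L l t -> dideal 1 t by move=> Lt; apply: hl0; apply: lattice_le Lt; rewrite /l; lia.
have hk t : dideal 0 t -> L k t by move=> /hM; apply: lattice_le; rewrite /k; lia.
apply: (whittaker_sum_inv fi hs hl hk); rewrite fE /whittaker_sum.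
under eq_bigr => x _ do rewrite ev_sum scaler_sumr.
rewrite exchange_big big1 // => i _.
under eq_bigr => x _ do rewrite ev_scale scalerA mulrC -scalerA.
rewrite -scaler_sumr -/(whittaker_sum s (u i)) hp (whittaker_sum_rel hs hl) ?scaler0 //.
  by apply: level_le (hll i); rewrite /l (bigD1 i) //=; lia.
by apply: lattice_le (hkk i); rewrite /k (bigD1 i) //=; lia.
Qed.

(** If [z] is a point of the lattice, the average has value [psi z] times the
    Whittaker sum at [weyl * upper_unip z]; at the other points of [N] and
    at 1 it vanishes. *)
Lemma twisted_average_eq (f f' : IV) k l s : averages (L k) (L l) s ->
  (forall t, L l t -> dideal 1 t) -> level l f -> level l f' ->
  ev f 1%g = 0 -> ev f' 1%g = 0 ->
  (forall x, ~ L k x -> ev f (weyl * upper_unip x)%g = 0) ->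
  (forall x, ~ L k x -> ev f' (weyl * upper_unip x)%g = 0) ->
  whittaker_sum s f = whittaker_sum s f' -> twisted_average s f = twisted_average s f'.
Proof.
move=> hs hl hf hf' f1 f1' far far' E.
have [_ sk _] := hs.
have at1 (u : IV) x : ev u 1%g = 0 -> ev u (1 * upper_unip x)%g = 0.
  by move=> u1; rewrite mul1g -[upper_unip x]mulg1 ev_upper u1 sigma0.
apply: ev_determined => [|z]; rewrite !ev_twisted_average.
  by apply: eq_bigr => x _; rewrite !at1.
have E1 (u : IV) : \sum_(x <- s) psi (- x) *: ev u (weyl * upper_unip z * upper_unip x)%g =
    \sum_(x <- s) psi (- x) *: ev u (weyl * upper_unip (x + z))%g.
  by apply: eq_bigr => x _; rewrite -mulgA -upper_unipD addrC.
rewrite !E1; have [hz|hz] := pselect (L k z).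
  by rewrite !(whittaker_sum_translate hs hl) // E.
have nz x : x \in s -> ~ L k (x + z).
  by move=> /sk Lx h; apply: hz; rewrite -(addKr x z) addrC; apply: (latticeB hF).
by rewrite !big_seq; apply: eq_bigr => x /nz h; rewrite far // far'.
Qed.

(** Left invariance under [N] fixes the value at 1, so subtracting a multiple
    of one relation with [psi x != 1] removes it. *)
Lemma vanish_at1 (f : IV) : exists2 f' : IV, ev f' 1%g = 0 & f - f' \in rel.
Proof.
have [x hx nx] := psi_nt; have nx' : 1 - psi x != 0 by rewrite subr_eq0 eq_sym.
exists (f - (1 - psi x)^-1 *: (pi (upper_unip x) f - psi x *: f)); last first.
  by rewrite opprB addrC subrK; apply: rpredZ; exact: twisted_relation_mem.
rewrite ev_add ev_opp ev_scale ev_add ev_opp ev_scale ev_pi mul1g.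
rewrite -{1}[upper_unip x]mulg1 ev_upper (sigma1 hF divD dz1 dz2).
by rewrite -{2}[ev f 1%g]scale1r -scalerBl scalerA mulVf // scale1r subrr.
Qed.

(** By smoothness [f] vanishes near 1, hence at the points of [weyl * N] that
    are close to the Borel subgroup. *)
Lemma compact_support (f : IV) : ev f 1%g = 0 ->
  exists k : nat, forall x, ~ L (- k%:Z) x -> ev f (weyl * upper_unip x)%g = 0.
Proof.
move=> f1; have [y y0 hy] := ev_smooth f; have [M hM] := dideal_lattice hF divD.
exists (M + `|v y|)%N => x hx.
have hyx : ~ dideal 0 (y *: x).
  move=> h; apply: hx; have := latticeZ hF (frac_idealV hF y0) (hM _ h).
  by rewrite scalerA mulVf // scale1r; apply: lattice_le; lia.
have [yx0 hi] := notin_dideal0_inv hF divD hyx.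
have x0 : x != 0 by apply: contraNneq yx0 => ->; rewrite scaler0.
apply: ev_weyl_low => //; rewrite -[lower_unip _]mul1g hy //; apply: ord2_all;
  rewrite !mxE /= ?subrr ?subr0; try by exists 0; rewrite ?scaler0 //; left.
exists (y *: x)^-1; first exact: dideal1_sub hi.
by rewrite invrZ ?unitfE ?divD // scalerA divff // scale1r.
Qed.

(** After removing the value at 1, the class of [f] is a non-zero multiple of
    the class of an average, which depends only on the Whittaker sum;
    choose the invariant vector with the same Whittaker sum. *)
Lemma whittaker_surj (f : IV) : exists2 f0 : IV, f0 \in inv & f - f0 \in rel.
Proof.
have relT (a b c : IV) : a - b \in rel -> b - c \in rel -> a - c \in rel.
  by move=> ab bc; rewrite -(subrK b a) -addrA; exact: rpredD.
have [f1 f11 ff1] := vanish_at1 f.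
suff [f0 f0i h] : exists2 f0 : IV, f0 \in inv & f1 - f0 \in rel.
  by exists f0 => //; exact: relT ff1 h.
have [k1 hk1] := compact_support f11; have [M hM] := dideal_lattice hF divD.
have [l1 hl1] := level_ex f1; have [l0 hl0] := deep_lattice.
pose k : int := - (k1 + M)%N%:Z; pose l : int := (l1 + l0)%N%:Z.
have kl : k <= l by rewrite /k /l; lia.
have [s hs] := lattice_averages hF D kl.
have hl t : L l t -> dideal 1 t by move=> Lt; apply: hl0; apply: lattice_le Lt; rewrite /l; lia.
have hk t : dideal 0 t -> L k t by move=> /hM; apply: lattice_le; rewrite /k; lia.
have [N N0 hN] := cell_count hs hl hk.
have N0' : N%:R != 0 :> C by rewrite pnatr_eq0 -lt0n.
(* The scalar gives [f0] and [f1] the same Whittaker sum. *)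
pose f0 := cell_vector (N%:R^-1 *: whittaker_sum s f1).
exists f0; first exact: cell_vector_inv.
have f0w : whittaker_sum s f0 = whittaker_sum s f1.
  rewrite {1}/whittaker_sum.
  have E x : psi (- x) *: ev f0 (weyl * upper_unip x)%g =
      if `[< dideal 0 x >] then N%:R^-1 *: whittaker_sum s f1 else 0.
    rewrite /f0 ev_cell_vector; case: asboolP => hx.
      by rewrite cell_fun_weyl // scalerA psiNl scale1r.
    by rewrite cell_fun_weyl0 // scaler0.
  by under eq_bigr do rewrite E; rewrite hN scalerA divff // scale1r.
have lf0 : level l f0.
  move=> g t Lt; rewrite /f0 !ev_cell_vector cell_fun_Iwahori1; last first.
    by apply: (upper_unip_Iwahori1 hF divD); apply: (dideal_le ler01); exact: hl.
  by rewrite upper_unipE mx22E psi_p ?scale1r //; exact: hl.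
have A : twisted_average s f1 = twisted_average s f0.
  apply: (twisted_average_eq hs hl) => //.
  - by apply: level_le hl1; rewrite /l; lia.
  - exact: cell_fun1.
  - by move=> x hx; apply: hk1 => h; apply: hx; apply: lattice_le h; rewrite /k; lia.
  - by move=> x hx; rewrite ev_cell_vector cell_fun_weyl0 // => /hk.
have s0 : (size s)%:R != 0 :> C by have [s0 _ _] := hs; rewrite pnatr_eq0 size_eq0.
have r1 := twisted_average_rel s f1; have r0 := twisted_average_rel s f0; rewrite A in r1.
have E : (twisted_average s f0 - (size s)%:R *: f0) + (-1) *: (twisted_average s f0 - (size s)%:R *: f1) =
    (size s)%:R *: (f1 - f0).
  by rewrite scaleN1r opprB addrC addrA subrK -scalerBr.
have -> : f1 - f0 = (size s)%:R^-1 *: ((size s)%:R *: (f1 - f0)).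
  by rewrite scalerA mulVf // scale1r.
by rewrite -E; apply: rpredZ; apply: rpredD => //; apply: rpredZ.
Qed.

Lemma diagV (d : Dx) : diag (d^-1)%g = ((diag d)^-1)%g.
Proof. by apply/esym/invg_uniq; rewrite -diagM mulgV diag1. Qed.

Lemma invariants_stable : stable (res_rep pi (diag1 D)) inv.
Proof.
move=> d f /asboolP hf; apply/asboolP => k hk.
pose k' := (diag (d^-1)%g * k * (diag (d^-1)%g)^-1)%g.
have hk' : Iw1 k' by exact: (Iwahori1_conj hF divD).
have kE : (k * diag d = diag d * k')%g.
  by rewrite /k' diagV invgK !mulgA mulgV mul1g.
rewrite -[LHS]repM kE repM hf // linearZ; congr (_ *: _).
rewrite /psi0 /k' diag_conj_entry // unit_valV //.
by apply: psi_conj; rewrite invD_neq0 ?unit_neq0.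
Qed.

Lemma relations_stable : stable (res_rep pi (diag1 D)) rel.
Proof.
move=> d f /asboolP[n [c [u [hu ->]]]].
rewrite linear_sum; apply: rpred_sum => i _.
rewrite linearZ; apply: rpredZ; have [g [b [x [gE ->]]]] := hu i.
have -> : g = upper_unip b by apply: val_inj; rewrite gE upper_unipE.
pose b' := val d * b * (val d)^-1.
have E : (diag d * upper_unip b = upper_unip b' * diag d)%g.
  have -> : upper_unip b' = (diag d * upper_unip b * (diag d)^-1)%g.
    apply: val_inj; apply: mx22_eq; rewrite diag_conj_entry // !upper_unipE !mx22E //.
    - by rewrite mulr1 divrr // divD // unit_neq0.
    - by rewrite mulr0 mul0r.
    - by rewrite mulr1 divrr // divD // unit_neq0.
  by rewrite -mulgA mulVg mulg1.
suff key : res_rep pi (diag1 D) d (pi (upper_unip b) x - psi b *: x : IV) =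
    pi (upper_unip b') (pi (diag d) x) - psi b' *: pi (diag d) x.
  exact: (eq_ind_r (fun y => y \in rel) (twisted_relation_mem b' (pi (diag d) x)) key).
apply: ev_inj => h.
change (ev x (h * diag d * upper_unip b)%g - psi b *: ev x (h * diag d)%g =
  ev x (h * upper_unip b' * diag d)%g - psi b' *: ev x (h * diag d)%g).
by rewrite -!mulgA E psi_conj // unit_neq0.
Qed.

Lemma whittaker_iso : exists (hI : stable (res_rep pi (diag1 D)) inv)
    (hN : stable (res_rep pi (diag1 D)) rel),
  rep_iso (sub_rep hI) (quot_rep hN) (fun f : submod inv => qproj rel (val f)).
Proof.
exists invariants_stable, relations_stable.
pose phi (f : submod inv) := qproj rel (val f).
have lin : linear phi by move=> a x y; rewrite /phi linearP.
have inj : injective phi.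
  move=> x y /qproj_eq h; apply/val_inj/eqP; rewrite -subr_eq0; apply/eqP.
  apply: whittaker_inj => //.
  have -> : val x - val y = val (x - y) by rewrite raddfB.
  exact: submod_valP.
have surj z : exists f, phi f = z.
  have [f <-] := qproj_surj z; have [f0 f0i h] := whittaker_surj f.
  exists (Submod f0i); apply/esym/qproj_eq; exact: h.
split; first exact: lin.
  have [psi' hpsi'] := choice surj.
  by exists psi' => // x; apply: inj; rewrite hpsi'.
by move=> d x; apply/esym; exact: (quot_actE relations_stable d (val x)).
Qed.

End Whittaker.

Theorem theorem1p2 (R : realType)
    (F : fieldType) (v : F -> int) (q : nat) (hF : local_field v q)
    (D : falgType F) (n : nat) (hD : central_division_algebra D n)
    (oD : set D) (hO : maximal_order v oD)
    (pD : set D) (hP : maximal_ideal oD pD)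
    (Trd : D -> F) (hTrd : reduced_trace n Trd)
    (psiF : F -> R[i]) (hpsiF : level_one_character v psiF)
    (V1 V2 : lmodType R[i])
    (tau1 : rep (unit_group D) V1) (tau2 : rep (unit_group D) V2)
    (irr1 : irreducible tau1) (irr2 : irreducible tau2)
    (sm1 : smooth oD tau1) (sm2 : smooth oD tau2)
    (dz1 : depth_zero tau1 pD) (dz2 : depth_zero tau2 pD) :
  let psi : D -> R[i] := fun x => psiF (Trd x) in
  let pi := parabolic_induction hF (max_is_order hO) tau1 tau2 in
  let piD := res_rep pi (diag1 D) in
  let invariants := psi0_invariants oD pD psi pi in
  let relations := lspan (twisted_relations psi pi) in
  exists (hI : stable piD invariants) (hN : stable piD relations),
    rep_iso (sub_rep hI) (quot_rep hN)
      (fun f : submod invariants => qproj relations (val f)).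
Proof.
have divD := division hD.
have dimD := index_n hD.
have n0 : (0 < n)%N by have := dimD_gt0 D; rewrite dimD; case: (n).
have [psi_p [b [hb Tb0 Tb1]]] := Trd_residue hF divD n0 dimD hTrd.
have [Tlin Tcomm] := Trd_spec hTrd.
have TZ a x : Trd (a *: x) = a * Trd x.
  have T0 : Trd 0 = 0.
    have := Tlin 1 0 0; rewrite scale1r mul1r addr0 -[X in X = _]addr0.
    by move/addrI.
  by rewrite -[a *: x]addr0 Tlin T0 addr0.
have TD x y : Trd (x + y) = Trd x + Trd y by rewrite -{1}[x]scale1r Tlin mul1r.
have oDE := maximal_orderE hF divD hO; have pDE := maximal_idealE hF divD hO hP.
move: (max_is_order hO) dz1 dz2 => hO'; clear sm1 sm2 hP hO.
subst pD; subst oD => dz1 dz2 psi pi piD invariants relations.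
apply: whittaker_iso => //.
- by move=> x y; rewrite /psi TD (charD hpsiF).
- by move=> x /psi_p; exact: (char_trivial hpsiF).
- have [x hx nx] := char_nontrivial hpsiF.
  have T0 : Trd b != 0 by apply/eqP => E; apply: Tb1; rewrite E; left.
  exists ((x / Trd b) *: b); last by rewrite /psi TZ divfK.
  apply: (didealZ0 hF divD) => //; apply: (frac_ideal_div hF) => //; rewrite add0r.
  apply: frac_ideal_le hx; rewrite leNgt; apply/negP => lt; apply: Tb1; right; lia.
- by move=> x y x0; rewrite /psi Tcomm mulKr ?divD.
Qed.
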